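(* The congruence-orbits of Jordan nets in $\mathbb{S}^5$ are the orbits of the following eleven pairwise non-congruent nets: $A^{(1)}_{2,0,1}=\langle a^2+b^2+c^2,\,d^2,\,e^2\rangle$, $A^{(1)}_{0,1,1}=\langle a^2+b^2,\,c^2+d^2,\,e^2\rangle$, $A^{(2)}_{1,2,1}=\langle a^2,\,2bc+d^2+e^2,\,b^2\rangle$, $A^{(2)}_{1,0,2}=\langle a^2,\,be+cd,\,b^2+c^2\rangle$, $A^{(2)}_{2,1,1}=\langle a^2+b^2,\,2cd+e^2,\,c^2\rangle$, $A^{(2)}_{3,0,1}=\langle a^2+b^2+c^2,\,de,\,d^2\rangle$, $A^{(3)}_{2,0,1}=\langle 2ac+b^2+d^2+e^2,\,ab,\,a^2\rangle$, $A^{(3)}_{0,1,1}=\langle 2ac+b^2+2de,\,2ab+d^2,\,a^2\rangle$, $B^{(2)}_{1,1,2}=\langle ab,\,2cd+e^2,\,ac\rangle$, $C_{5,1}=\langle 2ae+2bd+c^2,\,a^2,\,b^2\rangle$, $C_{5,2}=\langle 2ae+2bd+c^2,\,ab,\,a^2\rangle$. Moreover, for two nets $\mathcal{L},\mathcal{L}'$ in this list, $\mathcal{L}$ degenerates to $\mathcal{L}'$ if and only if there is a (possibly empty) directed path from $\mathcal{L}$ to $\mathcal{L}'$ in the directed graph with the following edges: $A^{(1)}_{0,1,1}\to A^{(2)}_{1,0,2}$, $A^{(1)}_{0,1,1}\to A^{(2)}_{2,1,1}$, $A^{(1)}_{2,0,1}\to A^{(2)}_{1,2,1}$, $A^{(1)}_{2,0,1}\to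 A^{(2)}_{3,0,1}$, $A^{(2)}_{1,0,2}\to A^{(2)}_{1,2,1}$, $A^{(2)}_{1,0,2}\to A^{(3)}_{0,1,1}$, $A^{(2)}_{2,1,1}\to A^{(3)}_{0,1,1}$, $A^{(2)}_{3,0,1}\to A^{(3)}_{2,0,1}$, $A^{(2)}_{1,2,1}\to A^{(3)}_{2,0,1}$, $A^{(2)}_{1,2,1}\to C_{5,1}$, $A^{(3)}_{0,1,1}\to A^{(3)}_{2,0,1}$, $A^{(3)}_{0,1,1}\to C_{5,1}$, $B^{(2)}_{1,1,2}\to C_{5,2}$, $A^{(3)}_{2,0,1}\to C_{5,2}$, $C_{5,1}\to C_{5,2}$.
   Context: $\mathbb{S}^n$ is the space of complex symmetric $n\times n$ matrices. For an invertible $U\in\mathbb{S}^n$, the product $X\bullet_U Y=\frac12(XU^{-1}Y+YU^{-1}X)$ makes $\mathbb{S}^n$ a unital Jordan algebra with unit $U$. A subspace $\mathcal{L}\subseteq\mathbb{S}^n$ is a Jordan space if it is the image of an injective morphism of unital Jordan algebras $\mathcal{A}\to(\mathbb{S}^n,\bullet_U)$ for some unital Jordan algebra $\mathcal{A}$ and some invertible $U\in\mathbb{S}^n$ (i.e. $\mathcal{L}$ contains an invertible $U$ and is closed under $\bullet_U$). A Jordan net is a Jordan space of dimension $3$. The group $\mathrm{GL}_n(\mathbb{C})$ acts on subspaces of $\mathbb{S}^n$ by congruence, $g\cdot\mathcal{L}=g\mathcal{L}g^\top$; two subspaces are congruent if they lie in the same orbit. A subspace $\mathcal{L}\subseteq\mathbb{S}^5$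 is identified with the space of quadratic forms $(a,b,c,d,e)\mathcal{L}(a,b,c,d,e)^\top$ in variables $a,b,c,d,e$; $\langle q_1,q_2,q_3\rangle$ denotes the linear span of the forms $q_i$, i.e. the span of the corresponding symmetric matrices. Degeneration: let $\mathcal{L},\mathcal{L}'\subseteq\mathbb{S}^n$ be Jordan spaces of the same dimension $m$ with bases $X_1,\dots,X_m$ and $X_1',\dots,X_m'$. Then $\mathcal{L}$ degenerates to $\mathcal{L}'$, written $\mathcal{L}\to\mathcal{L}'$, if there exist $P\in\mathrm{GL}_n(\mathbb{C}[t^{\pm1}])$ and $Q\in\mathrm{GL}_m(\mathbb{C}[t^{\pm1}])$ such that the entries of $(Y_1,\dots,Y_m):=(PX_1P^\top,\dots,PX_mP^\top)Q$ are matrices with coefficients in $\mathbb{C}[t]$ and $X_i'=\lim_{t\to0}Y_i$ for all $i$. (Equivalently, $\mathcal{L}'$ lies in the closure of the orbit $\mathrm{GL}_n(\mathbb{C})\cdot\mathcal{L}$.) *)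

(* Defs.v *)
From HB Require Import structures.
From mathcomp Require Import all_boot all_order all_algebra fraction.
From mathcomp Require Export complex.
From mathcomp Require Import boolp classical_sets reals topology normedtype.
From mathcomp Require Import ring.

Set Implicit Arguments.
Unset Strict Implicit.
Unset Printing Implicit Defensive.

Import Order.TTheory GRing.Theory Num.Theory.
Import numFieldNormedType.Exports.

Local Open Scope ring_scope.
Local Open Scope classical_set_scope.

Record jordan_algebra (K : fieldType) := JordanAlgebra {
  jcar :> lmodType K;
  jmul : jcar -> jcar -> jcar;
  jone : jcar;
  jmulC : commutative jmul;
  jmul_linear : forall x, linear (jmul x);
  jmul1x : left_id jone jmul;
  jmul_jordan : forall x y,
    jmul (jmul x y) (jmul x x) = jmul x (jmul y (jmul x x)) }.

Definition jprod (K : fieldType) n (U X Y : 'M[K]_n) : 'M[K]_n :=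
  2^-1 *: (X *m invmx U *m Y + Y *m invmx U *m X).

Definition symmetric_space (K : fieldType) n (L : {vspace 'M[K]_n}) : Prop :=
  forall X, X \in L -> X^T = X.

Definition jordan_space (K : fieldType) n (L : {vspace 'M[K]_n}) : Prop :=
  symmetric_space L /\
  exists2 U : 'M[K]_n, U \in unitmx /\ U^T = U &
  exists (A : jordan_algebra K) (phi : {linear A -> 'M[K]_n}),
    [/\ injective phi,
        forall x y, phi (jmul x y) = jprod U (phi x) (phi y),
        phi (jone A) = U
      & forall X, X \in L <-> exists x, phi x = X].

Section JordanProduct.
Variables (K : numFieldType) (n : nat) (U : 'M[K]_n).
Hypothesis unitU : U \in unitmx.

Lemma half_double (X : 'M[K]_n) : 2^-1 *: (X + X) = X.
Proof.
by rewrite -{1 2}[X]scale1r -scalerDl scalerA mulVf ?scale1r ?pnatr_eq0.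
Qed.

Lemma jprodC : commutative (jprod U).
Proof. by move=> X Y; rewrite /jprod addrC. Qed.

Lemma jprod_linear X : linear (jprod U X).
Proof.
move=> a Y Z; rewrite /jprod mulmxDr !mulmxDl -!scalemxAr -!scalemxAl.
rewrite addrACA -[a *: _ + a *: _]scalerDr [LHS]scalerDr !scalerA.
by rewrite [_ * a]mulrC.
Qed.

Lemma jprod1x : left_id U (jprod U).
Proof.
move=> X; rewrite /jprod mulmxV // mul1mx mulmxKV //.
exact: half_double.
Qed.

Lemma jprodxx X : jprod U X X = X *m invmx U *m X.
Proof.
by rewrite /jprod half_double.
Qed.

Lemma jprod_jordan X Y :
  jprod U (jprod U X Y) (jprod U X X) = jprod U X (jprod U Y (jprod U X X)).
Proof.
rewrite jprodxx /jprod; congr (_ *: _).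
rewrite -!scalemxAl -!scalemxAr -?scalemxAl -!scalerDr; congr (_ *: _).
rewrite !(mulmxDl, mulmxDr) !mulmxA.
set A := X *m _ *m Y *m _ *m X *m _ *m X.
set B := Y *m _ *m X *m _ *m X *m _ *m X.
set C := X *m _ *m X *m _ *m X *m _ *m Y.
set D := X *m _ *m X *m _ *m Y *m _ *m X.
by rewrite -!addrA; congr (_ + _); rewrite addrCA.
Qed.
End JordanProduct.

Lemma jordan_spaceP (K : numFieldType) n (L : {vspace 'M[K]_n}) :
  jordan_space L <->
  symmetric_space L /\
  exists U, [/\ U \in L, U \in unitmx
    & forall X Y, X \in L -> Y \in L -> jprod U X Y \in L].
Proof.
split=> [[symL [U [unitU _] [A [phi [_ phiM phi1 LP]]]]]|[symL [U [LU unitU LM]]]].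
  split=> //; exists U; split=> //; first by apply/LP; exists (jone A).
  move=> _ _ /LP [x <-] /LP [y <-]; apply/LP.
  by exists (jmul x y); rewrite phiM.
split=> //; exists U; first by split; last exact: symL.
pose m (x y : subvs_of L) := vsproj L (jprod U (vsval x) (vsval y)).
have mE x y : vsval (m x y) = jprod U (vsval x) (vsval y).
  by rewrite vsprojK // LM ?subvsP.
have mC : commutative m by move=> x y; apply: subvs_inj; rewrite !mE jprodC.
have ml x : linear (m x).
  by move=> a y z; apply: subvs_inj; rewrite !linearP /= !mE linearP /= jprod_linear.
have m1 : left_id (Subvs LU) m.
  by move=> x; apply: subvs_inj; rewrite mE jprod1x.
have mJ x y : m (m x y) (m x x) = m x (m y (m x x)).
  by apply: subvs_inj; rewrite !mE jprod_jordan.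
exists (JordanAlgebra mC ml m1 mJ), (@vsval _ _ L); split=> //.
- exact: subvs_inj.
- move=> X; split=> [LX|[x <-]]; last exact: subvsP.
  by exists (Subvs LX).
Qed.

Definition jordan_net (K : fieldType) n (L : {vspace 'M[K]_n}) : Prop :=
  jordan_space L /\ \dim L = 3%N.

Definition congr_act (K : fieldType) n (g : 'M[K]_n) (L : {vspace 'M[K]_n}) :
    {vspace 'M[K]_n} :=
  (linfun (mulmxr g^T \o mulmx g) @: L)%VS.

Definition congruent (K : fieldType) n (L L' : {vspace 'M[K]_n}) : Prop :=
  exists2 g : 'M[K]_n, g \in unitmx & L' = congr_act g L.

Lemma mem_congr_act (K : fieldType) n (g : 'M[K]_n) (L : {vspace 'M[K]_n}) X :
  X \in congr_act g L <-> exists2 Y, Y \in L & X = g *m Y *m g^T.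
Proof.
split; first by case/memv_imgP => Y LY ->; exists Y; rewrite // lfunE.
by case=> Y LY ->; apply/memv_imgP; exists Y; rewrite // lfunE.
Qed.

(* K[t, t^-1] is the subring of the fraction field of K[t] of all p / t^k. *)
Definition laurent (K : fieldType) (f : {fraction {poly K}}) : Prop :=
  exists (p : {poly K}) (k : nat), f = tofrac p / tofrac 'X ^+ k.

Definition laurent_GL (K : fieldType) n (P : 'M[{fraction {poly K}}]_n) : Prop :=
  [/\ P \in unitmx, forall i j, laurent (P i j)
    & forall i j, laurent (invmx P i j)].

(* [Y] is the tuple of polynomial matrices (P X_1 P^T, ..., P X_m P^T) Q.
   Constant base changes on either side can be absorbed into [Q], so it does
   not matter which bases [X] and [X'] are taken. *)
Definition degenerates (K : numFieldType) n (L L' : {vspace 'M[K]_n}) : Prop :=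
  exists (m : nat) (X X' : m.-tuple 'M[K]_n)
         (P : 'M[{fraction {poly K}}]_n) (Q : 'M[{fraction {poly K}}]_m)
         (Y : 'I_m -> 'M[{poly K}]_n),
    [/\ basis_of L X /\ basis_of L' X', laurent_GL P, laurent_GL Q,
        forall j, map_mx (@tofrac _) (Y j) =
          \sum_i Q i j *:
            (P *m map_mx (@tofrac _ \o polyC) (tnth X i) *m P^T)
      & forall j a b, (Y j a b).[t] @[t --> (0 : K)^'] --> tnth X' j a b].

Lemma cvg_horner0P (K : numFieldType) (p : {poly K}) (x : K) :
  p.[t] @[t --> (0 : K)^'] --> x <-> x = p.[0].
Proof.
have ch : continuous (horner p : K -> K).
  elim/poly_ind: p => [|p c IHp] y.
    have -> : horner (0 : {poly K}) = (fun=> 0)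
      by apply/funext => t; rewrite horner0.
    apply: cst_continuous.
  have -> : horner (p * 'X + c%:P) = (fun t => p.[t] * t + c).
    by apply/funext => t; rewrite hornerMXaddC.
  exact: cvgD (cvgM (IHp y) (@cvg_id _ (nbhs y))) (@cvg_cst _ c _ _ _).
have cp : p.[t] @[t --> (0 : K)^'] --> p.[0].
  by apply: cvg_trans (ch 0); apply: cvg_app; exact: cvg_within.
split=> [cx|-> //].
exact: (cvg_unique _ cx cp).
Qed.

(* The symmetric matrix of a quadratic form, by polarization. *)
Definition gram (K : fieldType) n (q : 'rV[K]_n -> K) : 'M[K]_n :=
  \matrix_(i, j) (2^-1 * (q (delta_mx 0 i + delta_mx 0 j)
                          - q (delta_mx 0 i) - q (delta_mx 0 j))).

Lemma gramK (K : numFieldType) n (S : 'M[K]_n) : S^T = S ->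
  gram (fun v => (v *m S *m v^T) 0 0) = S.
Proof.
move=> symS; apply/matrixP => i j; rewrite mxE.
have e a b : ((delta_mx 0 a : 'rV[K]_n) *m S *m (delta_mx 0 b)^T) 0 0 = S a b.
  by rewrite -rowE trmx_delta mxE (bigD1 b) //= !mxE !eqxx mulr1 big1
    ?addr0 // => c; rewrite !mxE => /negPf ->; rewrite mulr0.
have eD (A B : 'M[K]_1) : (A + B) 0 0 = A 0 0 + B 0 0 by rewrite mxE.
rewrite linearD /= !(mulmxDl, mulmxDr) !eD !e.
have -> : S j i = S i j by rewrite -{1}symS mxE.
have -> : S i i + S i j + (S i j + S j j) - S i i - S j j = 2 * S i j by ring.
by rewrite mulKf // pnatr_eq0.
Qed.

Definition form5 (K : fieldType) (f : K -> K -> K -> K -> K -> K) : 'M[K]_5 :=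
  gram (fun v => f (v 0 0) (v 0 1) (v 0 2) (v 0 3) (v 0 4)).

Lemma form5E (K : fieldType) f (i j : 'I_5) :
  let d (k : 'I_5) : 'I_5 -> K := fun l => (l == k)%:R in
  form5 f i j = 2^-1 * (
    f (d i 0 + d j 0) (d i 1 + d j 1) (d i 2 + d j 2) (d i 3 + d j 3)
      (d i 4 + d j 4)
    - f (d i 0) (d i 1) (d i 2) (d i 3) (d i 4)
    - f (d j 0) (d j 1) (d j 2) (d j 3) (d j 4)).
Proof. by rewrite !mxE. Qed.

Inductive net5 :=
  | A1_201 | A1_011
  | A2_121 | A2_102 | A2_211 | A2_301
  | A3_201 | A3_011
  | B2_112
  | C5_1 | C5_2.

Definition net_forms (K : fieldType) (k : net5) :
    seq (K -> K -> K -> K -> K -> K) :=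
  match k with
  | A1_201 => [:: fun a b c d e => a ^+ 2 + b ^+ 2 + c ^+ 2;
                  fun a b c d e => d ^+ 2;
                  fun a b c d e => e ^+ 2]
  | A1_011 => [:: fun a b c d e => a ^+ 2 + b ^+ 2;
                  fun a b c d e => c ^+ 2 + d ^+ 2;
                  fun a b c d e => e ^+ 2]
  | A2_121 => [:: fun a b c d e => a ^+ 2;
                  fun a b c d e => 2 * b * c + d ^+ 2 + e ^+ 2;
                  fun a b c d e => b ^+ 2]
  | A2_102 => [:: fun a b c d e => a ^+ 2;
                  fun a b c d e => b * e + c * d;
                  fun a b c d e => b ^+ 2 + c ^+ 2]
  | A2_211 => [:: fun a b c d e => a ^+ 2 + b ^+ 2;
                  fun a b c d e => 2 * c * d + e ^+ 2;
                  fun a b c d e => c ^+ 2]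
  | A2_301 => [:: fun a b c d e => a ^+ 2 + b ^+ 2 + c ^+ 2;
                  fun a b c d e => d * e;
                  fun a b c d e => d ^+ 2]
  | A3_201 => [:: fun a b c d e => 2 * a * c + b ^+ 2 + d ^+ 2 + e ^+ 2;
                  fun a b c d e => a * b;
                  fun a b c d e => a ^+ 2]
  | A3_011 => [:: fun a b c d e => 2 * a * c + b ^+ 2 + 2 * d * e;
                  fun a b c d e => 2 * a * b + d ^+ 2;
                  fun a b c d e => a ^+ 2]
  | B2_112 => [:: fun a b c d e => a * b;
                  fun a b c d e => 2 * c * d + e ^+ 2;
                  fun a b c d e => a * c]
  | C5_1   => [:: fun a b c d e => 2 * a * e + 2 * b * d + c ^+ 2;
                  fun a b c d e => a ^+ 2;
                  fun a b c d e => b ^+ 2]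
  | C5_2   => [:: fun a b c d e => 2 * a * e + 2 * b * d + c ^+ 2;
                  fun a b c d e => a * b;
                  fun a b c d e => a ^+ 2]
  end.

Lemma net_formsE (K : numFieldType) (k : net5) (i : nat) (v : 'rV[K]_5) :
  let f := nth (fun _ _ _ _ _ => 0) (net_forms K k) i in
  (v *m form5 f *m v^T) 0 0 = f (v 0 0) (v 0 1) (v 0 2) (v 0 3) (v 0 4).
Proof.
move=> f.
have -> : (v *m form5 f *m v^T) 0 0 =
  \sum_(j < 5) \sum_(i < 5) v 0 i * form5 f i j * v 0 j.
  rewrite mxE; apply: eq_bigr => j _; rewrite mxE mulr_suml.
  by apply: eq_bigr => l _; rewrite [v^T _ _]mxE.
rewrite !big_ord_recl !big_ord0.
have -> : lift ord0 (lift ord0 (lift ord0 (lift ord0 ord0))) = 4 :> 'I_5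
  by apply: val_inj.
have -> : lift ord0 (lift ord0 (lift ord0 ord0)) = 3 :> 'I_5 by apply: val_inj.
have -> : lift ord0 (lift ord0 ord0) = 2 :> 'I_5 by apply: val_inj.
have -> : lift ord0 ord0 = 1 :> 'I_5 by apply: val_inj.
have -> : ord0 = 0 :> 'I_5 by apply: val_inj.
rewrite !form5E /=.
move: (v 0 0) (v 0 1) (v 0 2) (v 0 3) (v 0 4) => a b c d e.
have h : 2 != 0 :> K by rewrite pnatr_eq0.
rewrite {}/f; case: i => [|[|[|i]]]; case: k; rewrite /= ?nth_nil; by field.
Qed.

Definition net (K : fieldType) (k : net5) : {vspace 'M[K]_5} :=
  <<map (@form5 K) (net_forms K k)>>%VS.

Definition net_edge (k l : net5) : bool :=
  match k, l with
  | A1_011, (A2_102 | A2_211)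
  | A1_201, (A2_121 | A2_301)
  | A2_102, (A2_121 | A3_011)
  | A2_211, A3_011
  | A2_301, A3_201
  | A2_121, (A3_201 | C5_1)
  | A3_011, (A3_201 | C5_1)
  | B2_112, C5_2
  | A3_201, C5_2
  | C5_1, C5_2 => true
  | _, _ => false
  end.

(* Main.v *)
Require Import Defs.
From mathcomp Require Import all_boot all_order all_algebra fraction.
From mathcomp Require Import boolp reals.
From mathcomp Require Import ring.

Set Implicit Arguments.
Unset Strict Implicit.
Unset Printing Implicit Defensive.

Import Order.TTheory GRing.Theory Num.Theory.

Local Open Scope ring_scope.

(* Congruence by h with h U h^T = 1 turns a Jordan net into a space L of
   symmetric matrices of dimension 3 that contains 1 and is closed under squares.
   If T in L is such that 1, T and T^2 are independent, then T satisfies a cubic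
   equation, and according to the multiplicities of its roots L is spanned by
   three orthogonal idempotents, by 1, an idempotent and an element of square 0,
   or by 1, N and N^2 with N^3 = 0.  Otherwise L = <1, S, N> where N^2 = 0 and S^2
   and NS + SN are scalars.  Splitting off from these matrices the nondegenerate
   subspaces generated by a vector yields the eleven nets.

   The edges of the graph are explicit one-parameter families.  For the converse,
   in a degeneration of L to L' every plane of L has a limit plane in L', and each
   closed congruence-invariant condition on the elements of the plane and on the
   inverses of the units of L passes to the limit.  Bounds on the ranks,
   nilpotency, commutativity and the existence of a common linear factor suffice.
   As the graph is acyclic, the nets are pairwise non-congruent. *)

(** * The eleven nets as explicit matrices *)

(** A unit of [L'] need not come from a fixed unit of [L]: it is the limit of members of the moving
    family that are units for generic [t]. A condition is therefore required of [L] for the inverses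
    of all its units, which Cayley-Hamilton writes as [U^-1 W U^-1] with [W] in [L]. Along the
    family the adjugate, polynomial in [t], replaces the inverse; the determinant is the price,
    whence the invariance under scaling. The limit of a plane comes from dividing its equation by
    the largest possible power of [t], so no compactness argument is made. The families on the edges
    mostly rest on colliding squares: [(a + t e)^2 - a^2] has leading term [2 t a e], and further
    parameters cancel more orders. In the classification, symmetry turns every stable nondegenerate
    subspace into an orthogonal summand. Size 5 enters through three facts: two idempotents of equal
    rank cannot be complementary, a matrix of square 0 has rank at most 2, and a totally isotropic
    subspace has dimension at most 2. *)

Definition lmx (R : nmodType) m n (s : seq (seq R)) : 'M[R]_(m, n) :=
  \matrix_(i, j) (nth [::] s i)`_j.

Lemma all_ord5 (P : 'I_5 -> Prop) :
  P 0 -> P 1 -> P 2 -> P 3 -> P 4 -> forall i, P i.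
Proof.
move=> P0 P1 P2 P3 P4 [[|[|[|[|[|m]]]]] lt_m] //.
- by rewrite (_ : Ordinal _ = 0) //; apply: val_inj.
- by rewrite (_ : Ordinal _ = 1) //; apply: val_inj.
- by rewrite (_ : Ordinal _ = 2) //; apply: val_inj.
- by rewrite (_ : Ordinal _ = 3) //; apply: val_inj.
- by rewrite (_ : Ordinal _ = 4) //; apply: val_inj.
Qed.

Lemma sum_ord5 (R : nmodType) (F : 'I_5 -> R) :
  \sum_i F i = F 0 + (F 1 + (F 2 + (F 3 + F 4))).
Proof.
rewrite !big_ord_recl big_ord0 addr0.
by do ![congr (_ + _)]; congr (F _); apply: val_inj.
Qed.

Ltac by_mx5 := apply/matrixP; let i := fresh in let j := fresh in intros i j;
  rewrite !(mxE, sum_ord5); revert i j; apply: all_ord5; apply: all_ord5;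
  rewrite /=; ring.

Lemma lmx5M (R : pzSemiRingType) (s t u : seq (seq R)) :
  (forall i j, (i < 5)%N -> (j < 5)%N ->
     (nth [::] s i)`_0 * (nth [::] t 0)`_j
     + ((nth [::] s i)`_1 * (nth [::] t 1)`_j
     + ((nth [::] s i)`_2 * (nth [::] t 2)`_j
     + ((nth [::] s i)`_3 * (nth [::] t 3)`_j
     + (nth [::] s i)`_4 * (nth [::] t 4)`_j))) = (nth [::] u i)`_j) ->
  lmx 5 5 s *m lmx 5 5 t = lmx 5 5 u.
Proof.
move=> stu; apply/matrixP => i j; rewrite !mxE sum_ord5 !mxE.
exact: stu.
Qed.

Definition gen_rows (K : nzSemiRingType) (k : net5) (x y z : K) : seq (seq K) :=
  match k with
  | A1_201 => [:: [:: x; 0; 0; 0; 0]; [:: 0; x; 0; 0; 0]; [:: 0; 0; x; 0; 0];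
                  [:: 0; 0; 0; y; 0]; [:: 0; 0; 0; 0; z]]
  | A1_011 => [:: [:: x; 0; 0; 0; 0]; [:: 0; x; 0; 0; 0]; [:: 0; 0; y; 0; 0];
                  [:: 0; 0; 0; y; 0]; [:: 0; 0; 0; 0; z]]
  | A2_121 => [:: [:: x; 0; 0; 0; 0]; [:: 0; z; y; 0; 0]; [:: 0; y; 0; 0; 0];
                  [:: 0; 0; 0; y; 0]; [:: 0; 0; 0; 0; y]]
  | A2_102 => [:: [:: x; 0; 0; 0; 0]; [:: 0; z; 0; 0; y]; [:: 0; 0; z; y; 0];
                  [:: 0; 0; y; 0; 0]; [:: 0; y; 0; 0; 0]]
  | A2_211 => [:: [:: x; 0; 0; 0; 0]; [:: 0; x; 0; 0; 0]; [:: 0; 0; z; y; 0];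
                  [:: 0; 0; y; 0; 0]; [:: 0; 0; 0; 0; y]]
  | A2_301 => [:: [:: x; 0; 0; 0; 0]; [:: 0; x; 0; 0; 0]; [:: 0; 0; x; 0; 0];
                  [:: 0; 0; 0; z; y]; [:: 0; 0; 0; y; 0]]
  | A3_201 => [:: [:: z; y; x; 0; 0]; [:: y; x; 0; 0; 0]; [:: x; 0; 0; 0; 0];
                  [:: 0; 0; 0; x; 0]; [:: 0; 0; 0; 0; x]]
  | A3_011 => [:: [:: z; y; x; 0; 0]; [:: y; x; 0; 0; 0]; [:: x; 0; 0; 0; 0];
                  [:: 0; 0; 0; y; x]; [:: 0; 0; 0; x; 0]]
  | B2_112 => [:: [:: 0; x; z; 0; 0]; [:: x; 0; 0; 0; 0]; [:: z; 0; 0; y; 0];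
                  [:: 0; 0; y; 0; 0]; [:: 0; 0; 0; 0; y]]
  | C5_1   => [:: [:: y; 0; 0; 0; x]; [:: 0; z; 0; x; 0]; [:: 0; 0; x; 0; 0];
                  [:: 0; x; 0; 0; 0]; [:: x; 0; 0; 0; 0]]
  | C5_2   => [:: [:: z; y; 0; 0; x]; [:: y; 0; 0; x; 0]; [:: 0; 0; x; 0; 0];
                  [:: 0; x; 0; 0; 0]; [:: x; 0; 0; 0; 0]]
  end.

Definition gen (K : nzSemiRingType) k (x y z : K) : 'M[K]_5 :=
  lmx 5 5 (gen_rows k x y z).

(** Coordinates of a unit that is a permutation matrix of order at most 2. It is its own inverse, so
    that no [invmx] enters the computations in a net. *)
Definition net1 (K : nzSemiRingType) (k : net5) : K * K * K :=
  match k with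
  | A1_201 | A1_011 => (1, 1, 1)
  | A3_201 | A3_011 | C5_1 | C5_2 => (1, 0, 0)
  | _ => (1, 1, 0)
  end.

Definition gen3 (K : nzSemiRingType) k (x : K * K * K) := gen k x.1.1 x.1.2 x.2.

Definition netU (K : nzSemiRingType) k : 'M[K]_5 := gen3 k (net1 K k).

(* Coordinates of the Jordan product of the isotope with unit [netU k], twice
   over for [B2_112], whose product is not associative. *)
Definition netM (K : nzSemiRingType) (k : net5) (x y z x' y' z' : K) : K * K * K :=
  match k with
  | A1_201 | A1_011 => (x * x', y * y', z * z')
  | A2_121 | A2_102 | A2_211 | A2_301 => (x * x', y * y', y * z' + z * y')
  | A3_201 | A3_011 => (x * x', x * y' + y * x', x * z' + y * y' + z * x')
  | B2_112 => (2 * (x * x'), 2 * (y * y'), (x + y) * z' + z * (x' + y'))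
  | C5_1 | C5_2 => (x * x', x * y' + y * x', x * z' + z * x')
  end.

Lemma netUU (K : comNzRingType) k : netU K k *m netU K k = 1%:M.
Proof.
apply/matrixP => i j; rewrite !mxE sum_ord5 !mxE; move: i j.
by case: k; apply: all_ord5; apply: all_ord5; rewrite /=; ring.
Qed.

Lemma gen_mul (K : comNzRingType) k x y z x' y' z' : k <> B2_112 ->
  gen k x y z *m netU K k *m gen k x' y' z' = gen3 k (netM k x y z x' y' z').
Proof.
move=> kB; apply/matrixP => i j.
rewrite !mxE sum_ord5 !mxE !sum_ord5 !mxE; move: i j.
by case: k kB => // _; apply: all_ord5; apply: all_ord5; rewrite /=; ring.
Qed.

Lemma gen_mulC (K : comNzRingType) x y z x' y' z' :
  gen B2_112 x y z *m netU K B2_112 *m gen B2_112 x' y' z'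
  + gen B2_112 x' y' z' *m netU K B2_112 *m gen B2_112 x y z
  = gen3 B2_112 (netM B2_112 x y z x' y' z').
Proof.
by_mx5.
Qed.

Lemma genD (K : nzSemiRingType) k (x y z x' y' z' : K) :
  gen k x y z + gen k x' y' z' = gen k (x + x') (y + y') (z + z').
Proof.
apply/matrixP => i j; rewrite !mxE.
by move: i j; case: k; apply: all_ord5; apply: all_ord5; rewrite /= ?addr0.
Qed.

Lemma genZ (K : nzSemiRingType) k (a x y z : K) :
  a *: gen k x y z = gen k (a * x) (a * y) (a * z).
Proof.
apply/matrixP => i j; rewrite !mxE.
by move: i j; case: k; apply: all_ord5; apply: all_ord5; rewrite /= ?mulr0.
Qed.

Lemma gen_sym (K : nzSemiRingType) k (x y z : K) : (gen k x y z)^T = gen k x y z.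
Proof.
apply/matrixP => i j; rewrite !mxE.
by case: k; move: i j; apply: all_ord5; apply: all_ord5.
Qed.

Definition net_tuple (K : nzSemiRingType) k : 3.-tuple 'M[K]_5 :=
  [tuple gen k 1 0 0; gen k 0 1 0; gen k 0 0 1].

Lemma gen_sum (K : nzSemiRingType) k (x : 'I_3 -> K) :
  \sum_i x i *: tnth (net_tuple K k) i = gen k (x 0) (x 1) (x 2).
Proof.
rewrite !big_ord_recl big_ord0 addr0 !(tnth_nth 0) /= !genZ !genD.
rewrite !(mulr0, mulr1, addr0, add0r).
by congr (gen k (x _) (x _) (x _)); apply: val_inj.
Qed.

Section Nets.
Variable K : numFieldType.

Lemma eq_gram n (q q' : 'rV[K]_n -> K) : q =1 q' -> gram q = gram q'.
Proof. by move=> eq_q; apply/matrixP => i j; rewrite !mxE !eq_q. Qed.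

(** A mixed term such as [a * b] has matrix entries [1/2], while [gen] is normalised to entries [1].
    Rescaling a generator does not change the span. *)
Lemma form5_gen k :
  [seq form5 f | f <- net_forms K k] =
    match k with
    | A2_102 | A2_301 | A3_201 | C5_2 =>
        [:: gen k 1 0 0; gen k 0 2^-1 0; gen k 0 0 1]
    | B2_112 => [:: gen k 2^-1 0 0; gen k 0 1 0; gen k 0 0 2^-1]
    | _ => [:: gen k 1 0 0; gen k 0 1 0; gen k 0 0 1]
    end.
Proof.
have formE f l x y z :
    (forall v : 'rV[K]_5, f (v 0 0) (v 0 1) (v 0 2) (v 0 3) (v 0 4) =
       (v *m gen l x y z *m v^T) 0 0) -> form5 f = gen l x y z.
  by move=> fE; rewrite -(gramK (gen_sym l x y z)); apply: eq_gram.
have h : 2 != 0 :> K by rewrite pnatr_eq0.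
case: k; rewrite /=; congr [:: _; _; _]; apply: formE => v;
  rewrite !mxE sum_ord5 !mxE !sum_ord5 !mxE /=; by field.
Qed.

Lemma mem_net k (X : 'M[K]_5) :
  X \in net K k <-> exists x y z, X = gen k x y z.
Proof.
have spanE (a b c : K) : a != 0 -> b != 0 -> c != 0 ->
    X \in <<[:: gen k a 0 0; gen k 0 b 0; gen k 0 0 c]>>%VS <->
    exists x y z, X = gen k x y z.
  move=> a0 b0 c0; rewrite !span_cons span_nil addv0; split.
    case/memv_addP => X1 /vlineP[x ->{X1}] [X2 X2s ->].
    case/memv_addP: X2s => X3 /vlineP[y ->{X3}] [X4 /vlineP[z ->{X4}] ->].
    exists (x * a), (y * b), (z * c).
    by rewrite !genZ !mulr0 !genD !(addr0, add0r).
  case=> x [y [z ->]].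
  have -> : gen k x y z = gen k x 0 0 + (gen k 0 y 0 + gen k 0 0 z).
    by rewrite !genD !(addr0, add0r).
  rewrite !memv_add //; apply/vlineP.
  - by exists (x / a); rewrite genZ !mulr0 divfK.
  - by exists (y / b); rewrite genZ !mulr0 divfK.
  - by exists (z / c); rewrite genZ !mulr0 divfK.
have h : 2^-1 != 0 :> K by rewrite invr_eq0 pnatr_eq0.
rewrite /net form5_gen.
by case: k spanE => spanE; apply: spanE; rewrite ?oner_eq0.
Qed.

Lemma gen_inj k (x y z x' y' z' : K) :
  gen k x y z = gen k x' y' z' -> [/\ x = x', y = y' & z = z'].
Proof.
move=> /matrixP eq_g.
have e i j : (nth [::] (gen_rows k x y z) (i : 'I_5))`_(j : 'I_5) =
    (nth [::] (gen_rows k x' y' z') i)`_j.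
  by have := eq_g i j; rewrite !mxE.
case: k {eq_g} e => e; split;
  first [exact (e 0 0) | exact (e 2 2) | exact (e 3 3) | exact (e 4 4)
       | exact (e 1 1) | exact (e 1 2) | exact (e 1 4) | exact (e 2 3)
       | exact (e 3 4) | exact (e 0 1) | exact (e 0 2) | exact (e 0 4)].
Qed.

Lemma invmx_netU k : invmx (netU K k) = netU K k.
Proof.
have uU : netU K k \in unitmx by have /mulmx1_unit[] := netUU K k.
by apply: (can_inj (mulKmx uU)); rewrite mulmxV // netUU.
Qed.

Lemma net_basis k : basis_of (net K k) (net_tuple K k).
Proof.
rewrite /basis_of eqEsubv -andbA; apply/and3P; split.
- apply/subvP => X /coord_span ->; apply/mem_net.
  under eq_bigr do rewrite -tnth_nth.
  by rewrite gen_sum; do 3![eexists].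
- apply/subvP => _ /mem_net[x [y [z ->]]].
  have := gen_sum k (fun i => [:: x; y; z]`_i) => /= <-.
  by apply: memv_suml => i _; rewrite memvZ // memv_span // mem_tnth.
- apply/freeP => c; under eq_bigr do rewrite -tnth_nth; rewrite gen_sum.
  have -> : 0 = gen k (0 : K) 0 0 by have := genZ k (0 : K) 0 0 0; rewrite scale0r !mulr0.
  case/gen_inj => c0 c1 c2 [[|[|[|//]]] lti].
  + by rewrite -[RHS]c0; congr (c _); apply: val_inj.
  + by rewrite -[RHS]c1; congr (c _); apply: val_inj.
  + by rewrite -[RHS]c2; congr (c _); apply: val_inj.
Qed.

Lemma mem_gen3 k (x : K * K * K) : gen3 k x \in net K k.
Proof. by apply/mem_net; exists x.1.1, x.1.2, x.2. Qed.

Lemma unit_netU k : netU K k \in unitmx.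
Proof. by have /mulmx1_unit[] := netUU K k. Qed.

Lemma net_jprod k X Y :
  X \in net K k -> Y \in net K k -> jprod (netU K k) X Y \in net K k.
Proof.
move=> /mem_net[x [y [z ->]]] /mem_net[x' [y' [z' ->]]].
rewrite /jprod invmx_netU memvZ //.
have [kB | kB] : k = B2_112 \/ k <> B2_112 by case: (k); first [by left | by right].
  by subst k; rewrite gen_mulC mem_gen3.
by rewrite !gen_mul // memvD ?mem_gen3.
Qed.

Lemma jordan_net_net k : jordan_net (net K k).
Proof.
split; last by rewrite (size_basis (net_basis k)).
apply/jordan_spaceP; split; first by move=> _ /mem_net[x [y [z ->]]]; apply: gen_sym.
by exists (netU K k); split; [apply: mem_gen3 | apply: unit_netU | apply: net_jprod].
Qed.

End Nets.

(** * Degeneration by polynomial matrices *)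

Notation ev t := (map_mx (horner_eval t)).
Notation cst := (map_mx polyC).

(* Clearing denominators: [P] and [Q] are polynomial matrices that are invertible
   up to a power of ['X]. *)
Definition pdeg (K : fieldType) n m (S S' : 'I_m -> 'M[K]_n) : Prop :=
  exists (P P' : 'M[{poly K}]_n) (Q Q' : 'M[{poly K}]_m)
         (Y : 'I_m -> 'M[{poly K}]_n) (a b c : nat),
  [/\ P *m P' = ('X^a)%:M, Q *m Q' = ('X^b)%:M,
      forall j, 'X^c *: Y j = \sum_i Q i j *: (P *m cst (S i) *m P^T)
    & forall j, ev 0 (Y j) = S' j].

Section Laurent.
Variable K : fieldType.
Implicit Types (n m : nat).

Notation iota := (@tofrac {poly K}).

Lemma iotaX_neq0 a : iota 'X ^+ a != 0.
Proof. by rewrite expf_neq0 // tofrac_eq0 polyX_eq0. Qed.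

Lemma map_iota_inj m n : injective (map_mx iota : 'M_(m, n) -> _).
Proof.
move=> A B /matrixP eqAB; apply/matrixP => i j.
by have := eqAB i j; rewrite !mxE => /eqP; rewrite tofrac_eq => /eqP.
Qed.

Lemma laurent_mx m n (P : 'M[{fraction {poly K}}]_(m, n)) :
  (forall i j, laurent (P i j)) ->
  exists (p : 'M[{poly K}]_(m, n)) a, iota 'X ^+ a *: P = map_mx iota p.
Proof.
move=> lP.
have /choice[f fP] : forall ij : 'I_m * 'I_n, exists pk : {poly K} * nat,
    P ij.1 ij.2 = iota pk.1 / iota 'X ^+ pk.2.
  by move=> [i j]; have [p [k Pij]] := lP i j; exists (p, k).
(* The sum of the exponents bounds each of them and so serves as a common denominator. *)
pose a := \sum_ij (f ij).2.
exists (\matrix_(i, j) ((f (i, j)).1 * 'X^(a - (f (i, j)).2))), a.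
apply/matrixP => i j; rewrite !mxE (fP (i, j)) /= rmorphM rmorphXn /=.
have le_a : ((f (i, j)).2 <= a)%N by rewrite /a (bigD1 (i, j)) //= leq_addr.
by rewrite -{1}(subnK le_a) exprD mulrCA -!mulrA mulfV ?iotaX_neq0 // mulr1.
Qed.

Lemma map_iotaM n (A B : 'M[{poly K}]_n) :
  map_mx iota A *m map_mx iota B = map_mx iota (A *m B).
Proof. by rewrite map_mxM. Qed.

Lemma degenerates_pdeg_tuple n m (S S' : 'I_m -> 'M[K]_n)
    (P : 'M[{fraction {poly K}}]_n) (Q : 'M[{fraction {poly K}}]_m)
    (Y : 'I_m -> 'M[{poly K}]_n) :
    laurent_GL P -> laurent_GL Q ->
    (forall j, map_mx iota (Y j) =
       \sum_i Q i j *: (P *m map_mx (iota \o polyC) (S i) *m P^T)) ->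
    (forall j, ev 0 (Y j) = S' j) -> pdeg S S'.
Proof.
have clear k (A : 'M[{fraction {poly K}}]_k) : laurent_GL A ->
    exists (p p' : 'M[{poly K}]_k) a b,
      iota 'X ^+ a *: A = map_mx iota p /\ p *m p' = ('X^b)%:M.
  case=> uA /laurent_mx[p [a pE]] /laurent_mx[p' [b p'E]].
  exists p, p', a, (a + b)%N; split=> //; apply: map_iota_inj.
  rewrite -map_iotaM -pE -p'E -scalemxAl -scalemxAr scalerA mulmxV //.
  by rewrite map_scalar_mx /= rmorphXn /= -exprD scalemx1.
move=> /clear[p [p' [a [a' [pE pp']]]]] /clear[q [q' [b [b' [qE qq']]]]] YE Y0.
(* One denominator comes from [Q], and one from each of [P] and [P^T]. *)
exists p, p', q, q', Y, a', b', (b + (a + a))%N; split=> // j.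
apply: map_iota_inj; rewrite map_mxZ /= rmorphXn /= YE scaler_sumr raddf_sum /=.
apply: eq_bigr => i _; rewrite map_mxZ /= !map_mxM /= -map_trmx -pE.
have -> : iota (q i j) = iota 'X ^+ b * Q i j.
  by have /matrixP/(_ i j) := qE; rewrite !mxE.
rewrite -map_mx_comp /= [(_ *: P)^T]linearZ /= -!scalemxAl -!scalemxAr !scalerA.
by congr (_ *: _); rewrite !exprD; ring.
Qed.

Lemma pdeg_degenerates_tuple n m (S S' : 'I_m -> 'M[K]_n) : pdeg S S' ->
  exists (P : 'M[{fraction {poly K}}]_n) (Q : 'M[{fraction {poly K}}]_m)
         (Y : 'I_m -> 'M[{poly K}]_n),
  [/\ laurent_GL P, laurent_GL Q,
      forall j, map_mx iota (Y j) =
       \sum_i Q i j *: (P *m map_mx (iota \o polyC) (S i) *m P^T)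
    & forall j, ev 0 (Y j) = S' j].
Proof.
have laurentZ (p : {poly K}) k : laurent ((iota 'X ^+ k)^-1 * iota p).
  by exists p, k; rewrite mulrC.
have GL k (p p' : 'M[{poly K}]_k) a c : p *m p' = ('X^a)%:M ->
    laurent_GL ((iota 'X ^+ c)^-1 *: map_mx iota p).
  move=> pp'; pose A := (iota 'X ^+ c)^-1 *: map_mx iota p.
  pose B := (iota 'X ^+ a)^-1 *: map_mx iota ('X^c *: p').
  have AB : A *m B = 1%:M.
    rewrite -scalemxAl -scalemxAr map_iotaM -scalemxAr pp' scalerA.
    rewrite map_mxZ map_scalar_mx /= ![iota (_ ^+ _)]rmorphXn /= scalerA.
    rewrite scale_scalar_mx.
    by rewrite [_ / _ * _]mulrAC mulVf ?mul1r ?mulVf ?iotaX_neq0.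
  have [uA _] := mulmx1_unit AB.
  split=> // i j; first by rewrite mxE [map_mx _ _ _ _]mxE.
  rewrite (_ : invmx _ = B) ?mxE ?[map_mx _ _ _ _]mxE //.
  by apply: (can_inj (mulKmx uA)); rewrite mulmxV.
case=> [P [P' [Q [Q' [Y [a [b [c [PP' QQ' YE Y0]]]]]]]]].
(* The power ['X^c] is moved into [Q], since it is invertible among Laurent polynomials. *)
exists (map_mx iota P), ((iota 'X ^+ c)^-1 *: map_mx iota Q), Y; split=> //.
- by have := GL _ _ _ _ 0%N PP'; rewrite expr0 invr1 scale1r.
- exact: GL QQ'.
- move=> j; apply: (can_inj (scalerK (iotaX_neq0 c))).
  rewrite scaler_sumr -[iota 'X ^+ c](rmorphXn iota) -map_mxZ YE raddf_sum /=.
  apply: eq_bigr => i _; rewrite map_mxZ /= !map_mxM /= -map_trmx !mxE scalerA.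
  by rewrite -map_mx_comp rmorphXn mulrA mulfV ?iotaX_neq0 // mul1r.
Qed.
End Laurent.

Section Pdeg.
Variables (K : fieldType) (n m : nat).
Implicit Types S Z : 'I_m -> 'M[K]_n.

Lemma cstM k l q (A : 'M[K]_(k, l)) (B : 'M_(l, q)) : cst (A *m B) = cst A *m cst B.
Proof. exact: map_mxM. Qed.

Lemma evM t k l q (A : 'M[{poly K}]_(k, l)) (B : 'M_(l, q)) :
  ev t (A *m B) = ev t A *m ev t B.
Proof. exact: map_mxM. Qed.

Lemma evZ t k l (p : {poly K}) (A : 'M_(k, l)) : ev t (p *: A) = p.[t] *: ev t A.
Proof. exact: map_mxZ. Qed.

Lemma ev_cst t k l (A : 'M[K]_(k, l)) : ev t (cst A) = A.
Proof.
by apply/matrixP => i j; rewrite !mxE; apply: hornerC.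
Qed.

Lemma pdeg_basis S S' Z Z' (D D' C C' : 'M[K]_m) :
  D *m D' = 1%:M -> C *m C' = 1%:M ->
  (forall i, S i = \sum_h D h i *: Z h) ->
  (forall j, Z' j = \sum_p C p j *: S' p) -> pdeg S S' -> pdeg Z Z'.
Proof.
move=> DD CC SE Z'E [P [P' [Q [Q' [Y [a [b [c [PP QQ YE Y0]]]]]]]]].
exists P, P', (cst D *m Q *m cst C), (cst C' *m Q' *m cst D').
exists (fun j => \sum_p (C p j)%:P *: Y p), a, b, c; split=> // [|j|j].
- rewrite !mulmxA -[_ *m cst C *m cst C']mulmxA -cstM CC map_scalar_mx mulmx1.
  rewrite -[_ *m Q *m Q']mulmxA QQ mul_mx_scalar -scalemxAl -cstM DD.
  by rewrite map_scalar_mx scalemx1.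
- rewrite scaler_sumr.
  transitivity (\sum_p (C p j)%:P *: ('X^c *: Y p)).
    by apply: eq_bigr => p _; rewrite !scalerA mulrC.
  under eq_bigr => p _.
    rewrite YE scaler_sumr.
    under eq_bigr => i _.
      rewrite SE raddf_sum /= mulmx_sumr mulmx_suml !scaler_sumr.
      under eq_bigr => h _.
        rewrite map_mxZ /= -scalemxAr -scalemxAl !scalerA mulrAC -mulrA.
      over.
    over.
  over.
  rewrite exchange_big /=; under eq_bigr => i _ do rewrite exchange_big.
  rewrite exchange_big; apply: eq_bigr => h _ /=.
  under eq_bigr => i _ do rewrite -scaler_suml.
  rewrite -scaler_suml; congr (_ *: _).
  rewrite !mxE exchange_big; apply: eq_bigr => p _ /=.
  by rewrite !mxE mulr_suml; apply: eq_bigr => i _; rewrite !mxE; ring.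
- rewrite raddf_sum Z'E; apply: eq_bigr => p _ /=.
  by rewrite evZ hornerC Y0.
Qed.

Lemma pdeg_congr S (g : 'M[K]_n) : g \in unitmx ->
  pdeg S (fun j => g *m S j *m g^T).
Proof.
move=> ug; exists (cst g), (cst (invmx g)), 1%:M, 1%:M.
exists (fun j => cst (g *m S j *m g^T)), 0%N, 0%N, 0%N; split=> [|| j | j].
- by rewrite -cstM mulmxV // map_scalar_mx.
- by rewrite mulmx1.
- rewrite expr0 scale1r (bigD1 j) //= big1 ?addr0 => [|i /negPf ij].
    by rewrite !mxE eqxx scale1r !cstM map_trmx.
  by rewrite !mxE ij scale0r.
- exact: ev_cst.
Qed.

Lemma ev0_split k l (A : 'M[{poly K}]_(k, l)) :
  exists R, A = cst (ev 0 A) + 'X *: R.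
Proof.
have /choice[f fE] : forall ij : 'I_k * 'I_l, exists r : {poly K},
    A ij.1 ij.2 = (A ij.1 ij.2).[0]%:P + 'X * r.
  move=> [i j] /=; have : root (A i j - (A i j).[0]%:P) 0.
    by rewrite rootE !hornerE subrr.
  case/factor_theorem => r; rewrite polyC0 subr0 => rE; exists r.
  by rewrite mulrC -rE addrC subrK.
exists (\matrix_(i, j) f (i, j)); apply/matrixP => i j; rewrite !mxE.
exact: (fE (i, j)).
Qed.

Notation sub N := (map_mx (comp_poly 'X^N)).

(** The second family divides by ['X^c1], which would blow up the error of the first.
    Reparametrising the first by ['X^N] with [N = c1 + 1] turns its error into a multiple of ['X^N],
    so that one factor ['X] is left after the division. *)
Lemma pdeg_trans S S' S'' : pdeg S S' -> pdeg S' S'' -> pdeg S S''.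
Proof.
case=> [P [P' [Q [Q' [Y [a [b [c [PP QQ YE Y0]]]]]]]]].
case=> [P1 [P1' [Q1 [Q1' [Y1 [a1 [b1 [c1 [PP1 QQ1 YE1 Y10]]]]]]]]].
pose N := c1.+1.
have fM k l q (A : 'M[{poly K}]_(k, l)) (B : 'M_(l, q)) :
  sub N (A *m B) = sub N A *m sub N B by exact: map_mxM.
have fX k d : sub N ('X^d)%:M = ('X^(N * d))%:M :> 'M[{poly K}]_k.
  by rewrite map_scalar_mx /= comp_Xn_poly exprM.
have fcst k l (A : 'M[K]_(k, l)) : sub N (cst A) = cst A.
  by apply/matrixP => i j; rewrite !mxE comp_polyC.
have fZ k l p (A : 'M[{poly K}]_(k, l)) : sub N (p *: A) = (p \Po 'X^N) *: sub N A.
  exact: map_mxZ.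
have /choice[R YR] : forall j, exists R, Y j = cst (S' j) + 'X *: R.
  by move=> j; rewrite -Y0; apply: ev0_split.
have YfE j : 'X^(N * c) *: sub N (Y j) =
    \sum_i sub N Q i j *: (sub N P *m cst (S i) *m (sub N P)^T).
  rewrite exprM -comp_Xn_poly -fZ YE raddf_sum; apply: eq_bigr => i _ /=.
  by rewrite fZ !fM fcst map_trmx mxE.
exists (P1 *m sub N P), (sub N P' *m P1'), (sub N Q *m Q1), (Q1' *m sub N Q').
exists (fun k => Y1 k + 'X *: \sum_j Q1 j k *: (P1 *m sub N (R j) *m P1^T)).
exists (a1 + N * a)%N, (b1 + N * b)%N, (c1 + N * c)%N; split=> [|| k | k].
- rewrite mulmxA -[_ *m _ *m sub N P']mulmxA -fM PP fX mul_mx_scalar -scalemxAl PP1.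
  by rewrite scale_scalar_mx -exprD addnC.
- rewrite mulmxA -[_ *m _ *m Q1']mulmxA QQ1 mul_mx_scalar -scalemxAl -fM QQ fX.
  by rewrite scale_scalar_mx -exprD.
- transitivity ('X^(N * c) *: \sum_j Q1 j k *: (P1 *m sub N (Y j) *m P1^T)).
    rewrite exprD mulrC -scalerA; congr (_ *: _).
    rewrite scalerDr YE1 scalerA -exprSr scaler_sumr -big_split.
    apply: eq_bigr => j _ /=; rewrite YR raddfD /= fcst fZ comp_polyX.
    rewrite mulmxDr mulmxDl scalerDr -scalemxAr -scalemxAl !scalerA.
    by rewrite [_ * Q1 j k]mulrC.
  rewrite scaler_sumr.
  transitivity (\sum_j Q1 j k *: (P1 *m ('X^(N * c) *: sub N (Y j)) *m P1^T)).
    by apply: eq_bigr => j _; rewrite -scalemxAr -scalemxAl !scalerA mulrC.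
  under eq_bigr => j _.
    rewrite YfE mulmx_sumr mulmx_suml scaler_sumr.
    under eq_bigr => i _ do rewrite -scalemxAr -scalemxAl scalerA.
  over.
  rewrite exchange_big; apply: eq_bigr => i _ /=.
  rewrite trmx_mul !mulmxA -scaler_suml; congr (_ *: _).
  by rewrite !mxE; apply: eq_bigr => j _; rewrite mulrC.
- by rewrite raddfD /= Y10 evZ hornerX scale0r addr0.
Qed.
End Pdeg.

Section NetPdeg.
Variable K : numFieldType.

Lemma coord_change n m (L : {vspace 'M[K]_n}) (S Z : m.-tuple 'M[K]_n) :
  basis_of L S -> basis_of L Z ->
  exists D D' : 'M[K]_m, [/\ D *m D' = 1%:M,
    forall i, tnth S i = \sum_h D h i *: tnth Z h
  & forall i, tnth Z i = \sum_h D' h i *: tnth S h].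
Proof.
move=> bS bZ; have [fS fZ] := (basis_free bS, basis_free bZ).
exists (\matrix_(h, i) coord Z h (tnth S i)), (\matrix_(h, i) coord S h (tnth Z i)).
have exp (T T' : m.-tuple 'M[K]_n) i : basis_of L T -> basis_of L T' ->
    tnth T i = \sum_h coord T' h (tnth T i) *: tnth T' h.
  move=> bT bT'; under eq_bigr do rewrite [tnth T' _](tnth_nth 0).
  by apply: (coord_basis bT'); apply: (basis_mem bT); apply: mem_tnth.
split=> [|i|i]; last 2 first.
- by under eq_bigr do rewrite mxE; apply: exp.
- by under eq_bigr do rewrite mxE; apply: exp.
apply/matrixP => h k; rewrite !mxE.
transitivity (coord Z h (tnth Z k)).
  rewrite [in RHS](exp _ _ k bZ bS) linear_sum; apply: eq_bigr => i _ /=.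
  by rewrite !mxE linearZ /= mulrC.
by rewrite (tnth_nth 0) coord_free // eq_sym.
Qed.

(** The bases in the definition of a degeneration are arbitrary; the dimension forces three
    elements, and constant changes of basis go into [Q]. *)
Lemma degeneratesE k l : degenerates (net K k) (net K l) <->
  pdeg (tnth (net_tuple K k)) (tnth (net_tuple K l)).
Proof.
split=> [[m [X [X' [P [Q [Y [[bX bX'] GP GQ YE Y0]]]]]]] | /pdeg_degenerates_tuple].
  have m3 : m = 3 by rewrite -(size_basis bX) (size_basis (net_basis K k)).
  subst m.
  have [D [D' [DD DE _]]] := coord_change bX (net_basis K k).
  have [C' [C [CC _ CE]]] := coord_change bX' (net_basis K l).
  apply: pdeg_basis DD (mulmx1C CC) DE CE _.
  apply: degenerates_pdeg_tuple GP GQ YE _ => j; apply/matrixP => a b.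
  by rewrite mxE; apply/esym/cvg_horner0P.
case=> [P [Q [Y [GP GQ YE Y0]]]].
exists 3%N, (net_tuple K k), (net_tuple K l), P, Q, Y; split=> //.
  by split; apply: net_basis.
by move=> j a b; apply/cvg_horner0P; rewrite -Y0 mxE.
Qed.
End NetPdeg.

(** * Closed conditions inherited by degenerations *)

Section Closed.
Variables (K : numFieldType) (n : nat).

(* [V] stands for the inverse of a unit of the net, [X], [X2] and [Y] for elements
   of planes of the net. *)
Definition closed_rel (Psi : 'M[K]_n -> 'M[K]_n -> 'M[K]_n -> 'M[K]_n -> Prop) :=
  forall (V X X2 Y : 'M[{poly K}]_n) (q : {poly K}), q != 0 ->
  (forall t, q.[t] != 0 -> Psi (ev t V) (ev t X) (ev t X2) (ev t Y)) ->
  Psi (ev 0 V) (ev 0 X) (ev 0 X2) (ev 0 Y).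

Definition congr_inv (Psi : 'M[K]_n -> 'M[K]_n -> 'M[K]_n -> 'M[K]_n -> Prop) :=
  forall (g : 'M[K]_n) c V X X2 Y, g \in unitmx -> c != 0 -> Psi V X X2 Y ->
  Psi (c *: ((invmx g)^T *m V *m invmx g))
      (g *m X *m g^T) (g *m X2 *m g^T) (g *m Y *m g^T).

(** In characteristic 0 the field is infinite: [q * p] vanishes at every natural number, hence at
    more points than its size allows. *)
Lemma poly_eq0 (p q : {poly K}) :
  q != 0 -> (forall t, q.[t] != 0 -> p.[t] = 0) -> p = 0.
Proof.
move=> q0 pq0; apply/eqP; rewrite -[_ == _]orFb -(negPf q0) -mulf_eq0.
set r := q * p; apply/negP => /negP r0.
pose rs : seq K := [seq i%:R | i <- iota 0 (size r)].
have /(max_poly_roots r0) : all (root r) rs.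
  apply/allP => t _; rewrite rootE /r hornerM mulf_eq0.
  by case: eqVneq => //= /pq0 ->.
suff ur : uniq rs by move/(_ ur); rewrite size_map size_iota ltnn.
by rewrite map_inj_uniq ?iota_uniq // => i k /eqP; rewrite eqr_nat => /eqP.
Qed.

Lemma pmx_eq0 k l (A : 'M[{poly K}]_(k, l)) (q : {poly K}) :
  q != 0 -> (forall t, q.[t] != 0 -> ev t A = 0) -> A = 0.
Proof.
move=> q0 A0; apply/matrixP => i j; rewrite mxE; apply: poly_eq0 q0 _ => t qt.
by have /matrixP/(_ i j) := A0 t qt; rewrite !mxE.
Qed.

(** Semicontinuity of the rank. If the rank at [0] exceeded [r], constant matrices [B] and [C] would
    cut an identity of size [r + 1] out of [A] at [0]; but the determinant of [B A C] vanishes at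
    all generic points, hence identically. *)
Lemma rank_ev0 k l (A : 'M[{poly K}]_(k, l)) (q : {poly K}) r :
  q != 0 -> (forall t, q.[t] != 0 -> (\rank (ev t A) <= r)%N) ->
  (\rank (ev 0 A) <= r)%N.
Proof.
move=> q0 rA; rewrite leqNgt; apply/negP => lt_r.
set M := ev 0 A in lt_r.
pose B : 'M[K]_(r.+1, k) := pid_mx r.+1 *m invmx (col_ebase M).
pose C : 'M[K]_(l, r.+1) := invmx (row_ebase M) *m pid_mx r.+1.
have BMC : B *m M *m C = 1%:M.
  rewrite -{1}[M]mulmx_ebase /B /C !mulmxA mulmxKV ?col_ebase_unit //.
  rewrite mulmxK ?row_ebase_unit // !mul_pid_mx -pid_mx_1; congr pid_mx.
  rewrite (minn_idPl lt_r) (minn_idPr (leq_trans lt_r (rank_leq_row M))) minnn.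
  exact: minn_idPr (leq_trans lt_r (rank_leq_col M)).
have /(congr1 (horner_eval 0)) : \det (cst B *m A *m cst C) = 0.
  apply: poly_eq0 q0 _ => t qt.
  rewrite -[LHS](det_map_mx (horner_eval t)) !evM !ev_cst.
  have : ~~ row_free (B *m ev t A *m C).
    rewrite -row_leq_rank -ltnNge ltnS (leq_trans _ (rA t qt)) //.
    by rewrite (leq_trans (mxrankM_maxl _ _)) ?mxrankM_maxr.
  by rewrite row_free_unit unitmxE unitfE negbK => /eqP.
rewrite -(det_map_mx (horner_eval 0)) !evM !ev_cst BMC det1 rmorph0.
by move/eqP; rewrite oner_eq0.
Qed.

(** Algebraic form of the completeness of projective space: a curve of nonzero vectors has a limit
    direction at [0]. *)
Lemma pmx_primitive m (r : 'rV[{poly K}]_m) : r != 0 ->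
  exists d r0, r = 'X^d *: r0 /\ ev 0 r0 != 0.
Proof.
move=> r0; have /rV0Pn[j rj] := r0.
have [d] := ubnP (size (r 0 j)); elim: d r {r0} rj => // d IHd r rj lt_d.
have [r00|] := eqVneq (ev 0 r) 0; last by exists 0%N, r; rewrite scale1r.
have [s rE] := ev0_split r.
have {}rE : r = 'X *: s by rewrite rE r00 map_mx0 add0r.
have sj : s 0 j != 0 by apply: contraNneq rj => sj; rewrite rE mxE sj mulr0.
have [|e [s0 [sE s00]]] := IHd s sj.
  by move: lt_d; rewrite rE mxE mulrC size_mulX.
by exists e.+1, s0; rewrite rE sE scalerA -exprS.
Qed.

(** Every vector of the limit plane is a limit of vectors of the moving plane: with [c] such that
    [r c = 1] at [0], the vector [(r c) x - (r x) c] is killed by [r] identically and specialises to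
    [x]. *)
Lemma ker_lift m (r : 'rV[{poly K}]_m) (x : 'cV[K]_m) :
  r = 0 \/ ev 0 r != 0 -> ev 0 r *m x = 0 ->
  exists y : 'cV[{poly K}]_m, r *m y = 0 /\ ev 0 y = x.
Proof.
case=> [-> _ | /rV0Pn[j rj] rx].
  by exists (cst x); rewrite mul0mx ev_cst.
pose c : 'cV[K]_m := (ev 0 r 0 j)^-1 *: delta_mx j 0.
have rc : ev 0 r *m c = 1%:M.
  rewrite -scalemxAr -colE; apply/matrixP => p q; rewrite !ord1 !mxE.
  by rewrite mulVf //; move: rj; rewrite mxE.
exists ((r *m cst c) 0 0 *: cst x - (r *m cst x) 0 0 *: cst c); split.
  rewrite mulmxBr -!scalemxAr [r *m cst x]mx11_scalar [r *m cst c]mx11_scalar.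
  by rewrite !scale_scalar_mx !mxE mulrC subrr.
have ev00 (y : 'cV[K]_m) : ((r *m cst y) 0 0).[0] = (ev 0 r *m y) 0 0.
  by rewrite -{2}[y](ev_cst 0) -evM [RHS]mxE.
by rewrite raddfB /= !evZ !ev00 !ev_cst rc rx !mxE eqxx scale1r scale0r subr0.
Qed.

Definition comb (R : pzRingType) m (S : 'I_m -> 'M[R]_n) (x : 'cV[R]_m) : 'M[R]_n :=
  \sum_i x i 0 *: S i.

Lemma ev_comb m (Y : 'I_m -> 'M[{poly K}]_n) (x : 'cV[{poly K}]_m) t :
  ev t (comb Y x) = comb (fun i => ev t (Y i)) (ev t x).
Proof.
by rewrite /comb raddf_sum; apply: eq_bigr => i _; rewrite /= map_mxZ mxE.
Qed.

Lemma combZ m (S : 'I_m -> 'M[K]_n) a (x : 'cV[K]_m) :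
  comb S (a *: x) = a *: comb S x.
Proof. by rewrite /comb scaler_sumr; apply: eq_bigr => i _; rewrite mxE scalerA. Qed.

(* [lam] and [mu] are linear equations of planes; [lam'] and [mu'] are their limits,
   the lowest order terms of [lam Q] and [mu Q].  The zero equation stands for no
   restriction. *)
Lemma transfer m (S S' : 'I_m -> 'M[K]_n) (lam mu : 'rV[K]_m) : pdeg S S' ->
  exists lam' mu' : 'rV[K]_m,
  [/\ lam != 0 -> lam' != 0, mu != 0 -> mu' != 0, mu = 0 -> mu' = 0 &
  forall Psi, closed_rel Psi -> congr_inv Psi ->
    (forall u x x2 y : 'cV[K]_m, comb S u \in unitmx ->
       lam *m x = 0 -> lam *m x2 = 0 -> mu *m y = 0 ->
       Psi (invmx (comb S u)) (comb S x) (comb S x2) (comb S y)) ->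
    forall u x x2 y : 'cV[K]_m, comb S' u \in unitmx ->
      lam' *m x = 0 -> lam' *m x2 = 0 -> mu' *m y = 0 ->
      Psi (invmx (comb S' u)) (comb S' x) (comb S' x2) (comb S' y)].
Proof.
case=> [P [P' [Q [Q' [Y [a [b [c [PP QQ YE Y0]]]]]]]]].
have limit (nu : 'rV[K]_m) : exists r : 'rV[{poly K}]_m,
    [/\ r = 0 \/ ev 0 r != 0, nu != 0 -> ev 0 r != 0, nu = 0 -> r = 0
      & exists d, cst nu *m Q = 'X^d *: r].
  have [->|nu0] := eqVneq nu 0.
    by exists 0; split; [left | | | exists 0%N; rewrite map_mx0 mul0mx scaler0].
  have : cst nu *m Q != 0.
    apply: contraNneq nu0 => nuQ.
    have : cst nu *m Q *m Q' = 0 by rewrite nuQ mul0mx.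
    rewrite -mulmxA QQ mul_mx_scalar => /matrixP nu0; apply/eqP/matrixP => i j.
    have /eqP := nu0 i j; rewrite !mxE mulf_eq0 expf_eq0 polyX_eq0 andbF /=.
    by rewrite polyC_eq0 => /eqP.
  by case/pmx_primitive => d [r [rE r0]]; exists r; split;
    [right | | move=> nu00; rewrite nu00 eqxx in nu0 | exists d].
have [r [r0 rlam _ [d rE]]] := limit lam.
have [s [s0 smu smu0 [e sE]]] := limit mu.
exists (ev 0 r), (ev 0 s); split=> // [/smu0 ->| Psi]; first exact: map_mx0.
move=> clPsi invPsi PsiS u x x2 y uU rx rx2 sy.
have [px [rpx pxE]] := ker_lift r0 rx; have [px2 [rpx2 px2E]] := ker_lift r0 rx2.
have [py [spy pyE]] := ker_lift s0 sy.
have ev0Y z : comb S' (ev 0 z) = ev 0 (comb Y z).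
  by rewrite ev_comb; apply: eq_bigr => i _; rewrite Y0.
pose U := comb Y (cst u).
have U0 : ev 0 U = comb S' u by rewrite -ev0Y ev_cst.
have detU0 : (\det U).[0] = \det (comb S' u).
  by rewrite -U0 det_map_mx.
have detU : (\det U).[0] != 0 by rewrite detU0 -unitfE -unitmxE.
(* Generic means here [t != 0], so that [P] is invertible at [t], and [U] invertible at [t]. *)
pose q := 'X * \det U.
have q0 : q != 0.
  rewrite mulf_neq0 ?polyX_eq0 //; apply: contraNneq detU => ->.
  by rewrite horner0.
(* Away from [0] a member of the family is congruent to a member of the source, whose coordinates
   are obtained by [Q] and a division by [t^c]. *)
have evY t z : t != 0 -> ev t (comb Y z) =
    ev t P *m comb S ((t ^- c) *: (ev t Q *m ev t z)) *m (ev t P)^T.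
  move=> t0; rewrite combZ -scalemxAr -scalemxAl.
  apply: (can_inj (scalerK (expf_neq0 c t0))); rewrite scalerA mulfV ?expf_neq0 //.
  rewrite scale1r ev_comb /comb scaler_sumr mulmx_sumr mulmx_suml.
  transitivity (\sum_i (ev t z) i 0 *: ev t ('X^c *: Y i)).
    by apply: eq_bigr => i _; rewrite evZ hornerXn !scalerA mulrC.
  under eq_bigr => i _.
    rewrite YE raddf_sum scaler_sumr /=.
    under eq_bigr => j _ do rewrite evZ !evM ev_cst -map_trmx scalerA.
  over.
  rewrite exchange_big; apply: eq_bigr => j _ /=.
  rewrite -scalemxAr -scalemxAl -scaler_suml; congr (_ *: _).
  by rewrite !mxE; apply: eq_bigr => i _; rewrite !mxE mulrC.
have unitP t : t != 0 -> ev t P \in unitmx.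
  move=> t0; have : ev t P *m ev t P' \in unitmx.
    rewrite -evM PP map_scalar_mx /= /horner_eval hornerXn unitmxE det_scalar.
    by rewrite unitfE !expf_neq0.
  by rewrite unitmx_mul => /andP[].
have kerQ nu w k t (z : 'cV[{poly K}]_m) : cst nu *m Q = 'X^k *: w ->
    w *m z = 0 -> nu *m ((t ^- c) *: (ev t Q *m ev t z)) = 0.
  move=> wE wz; rewrite -scalemxAr mulmxA -{1}[nu](ev_cst t) -!evM wE.
  by rewrite -scalemxAl wz scaler0 map_mx0 scaler0.
(* The inverse of [U] is not a polynomial matrix. The adjugate is one, and at generic [t] it is a
   nonzero multiple of the inverse, which [congr_inv] tolerates. *)
have : Psi (ev 0 (\adj U)) (ev 0 (comb Y px)) (ev 0 (comb Y px2)) (ev 0 (comb Y py)).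
  apply: (clPsi _ _ _ _ q q0) => t; rewrite hornerM hornerX mulf_eq0 negb_or.
  case/andP=> t0 detUt; pose v := (t ^- c) *: (ev t Q *m u).
  have UE : ev t U = ev t P *m comb S v *m (ev t P)^T by rewrite evY ?ev_cst.
  have : ev t U \in unitmx by rewrite unitmxE unitfE (det_map_mx (horner_eval t)).
  rewrite UE !unitmx_mul => /andP[/andP[_ uv] _].
  have -> : ev t (\adj U) = (\det U).[t] *:
      ((invmx (ev t P))^T *m invmx (comb S v) *m invmx (ev t P)).
    have Ut : ev t U \in unitmx by rewrite UE !unitmx_mul unitmx_tr uv unitP.
    apply: (can_inj (mulKmx Ut)).
    rewrite -evM mul_mx_adj map_scalar_mx /= -scalemxAr UE -!mulmxA.
    rewrite [(ev t P)^T *m _]mulmxA -trmx_mul mulVmx ?unitP // trmx1 mul1mx.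
    by rewrite [comb S v *m _]mulmxA mulmxV // mul1mx mulmxV ?unitP // scalemx1.
  rewrite !evY //; apply: invPsi => //; first exact: unitP.
  by apply: PsiS => //; [apply: kerQ rE rpx | apply: kerQ rE rpx2 | apply: kerQ sE spy].
rewrite -!ev0Y pxE px2E pyE.
have d0 : (\det (comb S' u))^-1 != 0 by rewrite invr_eq0 -detU0.
move/(invPsi 1%:M _ _ _ _ _ (unitmx1 _ _) d0).
rewrite !trmx1 !mul1mx !mulmx1 invmx1 trmx1 mul1mx mulmx1.
suff -> : (\det (comb S' u))^-1 *: ev 0 (\adj U) = invmx (comb S' u) by [].
by rewrite map_mx_adj U0 /invmx uU.
Qed.
End Closed.

(** * Inverses of units in a Jordan space *)

Section Inverse.
Variables (K : numFieldType) (n : nat) (L : {vspace 'M[K]_n.+1}) (U : 'M[K]_n.+1).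
Hypotheses (LU : U \in L) (uU : U \in unitmx).
Hypothesis LM : forall X Y, X \in L -> Y \in L -> jprod U X Y \in L.

(** These are the Jordan powers of [U *m T] for the unit [U]: as powers of [T] commute, the
    symmetrised product is the ordinary one. *)
Lemma jordan_exp T i : U *m T \in L -> U *m T ^+ i \in L.
Proof.
move=> LT; elim: i => [|i IHi]; first by rewrite expr0 mulmx1.
have := LM LT IHi; rewrite /jprod !mulmxA !mulmxKV //.
by rewrite -!mulmxA -[T *m T ^+ i]exprS -[T ^+ i *m T]exprSr Defs.half_double.
Qed.

(** For [T = U^-1 X], Cayley-Hamilton makes [T^-1] a polynomial in [T], so that [W = U T^-1] lies in
    [L]. *)
Lemma jordan_inv X : X \in L -> X \in unitmx ->
  exists2 W, W \in L & invmx X = invmx U *m W *m invmx U.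
Proof.
move=> LX uX; pose T := invmx U *m X.
have uT : T \in unitmx by rewrite unitmx_mul unitmx_inv uU.
have LT p : U *m horner_mx T p \in L.
  rewrite -[p]coefK poly_def linear_sum mulmx_sumr; apply: memv_suml => i _ /=.
  rewrite linearZ rmorphXn /= horner_mx_X -scalemxAr memvZ // jordan_exp //.
  by rewrite /T mulKVmx.
have [q [c pE]] : exists q c, char_poly T = q * 'X + c%:P.
  elim/poly_ind: (char_poly T) => [|q c _]; last by exists q, c.
  by exists 0, 0; rewrite mul0r add0r polyC0.
have c0 : c != 0.
  have := char_poly_det T; rewrite pE coefD coefMX coefC /= add0r => ->.
  by rewrite mulf_neq0 ?signr_eq0 // -unitfE -unitmxE.
have := Cayley_Hamilton T; rewrite pE rmorphD rmorphM /= horner_mx_X horner_mx_C.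
move/eqP; rewrite addrC addr_eq0 => /eqP qT.
have TV : invmx T = - (c^-1 *: horner_mx T q).
  apply: (can_inj (mulmxK uT)); rewrite mulVmx // mulNmx -scalemxAl -scalerN.
  by rewrite -qT scale_scalar_mx mulVf.
exists (U *m invmx T); first by rewrite TV -scaleNr -scalemxAr memvZ.
rewrite mulKmx //; apply: (can_inj (mulKmx uX)); rewrite mulmxV //.
have XE : X = U *m T by rewrite /T mulKVmx.
by rewrite {1}XE -mulmxA mulKVmx // mulmxV.
Qed.
End Inverse.

Section Net.
Variable K : numFieldType.
Implicit Types (k l : net5) (x y z w : K * K * K).

Definition dot3 x y : K := x.1.1 * y.1.1 + x.1.2 * y.1.2 + x.2 * y.2.

Lemma gen3_inv k (U : 'M[K]_5) : U \in net K k -> U \in unitmx ->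
  exists w, invmx U = netU K k *m gen3 k w *m netU K k.
Proof.
move=> LU uU; have [_ /mem_net[x [y [z ->]]] ->] :=
  jordan_inv (mem_gen3 k (net1 K k)) (unit_netU K k) (@net_jprod K k) LU uU.
by exists (x, y, z); rewrite -/(netU K k) invmx_netU.
Qed.

Lemma comb_net k (x : 'cV[K]_3) :
  comb (tnth (net_tuple K k)) x = gen3 k (x 0 0, x 1 0, x 2 0).
Proof. exact: (gen_sum k (fun i => x i 0)). Qed.

(** In the source, [netU *m gen3 k w *m netU] runs over a set that contains the inverses of all
    units. In the target it is enough to keep the inverse of the distinguished unit. *)
Lemma net_transfer k l lam mu :
    pdeg (tnth (net_tuple K k)) (tnth (net_tuple K l)) ->
  exists lam' mu',
  [/\ lam != 0 -> lam' != 0, mu != 0 -> mu' != 0, mu = 0 -> mu' = 0 &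
  forall Psi, closed_rel Psi -> congr_inv Psi ->
    (forall w x x2 y, dot3 lam x = 0 -> dot3 lam x2 = 0 -> dot3 mu y = 0 ->
       Psi (netU K k *m gen3 k w *m netU K k) (gen3 k x) (gen3 k x2) (gen3 k y)) ->
    forall x x2 y, dot3 lam' x = 0 -> dot3 lam' x2 = 0 -> dot3 mu' y = 0 ->
      Psi (netU K l) (gen3 l x) (gen3 l x2) (gen3 l y)].
Proof.
pose row x : 'rV[K]_3 := \row_i [:: x.1.1; x.1.2; x.2]`_i.
pose col x : 'cV[K]_3 := (row x)^T.
pose trip (r : 'rV[K]_3) := (r 0 0, r 0 1, r 0 2).
have rowK x : trip (row x) = x by case: x => [[x y] z]; rewrite /trip !mxE.
have tripK r : row (trip r) = r.
  apply/rowP => -[[|[|[|//]]] lti]; rewrite mxE /=; congr (r _ _); exact: val_inj.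
have dotE r (x : 'cV[K]_3) : r *m x = (dot3 (trip r) (trip x^T))%:M.
  rewrite [LHS]mx11_scalar; congr (_%:M); rewrite !mxE !big_ord_recl big_ord0 addr0.
  rewrite !addrA /dot3 /= !mxE.
  by congr (_ + _ * _ + _ * _); congr (_ _ _); apply: val_inj.
have row0 : row 0 = 0 by rewrite -[RHS]tripK; congr row; rewrite /trip !mxE.
have rowN0 x : x != 0 -> row x != 0.
  by apply: contraNneq => x0; rewrite -[x]rowK x0 /trip !mxE.
move=> /(@transfer _ _ _ _ _ (row lam) (row mu)) [r [s [r0 s0 s00 rsP]]].
exists (trip r), (trip s); split.
- by move=> lam0; apply: contraNneq (r0 (rowN0 _ lam0)) => t0; rewrite -[r]tripK t0 row0.
- by move=> mu0; apply: contraNneq (s0 (rowN0 _ mu0)) => t0; rewrite -[s]tripK t0 row0.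
- by move=> mu0; rewrite s00 ?mu0 // /trip !mxE.
move=> Psi clPsi invPsi PsiS x x2 y lx lx2 my.
have dotR q z : dot3 (trip q) z = 0 -> q *m col z = 0.
  by move=> qz; rewrite dotE trmxK rowK qz raddf0.
have dotL q (z : 'cV_3) : row q *m z = 0 -> dot3 q (trip z^T) = 0.
  rewrite dotE rowK => /matrixP/(_ 0 0); by rewrite !mxE.
have combE m (z : 'cV_3) : comb (tnth (net_tuple K m)) z = gen3 m (trip z^T).
  by rewrite comb_net /trip !mxE.
have genE m z : gen3 m z = comb (tnth (net_tuple K m)) (col z).
  by rewrite combE trmxK rowK.
rewrite -[netU K l]invmx_netU /netU !(genE l).
apply: (rsP Psi clPsi invPsi); rewrite -?genE ?unit_netU //; try exact: dotR.
move=> u v v2 t uU rv rv2 st; rewrite !combE in uU *.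
have [w ->] := gen3_inv (mem_gen3 _ _) uU.
by apply: PsiS; apply: dotL.
Qed.

End Net.

(** * Closed relations invariant under congruence *)

Section Relations.
Variables (K : numFieldType) (n : nat).
Implicit Types (F : 'M[K]_n -> 'M[K]_n -> 'M[K]_n -> 'M[K]_n -> 'M[K]_n).

Definition rank_rel r F (V X X2 Y : 'M[K]_n) : Prop := (\rank (F V X X2 Y) <= r)%N.

(** The scalar [a] collects one factor [c] for each occurrence of [V] in [F]; an upper bound on the
    rank is insensitive to it. *)
Definition covariant F := forall g c V X X2 Y, g \in unitmx -> exists a,
  F (c *: ((invmx g)^T *m V *m invmx g))
    (g *m X *m g^T) (g *m X2 *m g^T) (g *m Y *m g^T)
  = a *: (g *m F V X X2 Y *m g^T).

Definition polynomial F := exists Fp, forall t V X X2 Y,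
  ev t (Fp V X X2 Y) = F (ev t V) (ev t X) (ev t X2) (ev t Y).

Lemma rank_rel_closed r F : polynomial F -> closed_rel (rank_rel r F).
Proof.
case=> Fp FpE V X X2 Y q q0 rF; rewrite /rank_rel -FpE.
by apply: rank_ev0 q0 _ => t qt; rewrite FpE; apply: rF.
Qed.

Lemma rank_rel_inv r F : covariant F -> congr_inv (rank_rel r F).
Proof.
move=> covF g c V X X2 Y ug _; rewrite /rank_rel; have [a ->] := covF g c V X X2 Y ug.
apply: leq_trans; rewrite (leq_trans (mxrank_scale _ _)) //.
by rewrite (leq_trans (mxrankM_maxl _ _)) ?mxrankM_maxr.
Qed.

Lemma congr_telescope (g V X Y : 'M[K]_n) c : g \in unitmx ->
  g *m X *m g^T *m (c *: ((invmx g)^T *m V *m invmx g)) *m (g *m Y *m g^T)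
  = c *: (g *m (X *m V *m Y) *m g^T).
Proof.
move=> ug; rewrite -scalemxAr -scalemxAl !mulmxA mulmxKV //.
by rewrite -[g *m X *m g^T *m _]mulmxA -trmx_mul mulVmx // trmx1 mulmx1.
Qed.

Definition valX (V X X2 Y : 'M[K]_n) := X.
Definition valY (V X X2 Y : 'M[K]_n) := Y.
Definition mulXX (V X X2 Y : 'M[K]_n) := X *m V *m X2.
Definition mulXY (V X X2 Y : 'M[K]_n) := X *m V *m Y.
Definition cubeX (V X X2 Y : 'M[K]_n) := X *m V *m X *m V *m X.
Definition sqrXY (V X X2 Y : 'M[K]_n) := X *m V *m Y *m V *m (X *m V *m Y).
Definition commXY (V X X2 Y : 'M[K]_n) := X *m V *m Y - Y *m V *m X.

Lemma polynomial_valX : polynomial valX. Proof. by exists (fun _ X _ _ => X). Qed.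
Lemma polynomial_valY : polynomial valY. Proof. by exists (fun _ _ _ Y => Y). Qed.
Lemma polynomial_mulXX : polynomial mulXX.
Proof. by exists (fun V X X2 _ => X *m V *m X2) => *; rewrite !evM. Qed.
Lemma polynomial_mulXY : polynomial mulXY.
Proof. by exists (fun V X _ Y => X *m V *m Y) => *; rewrite !evM. Qed.
Lemma polynomial_cubeX : polynomial cubeX.
Proof. by exists (fun V X _ Y => X *m V *m X *m V *m X) => *; rewrite !evM. Qed.
Lemma polynomial_sqrXY : polynomial sqrXY.
Proof.
by exists (fun V X _ Y => X *m V *m Y *m V *m (X *m V *m Y)) => *; rewrite !evM.
Qed.
Lemma polynomial_commXY : polynomial commXY.
Proof.
by exists (fun V X _ Y => X *m V *m Y - Y *m V *m X) => *; rewrite raddfB /= !evM.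
Qed.

Lemma covariant_valX : covariant valX.
Proof. by exists 1; rewrite scale1r. Qed.
Lemma covariant_valY : covariant valY.
Proof. by exists 1; rewrite scale1r. Qed.
Lemma covariant_mulXX : covariant mulXX.
Proof. by move=> g c *; exists c; apply: congr_telescope. Qed.
Lemma covariant_mulXY : covariant mulXY.
Proof. by move=> g c *; exists c; apply: congr_telescope. Qed.
Lemma covariant_cubeX : covariant cubeX.
Proof.
move=> g c V X X2 Y ug; exists (c * c); rewrite /cubeX congr_telescope //.
by rewrite -2!scalemxAl congr_telescope // scalerA.
Qed.
Lemma covariant_sqrXY : covariant sqrXY.
Proof.
move=> g c V X X2 Y ug; exists (c * c * c); rewrite /sqrXY congr_telescope //.
by rewrite -2!scalemxAl -scalemxAr congr_telescope // !scalerA.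
Qed.
Lemma covariant_commXY : covariant commXY.
Proof.
move=> g c V X X2 Y ug; exists c; rewrite /commXY !congr_telescope //.
by rewrite -scalerBr mulmxBr mulmxBl.
Qed.

(* On a pencil of forms [a w], with a common linear factor [a], every 2 x 2
   minor is up to sign the square of a linear form in [w]. *)
Definition minor2 (A B : 'M[K]_n) (p q : 'rV[K]_n) : K :=
  (p *m A *m p^T) 0 0 * (q *m B *m q^T) 0 0
  + (p *m B *m p^T) 0 0 * (q *m A *m q^T) 0 0
  - 2 * ((p *m A *m q^T) 0 0 * (p *m B *m q^T) 0 0).

(** The 2 x 2 minors of [s X + t X2] are binary quadratic forms in [s] and [t], with polarization
    [minor2]; the equation says that their discriminant vanishes. *)
Definition common_factor (V X X2 Y : 'M[K]_n) : Prop := forall p q,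
  minor2 X X2 p q ^+ 2 = minor2 X X p q * minor2 X2 X2 p q.

(** Proportionality of [X V X] and [X], cross-multiplied so that it consists of polynomial equations
    and is closed. *)
Definition square_parallel (V X X2 Y : 'M[K]_n) : Prop := forall p q : 'rV[K]_n,
  (p *m X *m q^T) 0 0 *: (X *m V *m X) = (p *m (X *m V *m X) *m q^T) 0 0 *: X.

Lemma common_factor_inv : congr_inv common_factor.
Proof.
move=> g c V X X2 Y ug _ H p q.
have E A a b : (a *m (g *m A *m g^T) *m b^T) = (a *m g) *m A *m (b *m g)^T.
  by rewrite trmx_mul !mulmxA.
by rewrite /minor2 !E; apply: H.
Qed.

Lemma square_parallel_inv : congr_inv square_parallel.
Proof.
move=> g c V X X2 Y ug _ H p q.
have E A a b : (a *m (g *m A *m g^T) *m b^T) = (a *m g) *m A *m (b *m g)^T.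
  by rewrite trmx_mul !mulmxA.
rewrite congr_telescope // -scalemxAr -scalemxAl [in RHS]mxE !E.
rewrite scalerA mulrC -!scalerA; congr (_ *: _).
have Z s A : s *: (g *m A *m g^T) = g *m (s *: A) *m g^T.
  by rewrite -scalemxAr -scalemxAl.
by rewrite !Z H.
Qed.

Lemma common_factor_closed : closed_rel common_factor.
Proof.
move=> V X X2 Y q q0 H a b.
pose m (A B : 'M[{poly K}]_n) : {poly K} :=
  (cst a *m A *m (cst a)^T) 0 0 * (cst b *m B *m (cst b)^T) 0 0
  + (cst a *m B *m (cst a)^T) 0 0 * (cst b *m A *m (cst b)^T) 0 0
  - 2%:P * ((cst a *m A *m (cst b)^T) 0 0 * (cst a *m B *m (cst b)^T) 0 0).
have evm t A B : (m A B).[t] = minor2 (ev t A) (ev t B) a b.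
  have e (c d : 'rV[K]_n) C : ((cst c *m C *m (cst d)^T) 0 0).[t] = (c *m ev t C *m d^T) 0 0.
    by rewrite -{2}[c](ev_cst t) -{2}[d](ev_cst t) [(ev t _)^T]map_trmx -!evM [RHS]mxE.
  by rewrite /m hornerD hornerN hornerD !hornerM !e hornerC.
have /(congr1 (horner_eval 0)) : m X X2 * m X X2 - m X X * m X2 X2 = 0.
  apply: poly_eq0 q0 _ => t qt; rewrite hornerD hornerN !hornerM !evm -expr2.
  by rewrite (H t qt) subrr.
rewrite /horner_eval hornerD hornerN !hornerM !evm -expr2 horner0.
by move/eqP; rewrite subr_eq0 => /eqP.
Qed.

Lemma square_parallel_closed : closed_rel square_parallel.
Proof.
move=> V X X2 Y q q0 H a b.
pose e (A : 'M[{poly K}]_n) : {poly K} := (cst a *m A *m (cst b)^T) 0 0.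
have eE t A : (e A).[t] = (a *m ev t A *m b^T) 0 0.
  by rewrite -{1}[a](ev_cst t) -{1}[b](ev_cst t) [(ev t _)^T]map_trmx -!evM [RHS]mxE.
have /(congr1 (map_mx (horner_eval 0))) :
    e X *: (X *m V *m X) - e (X *m V *m X) *: X = 0.
  apply: pmx_eq0 q0 _ => t qt; rewrite raddfB /= !evZ !eE !evM (H t qt).
  by rewrite subrr.
by rewrite raddfB /= !evZ !eE !evM map_mx0 => /eqP; rewrite subr_eq0 => /eqP.
Qed.
End Relations.

(** * Consequences and sources of rank bounds *)

Section RankBounds.
Variable K : numFieldType.

Lemma rank_support n (M : 'M[K]_n) (s : seq 'I_n) :
  (forall i j, i \notin s -> M i j = 0) -> (\rank M <= size s)%N.
Proof.
move=> M0; pose A := \matrix_(i < n, k < size s) ((k : nat) == index i s)%:R : 'M[K]_(_, _).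
pose B := \matrix_(k < size s, j < n) M (tnth (in_tuple s) k) j.
have -> : M = A *m B.
  apply/matrixP => i j; rewrite mxE; have [si|si] := boolP (i \in s).
    have lti : (index i s < size s)%N by rewrite index_mem.
    rewrite (bigD1 (Ordinal lti)) //= !mxE eqxx mul1r (tnth_nth i) /= nth_index //.
    rewrite big1 ?addr0 // => k; rewrite -val_eqE !mxE /= => /negPf ->.
    by rewrite mul0r.
  rewrite M0 // big1 // => k _; rewrite mxE.
  by rewrite memNindex // ltn_eqF ?mul0r.
by rewrite (leq_trans (mxrankM_maxr _ _)) ?rank_leq_row.
Qed.

(** A minor of size [r + 1] vanishes; [f] and [g] list its rows and columns in an order that makes
    it triangular, so the determinant is the product of the diagonal. *)
Lemma rank_trig n (M : 'M[K]_n) r (f g : 'I_r.+1 -> 'I_n) :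
  (\rank M <= r)%N -> (forall i j : 'I_r.+1, (i < j)%N -> M (f i) (g j) = 0) ->
  \prod_i M (f i) (g i) = 0.
Proof.
move=> rM M0; have trigM : is_trig_mx (mxsub f g M).
  by apply/is_trig_mxP => i j lt_ij; rewrite mxE M0.
transitivity (\det (mxsub f g M)).
  by rewrite det_trig //; apply: eq_bigr => i _; rewrite mxE.
apply/eqP; rewrite -[_ == _]negbK -unitfE -unitmxE -row_free_unit -row_leq_rank -ltnNge.
have -> : mxsub f g M = rowsub f 1%:M *m (M *m colsub g 1%:M).
  by rewrite mulmx_colsub mulmx1 -mxsub_mul mul1mx.
rewrite ltnS (leq_trans _ rM) //.
by rewrite (leq_trans (mxrankM_maxr _ _)) ?mxrankM_maxl.
Qed.

Definition sym_prod n (v w : 'rV[K]_n) : 'M[K]_n := v^T *m w + w^T *m v.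

Lemma rank_sym_prod n (v w : 'rV[K]_n) : (\rank (sym_prod v w) <= 2)%N.
Proof.
have r1 (a b : 'rV[K]_n) : (\rank (a^T *m b) <= 1)%N.
  exact: leq_trans (mxrankM_maxr _ _) (rank_leq_row _).
exact: leq_trans (mxrank_add _ _) (leq_add (r1 _ _) (r1 _ _)).
Qed.

(** For a fixed [v] the minor is [-2] times a product of values of one linear form at [w] and at
    [w']. This is why a common linear factor makes the discriminant vanish. *)
Lemma minor2_sym_prod n (v w w' p q : 'rV[K]_n) :
  minor2 (sym_prod v w) (sym_prod v w') p q =
  - 2 * (((p *m v^T) 0 0 * (q *m w^T) 0 0 - (q *m v^T) 0 0 * (p *m w^T) 0 0)
      * ((p *m v^T) 0 0 * (q *m w'^T) 0 0 - (q *m v^T) 0 0 * (p *m w'^T) 0 0)).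
Proof.
have E (a b c d : 'rV[K]_n) : (a *m (c^T *m d) *m b^T) 0 0 =
    (a *m c^T) 0 0 * (b *m d^T) 0 0.
  rewrite mulmxA -mulmxA mxE big_ord1; congr (_ * _).
  by rewrite -[d *m b^T]trmxK trmx_mul trmxK mxE.
have D (a b : 'M[K]_1) : (a + b) 0 0 = a 0 0 + b 0 0 by rewrite mxE.
by rewrite /minor2 /sym_prod !mulmxDr !mulmxDl !D !E; ring.
Qed.
End RankBounds.

(** * Planes contained in coordinate planes *)

Section Planes.
Variables (K : numFieldType) (lam : K * K * K).
Hypothesis lam0 : lam != 0.
Implicit Types x : K * K * K.

(** Vectors orthogonal to [lam = (a, b, c)] are tested in turn: [(b, -a, 0)] gives [a b = 0], and
    then [(-c, 1, a)] or [(1, -c, b)] gives [c = 0]. Geometrically, a plane in a union of two planes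
    is one of them. *)
Lemma kernel01 : (forall x, dot3 lam x = 0 -> x.1.1 * x.1.2 = 0) ->
  (forall x, x.1.1 = 0 -> dot3 lam x = 0) \/ (forall x, x.1.2 = 0 -> dot3 lam x = 0).
Proof.
case: lam lam0 => -[a b] c; rewrite /dot3 /= => l0 H.
have kill u v : dot3 (a, b, c) (u, v) = 0 -> u.1 * u.2 = 0 by apply: (H (u, v)).
have ab : b * - a = 0 by apply: (kill (b, - a) 0); rewrite /dot3 /=; ring.
have [a0|a0] := eqVneq a 0; last first.
  have b0 : b = 0 by move: ab => /eqP; rewrite mulrN oppr_eq0 mulf_eq0 (negPf a0) orbF => /eqP.
  have lc : dot3 (a, b, c) (- c, 1, a) = 0 by rewrite /dot3 /= b0; ring.
  have /eqP := kill _ _ lc; rewrite /= mulr1 oppr_eq0 => /eqP c0.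
  by left => x /= ->; rewrite b0 c0; ring.
have [b0|b0] := eqVneq b 0.
  have lc : dot3 (a, b, c) (1, 1, 0) = 0 by rewrite /dot3 /= a0 b0; ring.
  by have /eqP := kill _ _ lc; rewrite /= mulr1 oner_eq0.
have lc : dot3 (a, b, c) (1, - c, b) = 0 by rewrite /dot3 /= a0; ring.
have /eqP := kill _ _ lc; rewrite /= mul1r oppr_eq0 => /eqP c0.
by right => x /= ->; rewrite a0 c0; ring.
Qed.

Lemma kernel0 :
  (forall x, dot3 lam x = 0 -> x.1.1 * x.1.2 = 0 /\ x.1.1 * x.2 = 0) ->
  forall x, x.1.1 = 0 -> dot3 lam x = 0.
Proof.
move=> H; have [x /H[]|//|H1] := kernel01 => //.
have [|_] := H (1, 0, 1); first exact: H1.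
by rewrite /= mulr1 => /eqP; rewrite oner_eq0.
Qed.

Lemma kernel1 : (forall x, dot3 lam x = 0 -> x.1.2 = 0) ->
  forall x, x.1.2 = 0 -> dot3 lam x = 0.
Proof.
move=> H; have [x /H ->|H0|//] := kernel01; first by rewrite mulr0.
by have /eqP := H (0, 1, 0) (H0 (0, 1, 0) erefl); rewrite oner_eq0.
Qed.

Lemma kernel_not_line : ~ forall x, dot3 lam x = 0 -> x.1.1 = 0 /\ x.1.2 = 0.
Proof.
move=> H; have H1 := kernel1 (fun x lx => proj2 (H x lx)).
by have [/eqP] := H (1, 0, 0) (H1 (1, 0, 0) erefl); rewrite oner_eq0.
Qed.
End Planes.

(** * Non-degenerations *)

Section Sources.
Variable K : numFieldType.
Implicit Types (k l : net5) (x y w : K * K * K).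

Definition ndeg k l := pdeg (tnth (net_tuple K k)) (tnth (net_tuple K l)).

Definition mul3 k x y := netM k x.1.1 x.1.2 x.2 y.1.1 y.1.2 y.2.

Lemma gen3_mul k x y : k <> B2_112 ->
  gen3 k x *m netU K k *m gen3 k y = gen3 k (mul3 k x y).
Proof. exact: gen_mul. Qed.

Lemma gen3_mulV k x w y : k <> B2_112 ->
  gen3 k x *m (netU K k *m gen3 k w *m netU K k) *m gen3 k y
  = gen3 k (mul3 k (mul3 k x w) y).
Proof. by move=> kB; rewrite !mulmxA !gen3_mul. Qed.

Lemma mul3C k x y : mul3 k x y = mul3 k y x.
Proof.
by case: x y => [[x y] z] [[x' y'] z']; case: k; rewrite /mul3 /=;
  congr (_, _, _); ring.
Qed.

Lemma mul3A k x y z : k <> B2_112 -> mul3 k x (mul3 k y z) = mul3 k (mul3 k x y) z.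
Proof.
by case: x y z => [[? ?] ?] [[? ?] ?] [[? ?] ?]; case: k => // _; rewrite /mul3 /=;
  congr (_, _, _); ring.
Qed.

Lemma e0_neq0 : (1, 0, 0) != 0 :> K * K * K.
Proof. by rewrite !xpair_eqE oner_eq0. Qed.

Lemma e1_neq0 : (0, 1, 0) != 0 :> K * K * K.
Proof. by rewrite !xpair_eqE oner_eq0 andbF. Qed.

Lemma dot_e0 x : dot3 (1, 0, 0) x = x.1.1.
Proof. by rewrite /dot3 /=; ring. Qed.

Lemma dot_e1 x : dot3 (0, 1, 0) x = x.1.2.
Proof. by rewrite /dot3 /=; ring. Qed.

Definition plane_comm l :=
  exists2 lam, lam != 0 & forall x y, dot3 lam x = 0 ->
    gen3 l x *m netU K l *m gen3 l y = gen3 l y *m netU K l *m gen3 l x.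

Definition plane_rank2 l :=
  exists2 lam, lam != 0 & forall x, dot3 lam x = 0 -> (\rank (gen3 l x) <= 2)%N.

Definition plane_square_rank1 l :=
  exists2 lam, lam != 0 & forall x, dot3 lam x = 0 ->
  (\rank (gen3 l x *m netU K l *m gen3 l x) <= 1)%N.

Definition plane_nil3 l :=
  exists2 lam, lam != 0 & forall x, dot3 lam x = 0 ->
  gen3 l x *m netU K l *m gen3 l x *m netU K l *m gen3 l x = 0.

Definition plane_nil2 l :=
  exists2 lam, lam != 0 & forall x, dot3 lam x = 0 ->
  gen3 l x *m netU K l *m gen3 l x = 0.

Definition plane_factor l (par : Prop) :=
  exists2 lam, lam != 0 & forall x y, dot3 lam x = 0 -> dot3 lam y = 0 ->
  [/\ (\rank (gen3 l x) <= 2)%N,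
      common_factor (netU K l) (gen3 l x) (gen3 l y) 0
    & par -> square_parallel (netU K l) (gen3 l x) (gen3 l y) 0].

Definition planes_rank3 l (Psi : 'M[K]_5 -> Prop) :=
  exists lam mu, [/\ lam != 0, mu != 0,
    forall x, dot3 lam x = 0 -> (\rank (gen3 l x) <= 3)%N,
    forall y, dot3 mu y = 0 -> (\rank (gen3 l y) <= 3)%N
  & forall x y, dot3 lam x = 0 -> dot3 mu y = 0 ->
    Psi (gen3 l x *m netU K l *m gen3 l y)].

Lemma gen3_0 k : gen3 k (0 : K * K * K) = 0.
Proof. by have := genZ k (0 : K) 0 0 0; rewrite scale0r !mulr0 => ->. Qed.

Lemma ndeg_plane k l lam : lam != 0 -> ndeg k l ->
  exists2 nu, nu != 0 & forall Psi, closed_rel Psi -> congr_inv Psi ->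
    (forall w x x2 y, dot3 lam x = 0 -> dot3 lam x2 = 0 ->
       Psi (netU K k *m gen3 k w *m netU K k) (gen3 k x) (gen3 k x2) (gen3 k y)) ->
    forall x x2 y, dot3 nu x = 0 -> dot3 nu x2 = 0 ->
      Psi (netU K l) (gen3 l x) (gen3 l x2) (gen3 l y).
Proof.
move=> lam0 /(net_transfer lam 0)[nu [mu [/(_ lam0) l0 _ /(_ erefl) -> H]]].
exists nu => // Psi clPsi invPsi PsiS x x2 y lx lx2.
by apply: (H Psi clPsi invPsi) => //= [*|]; [apply: PsiS | rewrite /dot3 !mul0r !addr0].
Qed.

(** The product [mul3] of every net but [B2_112] is commutative and associative, so that
    [X V Y - Y V X] vanishes in the source for every [V]. *)
Lemma ndeg_comm k l : k <> B2_112 -> ndeg k l -> plane_comm l.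
Proof.
move=> kB /(ndeg_plane e0_neq0)[nu nu0 H]; exists nu => // x y nx.
apply/eqP; rewrite -subr_eq0 -mxrank_eq0 -leqn0.
apply: (H (rank_rel 0 (@commXY K 5)) _ _ _ x x y) => //.
- exact: rank_rel_closed (@polynomial_commXY K 5).
- exact: rank_rel_inv (@covariant_commXY K 5).
move=> w x1 x2 z _ _; rewrite /rank_rel /commXY !gen3_mulV //.
rewrite [mul3 k (mul3 k z w) x1]mul3C [mul3 k z w]mul3C mul3A //.
by rewrite subrr mxrank0.
Qed.

Lemma ndeg_rank2 k l : k = A1_201 \/ k = A2_121 -> ndeg k l -> plane_rank2 l.
Proof.
pose lam : K * K * K := if k is A1_201 then (1, 0, 0) else (0, 1, 0).
have lam0 : lam != 0 by rewrite /lam; case: (k); rewrite ?e0_neq0 ?e1_neq0.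
move=> kE /(ndeg_plane lam0)[nu nu0 H]; exists nu => // x nx.
apply: (H (rank_rel 2 (@valX K 5)) _ _ _ x x x) => //.
- exact: rank_rel_closed (@polynomial_valX K 5).
- exact: rank_rel_inv (@covariant_valX K 5).
move=> w [[x1 x2] x3] y z; case: kE @lam {lam0 nu0 H} => -> /=.
  rewrite dot_e0 /= => -> _.
  apply: (@rank_support _ _ _ [:: 3; 4]) => i j; rewrite !mxE.
  by move: i j; apply: all_ord5; apply: all_ord5.
rewrite dot_e1 /= => -> _.
apply: (@rank_support _ _ _ [:: 0; 1]) => i j; rewrite !mxE.
by move: i j; apply: all_ord5; apply: all_ord5.
Qed.

(** In both sources the plane [y = 0] is spanned by [a^2] and an element of square 0 annihilated by
    it, so that [X V X] is a multiple of [a^2], of rank 1. *)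
Lemma ndeg_square_rank1 k l :
  k = A2_102 \/ k = A2_121 -> ndeg k l -> plane_square_rank1 l.
Proof.
move=> kE /(ndeg_plane e1_neq0)[nu nu0 H]; exists nu => // x nx.
apply: (H (rank_rel 1 (@mulXX K 5)) _ _ _ x x x) => //.
- exact: rank_rel_closed (@polynomial_mulXX K 5).
- exact: rank_rel_inv (@covariant_mulXX K 5).
move=> [[w1 w2] w3] [[x1 x2] x3] [[y1 y2] y3] z; rewrite !dot_e1 /= => -> ->.
rewrite /rank_rel /mulXX gen3_mulV; last by case: kE => ->.
by case: kE => ->; apply: (@rank_support _ _ _ [:: 0]) => i j; rewrite !mxE;
  move: i j; apply: all_ord5; apply: all_ord5; rewrite //= !(mul0r, mulr0, addr0).
Qed.

Lemma ndeg_nil3 k l : k = A3_011 \/ k = A3_201 -> ndeg k l -> plane_nil3 l.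
Proof.
move=> kE /(ndeg_plane e0_neq0)[nu nu0 H]; exists nu => // x nx.
apply/eqP; rewrite -mxrank_eq0 -leqn0.
apply: (H (rank_rel 0 (@cubeX K 5)) _ _ _ x x x) => //.
- exact: rank_rel_closed (@polynomial_cubeX K 5).
- exact: rank_rel_inv (@covariant_cubeX K 5).
move=> [[w1 w2] w3] [[x1 x2] x3] y z; rewrite dot_e0 /= => -> _.
rewrite /rank_rel /cubeX; case: kE => ->; rewrite !gen3_mulV // /mul3 /=.
  by rewrite !(mul0r, mulr0, addr0) gen3_0 mxrank0.
by rewrite !(mul0r, mulr0, addr0) gen3_0 mxrank0.
Qed.

Lemma ndeg_nil2 k l : k = C5_1 \/ k = C5_2 -> ndeg k l -> plane_nil2 l.
Proof.
move=> kE /(ndeg_plane e0_neq0)[nu nu0 H]; exists nu => // x nx.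
apply/eqP; rewrite -mxrank_eq0 -leqn0.
apply: (H (rank_rel 0 (@mulXX K 5)) _ _ _ x x x) => //.
- exact: rank_rel_closed (@polynomial_mulXX K 5).
- exact: rank_rel_inv (@covariant_mulXX K 5).
move=> [[w1 w2] w3] [[x1 x2] x3] [[y1 y2] y3] z; rewrite !dot_e0 /= => -> ->.
rewrite /rank_rel /mulXX gen3_mulV; last by case: kE => ->.
by case: kE => ->; rewrite /mul3 /= !(mul0r, mulr0, addr0) gen3_0 mxrank0.
Qed.

Definition linear_factor k : 'rV[K]_5 :=
  delta_mx 0 (match k with A2_301 => 3 | _ => 0 end).

(** The halves are due to [sym_prod v v], which is twice the matrix of the square of [v]. *)
Definition cofactor k x : 'rV[K]_5 :=
  lmx 1 5 [:: match k with
              | A2_301 => [:: 0; 0; 0; x.2 / 2; x.1.2]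
              | B2_112 => [:: 0; x.1.1; x.2; 0; 0]
              | _ => [:: x.2 / 2; x.1.2; 0; 0; 0]
              end].

Definition factor_ker k : K * K * K := if k is B2_112 then (0, 1, 0) else (1, 0, 0).

Lemma gen3_factor k x :
  [\/ k = A2_301, k = A3_201, k = B2_112 | k = C5_2] -> dot3 (factor_ker k) x = 0 ->
  gen3 k x = sym_prod (linear_factor k) (cofactor k x).
Proof.
have hlf : x.2 / 2 + x.2 / 2 = x.2 by rewrite -splitr.
move=> kE; rewrite /factor_ker; case: x hlf => [[x y] z] /= hlf.
by case: kE => ->; rewrite ?dot_e0 ?dot_e1 /= => ->; apply/matrixP => i j;
  rewrite !mxE !big_ord1 !mxE; move: i j; apply: all_ord5; apply: all_ord5;
  rewrite /= ?(mul0r, mulr0, mul1r, mulr1, addr0, add0r).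
Qed.

(** On the forms [a (x b + z c)] only the entry of [V] at the row and column of [a] and [b]
    contributes to [X V X]. This separates [B2_112] from [A2_301] and [A3_201], which also have
    planes with a common factor. *)
Lemma square_parallelB w x : x.1.2 = 0 ->
  gen3 B2_112 x *m (netU K B2_112 *m gen3 B2_112 w *m netU K B2_112) *m gen3 B2_112 x
  = (x.1.1 * w.1.1) *: gen3 B2_112 x.
Proof.
case: w x => [[w1 w2] w3] [[x y] z] /= ->.
have -> : netU K B2_112 *m gen3 B2_112 (w1, w2, w3) *m netU K B2_112 =
    lmx 5 5 [:: [:: 0; w1; 0; 0; 0]; [:: w1; 0; 0; w3; 0]; [:: 0; 0; 0; w2; 0];
                [:: 0; w3; w2; 0; 0]; [:: 0; 0; 0; 0; w2]].
  by_mx5.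
rewrite (lmx5M (u := [:: [:: x * w1; 0; 0; x * w3 + z * w2; 0];
  [:: 0; x * w1; 0; 0; 0]; [:: 0; z * w1; 0; 0; 0]; [::]; [::]])).
  by_mx5.
by move=> [|[|[|[|[|i]]]]] [|[|[|[|[|j]]]]] //= _ _; ring.
Qed.

Lemma ndeg_factor k l : [\/ k = A2_301, k = A3_201, k = B2_112 | k = C5_2] ->
  ndeg k l -> plane_factor l (k = B2_112).
Proof.
have lam0 : factor_ker k != 0.
  by rewrite /factor_ker; case: (k); rewrite ?e0_neq0 ?e1_neq0.
move=> kE /(ndeg_plane lam0)[nu nu0 H]; exists nu => // x y nx ny; split=> [||kB].
- apply: (H (rank_rel 2 (@valX K 5)) _ _ _ x x x) => //.
  + exact: rank_rel_closed (@polynomial_valX K 5).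
  + exact: rank_rel_inv (@covariant_valX K 5).
  by move=> w x1 x2 z lx _; rewrite /rank_rel /valX gen3_factor // rank_sym_prod.
- rewrite -(gen3_0 l); apply: H nx ny.
  + exact: common_factor_closed.
  + exact: common_factor_inv.
  move=> w x1 x2 z lx1 lx2 p q; rewrite !gen3_factor // !minor2_sym_prod.
  by ring.
- rewrite -(gen3_0 l); apply: H nx ny.
  + exact: square_parallel_closed.
  + exact: square_parallel_inv.
  rewrite kB => w x1 x2 z lx1 _ p q; rewrite square_parallelB; last first.
    by rewrite -dot_e1.
  by rewrite -scalemxAr -scalemxAl [in RHS]mxE !scalerA [_ * (p *m _ *m _) 0 0]mulrC.
Qed.

(** The two planes are [x = 0] and [y = 0]. Their product is the line of the third generator, which
    is [e^2] of rank 1 for [A1_011] and the element [c^2] of square 0 for [A2_211]. *)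
Lemma ndeg_rank3 k l : k = A1_011 \/ k = A2_211 -> ndeg k l ->
  planes_rank3 l (fun M =>
    if k is A1_011 then (\rank M <= 1)%N else M *m netU K l *m M == 0).
Proof.
move=> kE /(net_transfer (1, 0, 0) (0, 1, 0)).
case=> [lam [mu [/(_ e0_neq0) l0 /(_ e1_neq0) m0 _ H]]].
exists lam, mu; split=> // [x lx | y my | x y lx my].
- apply: (H (rank_rel 3 (@valX K 5)) _ _ _ x x 0) => //.
  + exact: rank_rel_closed (@polynomial_valX K 5).
  + exact: rank_rel_inv (@covariant_valX K 5).
  + move=> w [[x1 x2] x3] y z; rewrite dot_e0 /= => -> _ _.
    by case: kE => ->; apply: (@rank_support _ _ _ [:: 2; 3; 4]) => i j;
      rewrite !mxE; move: i j; apply: all_ord5; apply: all_ord5.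
  + by rewrite /dot3 /= !mulr0 !addr0.
- apply: (H (rank_rel 3 (@valY K 5)) _ _ _ 0 0 y) => //.
  + exact: rank_rel_closed (@polynomial_valY K 5).
  + exact: rank_rel_inv (@covariant_valY K 5).
  + move=> w x z [[x1 x2] x3]; rewrite dot_e1 /= => _ _ ->; case: kE => ->.
      by apply: (@rank_support _ _ _ [:: 0; 1; 4]) => i j;
        rewrite !mxE; move: i j; apply: all_ord5; apply: all_ord5.
    by apply: (@rank_support _ _ _ [:: 0; 1; 2]) => i j;
      rewrite !mxE; move: i j; apply: all_ord5; apply: all_ord5.
  + by rewrite /dot3 /= !mulr0 !addr0.
  + by rewrite /dot3 /= !mulr0 !addr0.
case: kE H => -> H.
- apply: (H (rank_rel 1 (@mulXY K 5)) _ _ _ x x y) => //.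
  + exact: rank_rel_closed (@polynomial_mulXY K 5).
  + exact: rank_rel_inv (@covariant_mulXY K 5).
  move=> [[w1 w2] w3] [[x1 x2] x3] z [[y1 y2] y3]; rewrite dot_e0 dot_e1 /= => -> _ ->.
  rewrite /rank_rel /mulXY gen3_mulV //.
  by apply: (@rank_support _ _ _ [:: 4]) => i j; rewrite !mxE;
    move: i j; apply: all_ord5; apply: all_ord5; rewrite //= !(mul0r, mulr0, addr0).
- rewrite -mxrank_eq0 -leqn0.
  apply: (H (rank_rel 0 (@sqrXY K 5)) _ _ _ x x y) => //.
  + exact: rank_rel_closed (@polynomial_sqrXY K 5).
  + exact: rank_rel_inv (@covariant_sqrXY K 5).
  move=> [[w1 w2] w3] [[x1 x2] x3] z [[y1 y2] y3]; rewrite dot_e0 dot_e1 /= => -> _ ->.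
  rewrite /rank_rel /sqrXY !gen3_mulV // /mul3 /=.
  by rewrite !(mul0r, mulr0, addr0, add0r) gen3_0 mxrank0.
Qed.
End Sources.

(** * Nets that fail these properties *)

Section Targets.
Variable K : numFieldType.
Implicit Types (k l : net5) (x y w : K * K * K) (M : 'M[K]_5).

Lemma rank1_minor M a b a' b' : (\rank M <= 1)%N -> M a b' = 0 ->
  M a a' * M b b' = 0.
Proof.
move=> rM ab; rewrite -[RHS](rank_trig (f := fun i : 'I_2 => nth a [:: a; b] i)
  (g := fun i => nth a [:: a'; b'] i) rM).
  by rewrite !big_ord_recl big_ord0 mulr1.
by move=> [[|[|i]] lti] [[|[|j]] ltj].
Qed.

Lemma rank2_minor M a b c a' b' c' : (\rank M <= 2)%N ->
  M a b' = 0 -> M a c' = 0 -> M b c' = 0 -> M a a' * (M b b' * M c c') = 0.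
Proof.
move=> rM ab ac bc; rewrite -[RHS](rank_trig (f := fun i : 'I_3 => nth a [:: a; b; c] i)
  (g := fun i => nth a [:: a'; b'; c'] i) rM).
  by rewrite !big_ord_recl big_ord0 mulr1.
by move=> [[|[|[|i]]] lti] [[|[|[|j]]] ltj].
Qed.

Lemma rank3_minor M a b c d a' b' c' d' : (\rank M <= 3)%N ->
  M a b' = 0 -> M a c' = 0 -> M a d' = 0 -> M b c' = 0 -> M b d' = 0 ->
  M c d' = 0 -> M a a' * (M b b' * (M c c' * M d d')) = 0.
Proof.
move=> rM ab ac ad bc bd cd; rewrite -[RHS](rank_trig
  (f := fun i : 'I_4 => nth a [:: a; b; c; d] i)
  (g := fun i => nth a [:: a'; b'; c'; d'] i) rM).
  by rewrite !big_ord_recl big_ord0 mulr1.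
by move=> [[|[|[|[|i]]]] lti] [[|[|[|[|j]]]] ltj].
Qed.

Lemma cube0 (t : K) : t * t * t = 0 -> t = 0.
Proof. by move=> /eqP; rewrite !mulf_eq0 !orbb => /eqP. Qed.

Lemma gen3E l x i j : gen3 l x i j = (nth [::] (gen_rows l x.1.1 x.1.2 x.2) i)`_j.
Proof. by rewrite mxE. Qed.

Lemma gen3_inj l : injective (@gen3 K l).
Proof. by move=> [[? ?] ?] [[? ?] ?] /gen_inj[/= -> -> ->]. Qed.

Lemma gen3_square_B x : gen3 B2_112 x *m netU K B2_112 *m gen3 B2_112 x =
  gen3 B2_112 (x.1.1 ^+ 2, x.1.2 ^+ 2, (x.1.1 + x.1.2) * x.2).
Proof.
have h : 2 != 0 :> K by rewrite pnatr_eq0.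
apply: (can_inj (scalerK h)); rewrite /gen3 genZ scaler_nat mulr2n gen_mulC.
by congr gen; rewrite /=; ring.
Qed.

Lemma not_plane_comm : ~ plane_comm K B2_112.
Proof.
case=> -[[a b] c] lam0 H.
(* The centralizer is a line: commuting with the third generator forces equal first coordinates, and
   commuting with the first kills the last one. *)
have {}H x : dot3 (a, b, c) x = 0 -> x.1.1 = x.1.2 /\ x.2 = 0.
  move=> lx; split.
    have /matrixP/(_ 0 2) := H x (0, 0, 1) lx.
    by rewrite !(mxE, sum_ord5) /=
      !(mul0r, mulr0, mul1r, mulr1, add0r, addr0).
  have /matrixP/(_ 2 0) := H x (1, 0, 0) lx.
  by rewrite !(mxE, sum_ord5) /=
    !(mul0r, mulr0, mul1r, mulr1, add0r, addr0).
have [|/= c0 /eqP] := H (c, 0, - a); first by rewrite /dot3 /=; ring.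
rewrite /= oppr_eq0 => /eqP a0.
have [|/= b0 _] := H (b, - a, 0); first by rewrite /dot3 /=; ring.
by move: lam0; rewrite b0 c0 a0 oppr0 eqxx.
Qed.

(** In the excluded nets the first two coordinates are cubed by taking cubes, so a plane of elements
    of cube 0 would lie on a line. *)
Lemma not_plane_nil3 l : plane_nil3 K l ->
  match l return Prop with A3_201 | A3_011 | C5_1 | C5_2 => True | _ => False end.
Proof.
case=> lam lam0 H.
suff : match l return Prop with A3_201 | A3_011 | C5_1 | C5_2 => True
                  | _ => forall x, dot3 lam x = 0 -> x.1.1 = 0 /\ x.1.2 = 0 end.
  by case: (l) => // /(kernel_not_line lam0).
have [lB | lB] : l = B2_112 \/ l <> B2_112 by case: (l); first [by left | by right].
  subst l => x lx; move: (H x lx); rewrite gen3_square_B => /matrixP Hx.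
  have := Hx 0 1; have := Hx 4 4; rewrite !(mxE, sum_ord5) /=.
  rewrite !(mul0r, mulr0, mul1r, mulr1, add0r, addr0) !expr2.
  by move=> /cube0 -> /cube0 ->.
have {}H x : dot3 lam x = 0 -> mul3 l (mul3 l x x) x = (0, 0, 0).
  by move=> /H; rewrite !gen3_mul // -(gen3_0 K l) => /gen3_inj.
by case: l lB H => // _ H x /H[/= /cube0 -> /cube0 -> _].
Qed.

Lemma not_plane_nil2 l : plane_nil2 K l ->
  match l return Prop with C5_1 | C5_2 => True | _ => False end.
Proof.
have sq0 (t : K) : t * t = 0 -> t = 0.
  by move/eqP; rewrite mulf_eq0 orbb => /eqP.
have last0 (t u v : K) : t = 0 -> t * u + v * v + u * t = 0 -> v = 0.
  by move=> ->; rewrite mul0r mulr0 add0r addr0 => /sq0.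
case=> lam lam0 H; have : plane_nil3 K l.
  by exists lam => // x /H ->; rewrite !mul0mx.
have [->|lB] : l = B2_112 \/ l <> B2_112 by case: (l); first [by left | by right].
  by move/not_plane_nil3.
have {}H x : dot3 lam x = 0 -> mul3 l x x = (0, 0, 0).
  by move=> /H; rewrite !gen3_mul // -(gen3_0 K l) => /gen3_inj.
move/not_plane_nil3; case: l lB H => // _ H _; apply: (kernel_not_line lam0) => x /H [].
  by move=> /sq0 x0 _ /(last0 _ _ _ x0).
by move=> /sq0 x0 _ /(last0 _ _ _ x0).
Qed.

(** A coordinate that acts on a block of size at least 2 must vanish. For [A1_011], [A2_211],
    [A2_301] and [B2_112] these are the first two, which leaves no plane. For [A1_201] the plane
    [x = 0] is left, but it contains [d^2 + e^2], its own square, of rank 2. *)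
Lemma not_plane_square_rank1 l : plane_square_rank1 K l ->
  match l return Prop with A1_011 | A1_201 | A2_211 | A2_301 | B2_112 => False
                         | _ => True end.
Proof.
have sq0 (t : K) : t * t * (t * t) = 0 -> t = 0.
  by move/eqP; rewrite !mulf_eq0 !orbb => /eqP.
have [-> | lB] : l = B2_112 \/ l <> B2_112 by case: (l); first [by left | by right].
  case=> lam lam0 H; apply: (kernel_not_line lam0) => x /H.
  rewrite gen3_square_B => r1.
  have := @rank1_minor _ 1 0 0 1 r1; have := @rank1_minor _ 3 2 2 3 r1.
  rewrite !gen3E /= !expr2 => /(_ erefl)/sq0 -> /(_ erefl)/sq0 ->.
  by [].
case=> lam lam0 H; have {}H x : dot3 lam x = 0 -> (\rank (gen3 l (mul3 l x x)) <= 1)%N.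
  by move/H; rewrite gen3_mul.
case: l lB H => // _ H.
- have /kernel0 kx : forall x, dot3 lam x = 0 -> x.1.1 * x.1.2 = 0 /\ x.1.1 * x.2 = 0.
    move=> x /H r1; have := @rank1_minor _ 0 1 0 1 r1.
    by rewrite !gen3E /= => /(_ erefl)/sq0 ->; rewrite !mul0r.
  have := @rank1_minor _ 3 4 3 4 (H (0, 1, 1) (kx lam0 (0, 1, 1) erefl)).
  by rewrite !gen3E /= !mulr1 => /(_ erefl)/eqP; rewrite oner_eq0.
- apply: (kernel_not_line lam0) => x /H r1.
  have := @rank1_minor _ 0 1 0 1 r1; have := @rank1_minor _ 2 3 2 3 r1.
  by rewrite !gen3E /= => /(_ erefl)/sq0 -> /(_ erefl)/sq0 ->.
- apply: (kernel_not_line lam0) => x /H r1.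
  have := @rank1_minor _ 0 1 0 1 r1; have := @rank1_minor _ 3 2 2 3 r1.
  by rewrite !gen3E /= => /(_ erefl)/sq0 -> /(_ erefl)/sq0 ->.
- apply: (kernel_not_line lam0) => x /H r1.
  have := @rank1_minor _ 0 1 0 1 r1; have := @rank1_minor _ 4 3 3 4 r1.
  by rewrite !gen3E /= => /(_ erefl)/sq0 -> /(_ erefl)/sq0 ->.
Qed.

Lemma triple0 (t : K) : t * (t * t) = 0 -> t = 0.
Proof. by move=> /eqP; rewrite !mulf_eq0 !orbb => /eqP. Qed.

Lemma double0 (t u : K) : t * (t * u) = 0 -> t * u = 0.
Proof. by move=> /eqP; rewrite mulrA mulf_eq0 mulf_eq0 orbb -mulf_eq0 => /eqP. Qed.

(** The minors used are triangular for a suitable order of rows and columns, and so reduce to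
    monomials in the coordinates. These pin the plane down, or leave none. *)
Lemma rank2_kernel l lam : lam != 0 ->
    (forall x, dot3 lam x = 0 -> (\rank (gen3 l x) <= 2)%N) ->
  match l return Prop with
  | A1_201 | A2_301 | A3_201 | C5_1 => forall x, x.1.1 = 0 -> dot3 lam x = 0
  | A2_121 => forall x, x.1.2 = 0 -> dot3 lam x = 0
  | A1_011 | A2_102 | A2_211 | A3_011 => False
  | _ => True
  end.
Proof.
move=> lam0 H.
have no1 : (1 * (1 * 1) : K) <> 0 by rewrite !mulr1; apply/eqP/oner_neq0.
have ker0 : (forall x, dot3 lam x = 0 -> x.1.1 = 0) ->
    forall x, x.1.1 = 0 -> dot3 lam x = 0.
  by move=> k0; apply: kernel0 => // x /k0 ->; rewrite !mul0r.
case: l H => // H.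
- apply: ker0 => x /H r2; have := @rank2_minor _ 0 1 2 0 1 2 r2.
  by rewrite !gen3E /= => /(_ erefl erefl erefl)/triple0.
- have /(kernel0 lam0) k0 : forall x, dot3 lam x = 0 -> x.1.1 * x.1.2 = 0 /\ x.1.1 * x.2 = 0.
    move=> x /H r2; have := @rank2_minor _ 0 1 2 0 1 2 r2.
    have := @rank2_minor _ 0 1 4 0 1 4 r2; rewrite !gen3E /=.
    by move=> /(_ erefl erefl erefl)/double0 -> /(_ erefl erefl erefl)/double0 ->.
  have := @rank2_minor _ 2 3 4 2 3 4 (H (0, 1, 1) (k0 (0, 1, 1) erefl)).
  by rewrite !gen3E /= => /(_ erefl erefl erefl)/no1.
- apply: kernel1 => // x /H r2; have := @rank2_minor _ 2 3 4 1 3 4 r2.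
  by rewrite !gen3E /= => /(_ erefl erefl erefl)/triple0.
- have /(kernel1 lam0) k1 : forall x, dot3 lam x = 0 -> x.1.2 = 0.
    move=> x /H r2; have := @rank2_minor _ 3 4 1 2 1 4 r2.
    by rewrite !gen3E /= => /(_ erefl erefl erefl)/triple0.
  have := @rank2_minor _ 0 1 2 0 1 2 (H (1, 0, 1) (k1 (1, 0, 1) erefl)).
  by rewrite !gen3E /= => /(_ erefl erefl erefl)/no1.
- have /(kernel1 lam0) k1 : forall x, dot3 lam x = 0 -> x.1.2 = 0.
    move=> x /H r2; have := @rank2_minor _ 3 2 4 2 3 4 r2.
    by rewrite !gen3E /= => /(_ erefl erefl erefl)/triple0.
  have := @rank2_minor _ 0 1 2 0 1 2 (H (1, 0, 1) (k1 (1, 0, 1) erefl)).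
  by rewrite !gen3E /= => /(_ erefl erefl erefl)/no1.
- apply: ker0 => x /H r2; have := @rank2_minor _ 0 1 2 0 1 2 r2.
  by rewrite !gen3E /= => /(_ erefl erefl erefl)/triple0.
- apply: ker0 => x /H r2; have := @rank2_minor _ 2 1 0 0 1 2 r2.
  by rewrite !gen3E /= => /(_ erefl erefl erefl)/triple0.
- have k0 : forall x, x.1.1 = 0 -> dot3 lam x = 0.
    apply: ker0 => x /H r2; have := @rank2_minor _ 2 1 0 0 1 2 r2.
    by rewrite !gen3E /= => /(_ erefl erefl erefl)/triple0.
  have := @rank2_minor _ 1 0 3 0 1 3 (H (0, 1, 0) (k0 (0, 1, 0) erefl)).
  by rewrite !gen3E /= => /(_ erefl erefl erefl)/no1.
- apply: ker0 => x /H r2; have := @rank2_minor _ 4 3 2 0 1 2 r2.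
  by rewrite !gen3E /= => /(_ erefl erefl erefl)/triple0.
Qed.

Lemma not_plane_rank2 l : plane_rank2 K l ->
  match l return Prop with A1_011 | A2_102 | A2_211 | A3_011 => False | _ => True end.
Proof. by case=> lam lam0 /(rank2_kernel lam0); case: l. Qed.

Lemma delta_form M i j :
  ((delta_mx 0 i : 'rV_5) *m M *m (delta_mx 0 j : 'rV_5)^T) 0 0 = M i j.
Proof. by rewrite -rowE trmx_delta -colE !mxE. Qed.

(** On the coordinates [i] and [j] the pencil is [s a^2 + t b^2], with minor [s t], which is not a
    square. *)
Lemma not_common_factor (X Y : 'M[K]_5) V Z i j :
    X i i = 1 -> X i j = 0 -> X j j = 0 -> Y i i = 0 -> Y i j = 0 -> Y j j = 1 ->
  ~ common_factor V X Y Z.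
Proof.
move=> Xii Xij Xjj Yii Yij Yjj /(_ (delta_mx 0 i) (delta_mx 0 j)).
rewrite /minor2 !delta_form Xii Xij Xjj Yii Yij Yjj => /eqP.
by rewrite !(mulr0, mul0r, mulr1, subr0, addr0, expr2) oner_eq0.
Qed.

Lemma not_plane_factor l (par : Prop) : plane_factor K l par ->
  match l return Prop with
  | A2_301 | A3_201 => ~ par
  | B2_112 | C5_2 => True
  | _ => False
  end.
Proof.
case=> lam lam0 H.
have {H}[r2 cf sp] : [/\ forall x, dot3 lam x = 0 -> (\rank (gen3 l x) <= 2)%N,
    forall x y, dot3 lam x = 0 -> dot3 lam y = 0 ->
      common_factor (netU K l) (gen3 l x) (gen3 l y) 0
  & forall x, par -> dot3 lam x = 0 ->
      square_parallel (netU K l) (gen3 l x) (gen3 l x) 0].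
  split=> [x lx | x y lx ly | x p lx]; last by have [_ _] := H x x lx lx; apply.
    by have [] := H x x lx lx.
  by have [] := H x y lx ly.
have := rank2_kernel lam0 r2; case: l {r2} cf sp => // cf sp kE.
- have := cf _ _ (kE (0, 1, 0) erefl) (kE (0, 0, 1) erefl).
  by apply: (@not_common_factor _ _ _ _ 3 4); rewrite gen3E.
- have := cf _ _ (kE (1, 0, 0) erefl) (kE (0, 0, 1) erefl).
  by apply: (@not_common_factor _ _ _ _ 0 1); rewrite gen3E.
(* In [A2_301] the element [(0, 1, 1)] has square [(0, 1, 2)], not a multiple of it. *)
- move=> p; have := sp _ p (kE (0, 1, 1) erefl) (delta_mx 0 3) (delta_mx 0 4).
  rewrite !gen3_mul // !delta_form !gen3E /mul3 /= !(mul0r, mulr1, scale1r) => /gen3_inj.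
  by case=> /(congr1 (fun t => t - 1)) /eqP; rewrite addrK subrr oner_eq0.
(* In [A3_201] the square of the nilpotent generator is the third generator. *)
- move=> p; have := sp _ p (kE (0, 1, 0) erefl) (delta_mx 0 0) (delta_mx 0 1).
  rewrite !gen3_mul // !delta_form !gen3E /mul3 /=.
  rewrite !(mulr0, mul0r, mulr1, addr0, add0r, scale1r, scale0r) -(gen3_0 K A3_201).
  by move/gen3_inj => -[/eqP]; rewrite oner_eq0.
- have := cf _ _ (kE (0, 1, 0) erefl) (kE (0, 0, 1) erefl).
  by apply: (@not_common_factor _ _ _ _ 0 1); rewrite gen3E.
Qed.

Lemma rank3_kernel l lam : lam != 0 ->
    (forall x, dot3 lam x = 0 -> (\rank (gen3 l x) <= 3)%N) ->
  match l return Prop with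
  | A1_201 | A2_301 => forall x, x.1.1 = 0 -> dot3 lam x = 0
  | A2_121 | A2_102 => forall x, x.1.2 = 0 -> dot3 lam x = 0
  | A1_011 => dot3 lam (0, 0, 1) = 0
  | _ => True
  end.
Proof.
move=> lam0 H.
have z0 (t u : K) : t * (t * (t * u)) = 0 -> t * u = 0.
  by move=> /double0 /double0.
have z1 (t : K) : t * (t * (t * t)) = 0 -> t = 0.
  by move=> /z0/eqP; rewrite mulf_eq0 orbb => /eqP.
case: l H => // H.
- apply: kernel0 => // x /H r3; have := @rank3_minor _ 0 1 2 3 0 1 2 3 r3.
  have := @rank3_minor _ 0 1 2 4 0 1 2 4 r3; rewrite !gen3E /=.
  move=> /(_ erefl erefl erefl erefl erefl erefl)/z0 ->.
  by move=> /(_ erefl erefl erefl erefl erefl erefl)/z0 ->.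
(* For [A1_011] two planes are possible, [x = 0] and [y = 0]; both contain [(0, 0, 1)]. *)
- case: (kernel01 lam0) => [x /H r3|k0|k1]; [|exact: k0 | exact: k1].
  have := @rank3_minor _ 0 1 2 3 0 1 2 3 r3; rewrite !gen3E /=.
  move=> /(_ erefl erefl erefl erefl erefl erefl)/double0 /eqP.
  by rewrite !mulf_eq0 orbb => /orP[] /eqP ->; rewrite ?mul0r ?mulr0.
- apply: kernel1 => // x /H r3; have := @rank3_minor _ 2 3 4 1 1 3 4 2 r3.
  by rewrite !gen3E /= => /(_ erefl erefl erefl erefl erefl erefl)/z1.
- apply: kernel1 => // x /H r3; have := @rank3_minor _ 3 4 1 2 2 1 4 3 r3.
  by rewrite !gen3E /= => /(_ erefl erefl erefl erefl erefl erefl)/z1.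
- apply: kernel0 => // x /H r3; have := @rank3_minor _ 0 1 2 3 0 1 2 3 r3.
  have := @rank3_minor _ 0 1 2 4 0 1 2 3 r3; rewrite !gen3E /=.
  move=> /(_ erefl erefl erefl erefl erefl erefl)/z0 ->.
  by move=> /(_ erefl erefl erefl erefl erefl erefl)/z0 ->.
Qed.

(** Both planes have to be [x = 0], and the square of the common element [(0, 1, 1)] has rank 2. *)
Lemma not_planes_rank3_mul l : planes_rank3 l (fun M => \rank M <= 1)%N ->
  match l return Prop with A1_201 | A2_301 => False | _ => True end.
Proof.
case=> lam [mu [lam0 mu0 /(rank3_kernel lam0) kl /(rank3_kernel mu0) km H]].
case: l kl km H => // kl km /(_ _ _ (kl (0, 1, 1) erefl) (km (0, 1, 1) erefl)).
  rewrite gen3_mul // => r1; have := @rank1_minor _ 3 4 3 4 r1.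
  by rewrite !gen3E /= !mulr1 => /(_ erefl)/eqP; rewrite oner_eq0.
rewrite gen3_mul // => r1; have := @rank1_minor _ 4 3 3 4 r1.
by rewrite !gen3E /= !mulr1 => /(_ erefl)/eqP; rewrite oner_eq0.
Qed.

(** The bound on the rank makes the two planes share an element that is not nilpotent. *)
Lemma not_planes_rank3_sqr l :
  planes_rank3 l (fun M => M *m netU K l *m M == 0) ->
  match l return Prop with A1_201 | A1_011 | A2_102 | A2_121 | A2_301 => False
                         | _ => True end.
Proof.
case=> lam [mu [lam0 mu0 /(rank3_kernel lam0) kl /(rank3_kernel mu0) km H]].
have [->|lB] // : l = B2_112 \/ l <> B2_112 by case: (l); first [by left | by right].
have {}H x : dot3 lam x = 0 -> dot3 mu x = 0 ->
    mul3 l (mul3 l x x) (mul3 l x x) = (0, 0, 0).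
  by move=> lx mx; have := H _ _ lx mx; rewrite !gen3_mul // => /eqP;
     rewrite -(gen3_0 K l) => /gen3_inj.
have no1 : (1 * 1 * (1 * 1) : K) <> 0 by rewrite !mulr1; apply/eqP/oner_neq0.
case: l {lB} kl km H => // kl km H.
- by case: (H _ (kl (0, 1, 1) erefl) (km (0, 1, 1) erefl)) => _ /no1.
- by case: (H _ kl km) => _ _ /no1.
- by case: (H _ (kl (1, 0, 0) erefl) (km (1, 0, 0) erefl)) => /no1.
- by case: (H _ (kl (1, 0, 0) erefl) (km (1, 0, 0) erefl)) => /no1.
- by case: (H _ (kl (0, 1, 1) erefl) (km (0, 1, 1) erefl)) => _ /no1.
Qed.
End Targets.

(** * The obstructions match the graph *)

Section Reach.
Variable K : numFieldType.

Definition net_path k l : Prop := exists2 p : seq net5, path net_edge k p & last k p = l.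

Ltac by_route := match goal with |- net_path _ ?l => first
  [ by exists [::] | by exists [:: l] | by exists [:: A2_102; l]
  | by exists [:: A2_121; l] | by exists [:: A3_011; l] | by exists [:: A3_201; l]
  | by exists [:: C5_1; l] | by exists [:: A2_121; C5_1; l]
  | by exists [:: A3_011; C5_1; l] | by exists [:: A2_102; A2_121; l]
  | by exists [:: A2_102; A2_121; C5_1; l] ] end.

(** For each source at most two obstructions are selected; the nets that survive them are exactly
    those reached by a route. *)
Lemma ndeg_path k l : ndeg K k l -> net_path k l.
Proof.
move=> kl.
have comm : k <> B2_112 -> l <> B2_112.
  by move=> kB lB; have := ndeg_comm kB kl; rewrite lB; apply: not_plane_comm.
have rk2 e := not_plane_rank2 (ndeg_rank2 e kl).
have sq1 e := not_plane_square_rank1 (ndeg_square_rank1 e kl).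
have nl3 e := not_plane_nil3 (ndeg_nil3 e kl).
have nl2 e := not_plane_nil2 (ndeg_nil2 e kl).
have fac e := not_plane_factor (ndeg_factor e kl).
have rk3 e := ndeg_rank3 e kl.
have by_comm : k <> B2_112 -> l = B2_112 -> net_path k l by move=> /comm.
case: k rk2 sq1 nl3 nl2 fac rk3 by_comm {kl comm} =>
  rk2 sq1 nl3 nl2 fac rk3 by_comm.
- have {sq1 nl3 nl2 fac rk3}rk2 := rk2 (or_introl erefl).
  by case: l rk2 by_comm => // _ by_comm; first [exact: by_comm | by_route].
- have {rk2 sq1 nl3 nl2 fac}rk3 := not_planes_rank3_mul (rk3 (or_introl erefl)).
  by case: l rk3 by_comm => // _ by_comm; first [exact: by_comm | by_route].
- have {}rk2 := rk2 (or_intror erefl).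
  have {nl3 nl2 fac rk3 by_comm}sq1 := sq1 (or_intror erefl).
  by case: l rk2 sq1 => // _ _; by_route.
- have {rk2 nl3 nl2 fac rk3 by_comm}sq1 := sq1 (or_introl erefl).
  by case: l sq1 => // _; by_route.
- have {rk2 sq1 nl3 nl2 fac}rk3 := not_planes_rank3_sqr (rk3 (or_intror erefl)).
  by case: l rk3 by_comm => // _ by_comm; first [exact: by_comm | by_route].
- have {rk2 sq1 nl3 nl2 rk3}fac := fac (Or41 _ _ _ erefl).
  by case: l fac by_comm => // _ by_comm; first [exact: by_comm | by_route].
- have {rk2 sq1 nl2 rk3 by_comm}fac := fac (Or42 _ _ _ erefl).
  have {}nl3 := nl3 (or_intror erefl).
  by case: l fac nl3 => // _ _; by_route.
- have {rk2 sq1 nl2 fac rk3 by_comm}nl3 := nl3 (or_introl erefl).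
  by case: l nl3 => // _; by_route.
- have {rk2 sq1 nl3 nl2 rk3 by_comm}fac := fac (Or43 _ _ _ erefl).
  by case: l fac => // fac; first [case: (fac erefl) | by_route].
- have {rk2 sq1 nl3 fac rk3 by_comm}nl2 := nl2 (or_introl erefl).
  by case: l nl2 => // _; by_route.
- have {rk2 sq1 nl3 rk3 by_comm}fac := fac (Or44 _ _ _ erefl).
  have {}nl2 := nl2 (or_intror erefl).
  by case: l fac nl2 => // _ _; by_route.
Qed.

(** Decreases strictly along each edge, which makes the graph acyclic. *)
Definition net_height k : nat :=
  match k with
  | C5_2 => 0 | C5_1 | A3_201 | B2_112 => 1 | A3_011 | A2_121 | A2_301 => 2
  | A2_102 | A2_211 => 3 | A1_201 | A1_011 => 4
  end.

Lemma net_path_antisym k l : net_path k l -> net_path l k -> k = l.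
Proof.
have edge_lt a b : net_edge a b -> (net_height b < net_height a)%N.
  by case: a; case: b.
have path_le a p : path net_edge a p -> (size p + net_height (last a p) <= net_height a)%N.
  elim: p a => //= b p IHp a /andP[/edge_lt lt_ba /IHp]; rewrite addSn.
  by move/leq_ltn_trans; apply.
case=> [[|a p] // /path_le le_kl lkl] [q /path_le le_lk lqk]; exfalso.
move: le_kl le_lk; rewrite lkl lqk /= addSn => lt_lk le_kl.
have := leq_ltn_trans (leq_addl _ _) lt_lk.
by rewrite ltnNge (leq_trans (leq_addl _ _) le_kl).
Qed.
End Reach.

(** * The edges of the graph *)

Section Edges.
Variable K : numFieldType.

(** Allows the edges to be certified by identities between quadratic forms instead of 25 matrix
    entries. *)
Lemma polarize (M : 'M[{poly K}]_5) i j : M^T = M ->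
  let v := delta_mx 0 i : 'rV_5 in let w := delta_mx 0 j : 'rV_5 in
  M i j = (2^-1)%:P *
    (((v + w) *m M *m (v + w)^T) 0 0 - (v *m M *m v^T) 0 0 - (w *m M *m w^T) 0 0).
Proof.
move=> symM v w.
have e a b : ((delta_mx 0 a : 'rV_5) *m M *m (delta_mx 0 b : 'rV_5)^T) 0 0 = M a b.
  by rewrite -rowE trmx_delta -colE !mxE.
have D (a b : 'M[{poly K}]_1) : (a + b) 0 0 = a 0 0 + b 0 0 by rewrite mxE.
have sMij : M j i = M i j by rewrite -[in LHS]symM mxE.
have h2 : (2^-1)%:P * 2 = 1 :> {poly K}.
  by rewrite -(rmorph_nat (@polyC K)) -polyCM mulVf ?pnatr_eq0.
rewrite linearD /= !(mulmxDl, mulmxDr) !D !e sMij -[LHS]mul1r -h2.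
by ring.
Qed.

(** The positive integer factors are invertible in characteristic 0. Carrying them along keeps the
    coefficients of the certificates integral, so that [ring] checks them. *)
Lemma pdeg_scaled m (S S' : 'I_m -> 'M[K]_5) (P P' : 'M[{poly K}]_5) (Q Q' : 'M_m)
    (R : 'I_m -> 'M[{poly K}]_5) (na nb nc a b c : nat) :
  (na.+1%:R * 'X^a : {poly K}) *: 1%:M = P *m P' -> (nb.+1%:R * 'X^b : {poly K}) *: 1%:M = Q *m Q' ->
  (forall j, P *m (\sum_i Q i j *: cst (S i)) *m P^T =
     (nc.+1%:R * 'X^c : {poly K}) *: cst (S' j) + 'X^(c.+1) *: R j) ->
  pdeg S S'.
Proof.
move=> PP QQ H; pose inv n : {poly K} := (n.+1%:R^-1)%:P.
have invE n : inv n * n.+1%:R = 1.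
  by rewrite -(rmorph_nat (@polyC K)) -polyCM mulVf ?pnatr_eq0.
exists P, (inv na *: P'), (inv nc *: Q), ((nc.+1%:R * inv nb) *: Q').
exists (fun j => cst (S' j) + 'X *: (inv nc *: R j)), a, b, c; split=> [|| j | j].
- by rewrite -scalemxAr -PP scalerA mulrA invE mul1r scalemx1.
- rewrite -scalemxAr -scalemxAl -QQ !scalerA.
  have -> : nc.+1%:R * inv nb * inv nc * (nb.+1%:R * 'X^b) =
    inv nc * nc.+1%:R * (inv nb * nb.+1%:R) * 'X^b by ring.
  by rewrite !invE !mul1r scalemx1.
- transitivity (inv nc *: (P *m (\sum_i Q i j *: cst (S i)) *m P^T)).
    rewrite H scalerDr !scalerDr !scalerA mulrA invE mul1r exprS.
    by congr (_ + _ *: _); ring.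
  rewrite mulmx_sumr mulmx_suml scaler_sumr; apply: eq_bigr => i _.
  by rewrite !mxE -scalemxAr -scalemxAl scalerA.
- by rewrite raddfD /= ev_cst evZ hornerX scale0r addr0.
Qed.
End Edges.

(* Over a field with a square root of -1, the twist by [last_sign] replaces the
   form [d^2 + e^2] by the congruent and split form [d^2 - e^2]. *)
Definition last_sign (R : pzRingType) : 'M[R]_5 :=
  lmx 5 5 [:: [:: 1; 0; 0; 0; 0]; [:: 0; 1; 0; 0; 0]; [:: 0; 0; 1; 0; 0];
              [:: 0; 0; 0; 1; 0]; [:: 0; 0; 0; 0; -1]].

Definition twist (R : pzRingType) (s : bool) : 'M[R]_5 :=
  if s then last_sign R else 1%:M.

Definition twistable k := if k is (A2_121 | A3_201) then true else false.

Section Edges.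
Variable K : numFieldType.
Notation T := {poly K}.

Lemma twist_sym (R : comNzRingType) s k (x y z : R) : s ==> twistable k ->
  (twist R s *m gen k x y z)^T = twist R s *m gen k x y z.
Proof.
case: s => [/= kE | _]; last by rewrite mul1mx gen_sym.
apply/matrixP => i j; rewrite !mxE !sum_ord5 !mxE.
by case: k kE => // _; move: i j; apply: all_ord5; apply: all_ord5; rewrite /=; ring.
Qed.

Lemma cst_twist s : cst (twist K s) = twist T s.
Proof.
case: s; rewrite ?map_mx1 //; apply/matrixP => i j; rewrite !mxE.
by move: i j; apply: all_ord5; apply: all_ord5; rewrite //= polyCN.
Qed.

Lemma cst_gen k (x y z : K) : cst (gen k x y z) = gen k x%:P y%:P z%:P.
Proof.
apply/matrixP => i j; rewrite !mxE.
by case: k; move: i j; apply: all_ord5; apply: all_ord5.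
Qed.

Lemma cst_net_tuple k i : cst (tnth (net_tuple K k) i) = tnth (net_tuple T k) i.
Proof. by case: i => [[|[|[|//]]] lti]; rewrite !(tnth_nth 0) cst_gen. Qed.

Definition qform (R : comNzRingType) k (s : bool) (x y z a b c d e : R) : R :=
  let e2 := if s then - (e * e) else e * e in
  match k with
  | A1_201 => x * (a * a + b * b + c * c) + y * (d * d) + z * e2
  | A1_011 => x * (a * a + b * b) + y * (c * c + d * d) + z * e2
  | A2_121 => x * (a * a) + y * (2 * b * c + d * d + e2) + z * (b * b)
  | A2_102 => x * (a * a) + y * (2 * b * e + 2 * c * d) + z * (b * b + c * c)
  | A2_211 => x * (a * a + b * b) + y * (2 * c * d + e2) + z * (c * c)
  | A2_301 => x * (a * a + b * b + c * c) + y * (2 * d * e) + z * (d * d)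
  | A3_201 => x * (2 * a * c + b * b + d * d + e2) + y * (2 * a * b) + z * (a * a)
  | A3_011 => x * (2 * a * c + b * b + 2 * d * e) + y * (2 * a * b + d * d) + z * (a * a)
  | B2_112 => x * (2 * a * b) + y * (2 * c * d + e2) + z * (2 * a * c)
  | C5_1   => x * (2 * a * e + 2 * b * d + c * c) + y * (a * a) + z * (b * b)
  | C5_2   => x * (2 * a * e + 2 * b * d + c * c) + y * (2 * a * b) + z * (a * a)
  end.

Lemma qformE (R : comNzRingType) k s (x y z : R) (v : 'rV_5) : s ==> twistable k ->
  (v *m (twist R s *m gen k x y z) *m v^T) 0 0 =
  qform k s x y z (v 0 0) (v 0 1) (v 0 2) (v 0 3) (v 0 4).
Proof.
case: s => [/= kE | _] /=; last first.
  by rewrite mul1mx mxE sum_ord5 !mxE !sum_ord5 !mxE; case: k; rewrite /=; ring.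
rewrite mxE sum_ord5 !mxE !sum_ord5 !mxE !sum_ord5 !mxE.
by case: k kE => // _; rewrite /=; ring.
Qed.

(** Format of a certificate: [P] substitutes the linear forms [w i] for the variables, the columns
    of [Q] combine the source forms, and [r] lists what is left beyond the order [c]. [P'] and [Q']
    witness invertibility away from [0]. *)
Lemma pdeg_edge s s' k l (P P' : seq (seq T)) (Q Q' : seq (seq T))
    (r : seq (T -> T -> T -> T -> T -> T)) (na nb nc a b c : nat) :
  s ==> twistable k -> s' ==> twistable l ->
  lmx 5 5 P *m lmx 5 5 P' = (na.+1%:R * 'X^a : T) *: 1%:M ->
  lmx 3 3 Q *m lmx 3 3 Q' = (nb.+1%:R * 'X^b : T) *: 1%:M ->
  (forall j, (j < 3)%N -> forall a0 a1 a2 a3 a4,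
    let w i := a0 * (nth [::] P 0)`_i + (a1 * (nth [::] P 1)`_i
      + (a2 * (nth [::] P 2)`_i + (a3 * (nth [::] P 3)`_i + a4 * (nth [::] P 4)`_i))) in
    qform k s (nth [::] Q 0)`_j (nth [::] Q 1)`_j (nth [::] Q 2)`_j
      (w 0) (w 1) (w 2) (w 3) (w 4) =
    nc.+1%:R * 'X^c *
      qform l s' (j == 0)%:R (j == 1)%:R (j == 2)%:R a0 a1 a2 a3 a4
    + 'X^(c.+1) * nth (fun _ _ _ _ _ => 0) r j a0 a1 a2 a3 a4) ->
  pdeg (fun i => twist K s *m tnth (net_tuple K k) i)
       (fun i => twist K s' *m tnth (net_tuple K l) i).
Proof.
move=> sk sl PP QQ H; pose h : T := (2^-1)%:P.
have h2 : h * 2 = 1.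
  by rewrite -(rmorph_nat (@polyC K)) -polyCM mulVf ?pnatr_eq0.
pose rv (j : 'I_3) (v : 'rV[T]_5) : T :=
  nth (fun _ _ _ _ _ => 0) r j (v 0 0) (v 0 1) (v 0 2) (v 0 3) (v 0 4).
pose R j := \matrix_(i1, i2) (h * (rv j (delta_mx 0 i1 + delta_mx 0 i2)
   - rv j (delta_mx 0 i1) - rv j (delta_mx 0 i2))) : 'M[T]_5.
apply: (pdeg_scaled (P := lmx 5 5 P) (P' := lmx 5 5 P') (Q := lmx 3 3 Q)
  (Q' := lmx 3 3 Q') (R := R)
  (na := na) (nb := nb) (nc := nc) (a := a) (b := b) (c := c)) => // j.
have -> : \sum_i (lmx 3 3 Q) i j *: cst (twist K s *m tnth (net_tuple K k) i) =
    twist T s *m gen k (nth [::] Q 0)`_j (nth [::] Q 1)`_j (nth [::] Q 2)`_j.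
  rewrite -[gen k _ _ _](gen_sum k (fun i => (nth [::] Q i)`_j)) mulmx_sumr.
  apply: eq_bigr => i _; rewrite cstM cst_twist cst_net_tuple -scalemxAr.
  by rewrite mxE.
rewrite cstM cst_twist cst_net_tuple.
have -> : tnth (net_tuple T l) j = gen l (j == 0 :> nat)%:R (j == 1 :> nat)%:R (j == 2 :> nat)%:R.
  by case: j {R rv} => [[|[|[|//]]] ltz]; rewrite (tnth_nth 0).
set M := twist T s *m _; set M' := twist T s' *m _; pose B := lmx 5 5 P *m M *m (lmx 5 5 P)^T.
have symM : M^T = M by apply: twist_sym.
have symM' : M'^T = M' by apply: twist_sym.
have symB : B^T = B by rewrite /B trmx_mul trmxK trmx_mul symM mulmxA.
have BE v : (v *m B *m v^T) 0 0 =
    nc.+1%:R * 'X^c * (v *m M' *m v^T) 0 0 + 'X^(c.+1) * rv j v.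
  have -> : v *m B *m v^T = (v *m lmx 5 5 P) *m M *m (v *m lmx 5 5 P)^T.
    by rewrite trmx_mul !mulmxA.
  rewrite !qformE // /rv -H ?ltn_ord //=.
  by congr qform; rewrite mxE sum_ord5 !mxE.
apply/matrixP => i1 i2; rewrite [LHS](polarize _ _ symB) !BE.
rewrite [RHS]mxE [X in _ = X + _]mxE [X in _ = _ + X]mxE [R j i1 i2]mxE.
rewrite [M' i1 i2](polarize _ _ symM').
by rewrite -/h; ring.
Qed.
End Edges.

Section Edges.
Variable K : numFieldType.

Lemma all_ord3 (P : 'I_3 -> Prop) : P 0 -> P 1 -> P 2 -> forall i, P i.
Proof.
move=> P0 P1 P2 [[|[|[|m]]] lt_m] //.
- by rewrite (_ : Ordinal _ = 0) //; apply: val_inj.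
- by rewrite (_ : Ordinal _ = 1) //; apply: val_inj.
- by rewrite (_ : Ordinal _ = 2) //; apply: val_inj.
Qed.

Lemma sum_ord3 (R : nmodType) (F : 'I_3 -> R) : \sum_i F i = F 0 + (F 1 + F 2).
Proof.
rewrite !big_ord_recl big_ord0 addr0.
by do ![congr (_ + _)]; congr (F _); apply: val_inj.
Qed.

Definition twisted_ndeg s k s' l :=
  pdeg (fun i => twist K s *m tnth (net_tuple K k) i)
       (fun i => twist K s' *m tnth (net_tuple K l) i).

Ltac by_mx3 := apply/matrixP; let i := fresh in let j := fresh in intros i j;
  rewrite !mxE !sum_ord3 !mxE; revert i j; apply: all_ord3; apply: all_ord3;
  rewrite /=; ring.
Ltac by_forms := case=> [|[|[|//]]] _ a b c d e; rewrite /=; ring.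

(** Collision of two idempotents: [(b + X e)^2 + (c + X d)^2 - b^2 - c^2] starts with
    [2 X (b e + c d)]. The next three edges from the nets [A1] collide a single pair of squares in
    the same way. *)
Lemma edge_A1_011_A2_102 : twisted_ndeg false A1_011 false A2_102.
Proof.
apply: (pdeg_edge (na := 0) (nb := 0) (nc := 0) (a := 1) (b := 1) (c := 1)
  (P := [:: [:: 0; 0; 0; 0; 1];
      [:: 1; 0; 1; 0; 0];
      [:: 0; 1; 0; 1; 0];
      [:: 0; 0; 0; 'X; 0];
      [:: 0; 0; 'X; 0; 0]])
  (P' := [:: [:: 0; 'X; 0; 0; - 1];
      [:: 0; 0; 'X; - 1; 0];
      [:: 0; 0; 0; 0; 1];
      [:: 0; 0; 0; 1; 0];
      [:: 'X; 0; 0; 0; 0]])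
  (Q := [:: [:: 0; - 1; 'X];
      [:: 0; 1; 0];
      [:: 'X; 0; 0]])
  (Q' := [:: [:: 0; 0; 1];
      [:: 0; 'X; 0];
      [:: 1; 1; 0]])
  (r := [:: fun a b c d e => 0;
      fun a b c d e => d * d + e * e;
      fun a b c d e => 0])) => //.
- by_mx5.
- by_mx3.
- by_forms.
Qed.

Lemma edge_A1_011_A2_211 : twisted_ndeg false A1_011 false A2_211.
Proof.
apply: (pdeg_edge (na := 0) (nb := 0) (nc := 0) (a := 2) (b := 2) (c := 2)
  (P := [:: [:: 'X; 0; 0; 0; 0];
      [:: 0; 'X; 0; 0; 0];
      [:: 0; 0; 0; 1; 1];
      [:: 0; 0; 0; 'X^2; 0];
      [:: 0; 0; 'X; 0; 0]])
  (P' := [:: [:: 'X; 0; 0; 0; 0];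
      [:: 0; 'X; 0; 0; 0];
      [:: 0; 0; 0; 0; 'X];
      [:: 0; 0; 0; 1; 0];
      [:: 0; 0; 'X^2; - 1; 0]])
  (Q := [:: [:: 1; 0; 0];
      [:: 0; 1; 0];
      [:: 0; - 1; 'X^2]])
  (Q' := [:: [:: 'X^2; 0; 0];
      [:: 0; 'X^2; 0];
      [:: 0; 1; 1]])
  (r := [:: fun a b c d e => 0;
      fun a b c d e => 'X * (d * d);
      fun a b c d e => 0])) => //.
- by_mx5.
- by_mx3.
- by_forms.
Qed.

Lemma edge_A1_201_A2_121 : twisted_ndeg false A1_201 false A2_121.
Proof.
apply: (pdeg_edge (na := 0) (nb := 0) (nc := 0) (a := 2) (b := 2) (c := 2)
  (P := [:: [:: 0; 0; 0; 'X; 0];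
      [:: 0; 0; 1; 0; 1];
      [:: 0; 0; 'X^2; 0; 0];
      [:: 'X; 0; 0; 0; 0];
      [:: 0; 'X; 0; 0; 0]])
  (P' := [:: [:: 0; 0; 0; 'X; 0];
      [:: 0; 0; 0; 0; 'X];
      [:: 0; 0; 1; 0; 0];
      [:: 'X; 0; 0; 0; 0];
      [:: 0; 'X^2; - 1; 0; 0]])
  (Q := [:: [:: 0; 1; 0];
      [:: 1; 0; 0];
      [:: 0; - 1; 'X^2]])
  (Q' := [:: [:: 0; 'X^2; 0];
      [:: 'X^2; 0; 0];
      [:: 1; 0; 1]])
  (r := [:: fun a b c d e => 0;
      fun a b c d e => 'X * (c * c);
      fun a b c d e => 0])) => //.
- by_mx5.
- by_mx3.
- by_forms.
Qed.

Lemma edge_A1_201_A2_301 : twisted_ndeg false A1_201 false A2_301.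
Proof.
apply: (pdeg_edge (na := 0) (nb := 0) (nc := 0) (a := 1) (b := 1) (c := 1)
  (P := [:: [:: 1; 0; 0; 0; 0];
      [:: 0; 1; 0; 0; 0];
      [:: 0; 0; 1; 0; 0];
      [:: 0; 0; 0; 1; 1];
      [:: 0; 0; 0; 0; 'X]])
  (P' := [:: [:: 'X; 0; 0; 0; 0];
      [:: 0; 'X; 0; 0; 0];
      [:: 0; 0; 'X; 0; 0];
      [:: 0; 0; 0; 'X; - 1];
      [:: 0; 0; 0; 0; 1]])
  (Q := [:: [:: 'X; 0; 0];
      [:: 0; - 1; 'X];
      [:: 0; 1; 0]])
  (Q' := [:: [:: 1; 0; 0];
      [:: 0; 0; 'X];
      [:: 0; 1; 1]])
  (r := [:: fun a b c d e => 0;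
      fun a b c d e => e * e;
      fun a b c d e => 0])) => //.
- by_mx5.
- by_mx3.
- by_forms.
Qed.

(** The plane [2 w2 w3] becomes [d^2 - e^2] through [w3 = d - e] and [w2] a small multiple of
    [d + e], which makes [w2^2] disappear. This is why the target is twisted; the edge from [A3_011]
    to [A3_201] is similar. *)
Lemma edge_A2_102_A2_121 : twisted_ndeg false A2_102 true A2_121.
Proof.
apply: (pdeg_edge (na := 3) (nb := 0) (nc := 3) (a := 2) (b := 0) (c := 2)
  (P := [:: [:: 2 * 'X; 0; 0; 0; 0];
      [:: 0; 2 * 'X; 0; 0; 0];
      [:: 0; 0; 0; 0; 2 * 'X];
      [:: 0; 0; 2 * 'X^2; 1; 0];
      [:: 0; 0; 2 * 'X^2; - 1; 0]])
  (P' := [:: [:: 2 * 'X; 0; 0; 0; 0];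
      [:: 0; 2 * 'X; 0; 0; 0];
      [:: 0; 0; 0; 1; 1];
      [:: 0; 0; 0; 2 * 'X^2; - 2 * 'X^2];
      [:: 0; 0; 2 * 'X; 0; 0]])
  (Q := [:: [:: 1; 0; 0];
      [:: 0; 1; 0];
      [:: 0; 0; 1]])
  (Q' := [:: [:: 1; 0; 0];
      [:: 0; 1; 0];
      [:: 0; 0; 1]])
  (r := [:: fun a b c d e => 0;
      fun a b c d e => 0;
      fun a b c d e => 4 * 'X * (d * d) + 8 * 'X * (d * e) + 4 * 'X * (e * e)])) => //.
- by_mx5.
- by_mx3.
- by_forms.
Qed.

Lemma edge_A2_102_A3_011 : twisted_ndeg false A2_102 false A3_011.
Proof.
apply: (pdeg_edge (na := 3) (nb := 0) (nc := 3) (a := 6) (b := 6) (c := 8)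
  (P := [:: [:: 2 * 'X^2; 2 * 'X^2; 0; 0; - 1];
      [:: 0; 2 * 'X^4; 0; 0; 'X^2];
      [:: 0; 0; 0; 0; 2 * 'X^4];
      [:: 0; 0; 2 * 'X^3; 0; 0];
      [:: 0; 0; 0; 2 * 'X^3; 0]])
  (P' := [:: [:: 2 * 'X^4; - 2 * 'X^2; 2; 0; 0];
      [:: 0; 2 * 'X^2; - 1; 0; 0];
      [:: 0; 0; 0; 2 * 'X^3; 0];
      [:: 0; 0; 0; 0; 2 * 'X^3];
      [:: 0; 0; 2 * 'X^2; 0; 0]])
  (Q := [:: [:: 1; - 'X^2; 'X^4];
      [:: 'X^2; 0; 0];
      [:: 0; 'X^2; 0]])
  (Q' := [:: [:: 0; 'X^4; 0];
      [:: 0; 0; 'X^4];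
      [:: 'X^2; - 1; 'X^2]])
  (r := [:: fun a b c d e => 8 * 'X * (b * c);
      fun a b c d e => 4 * 'X * (b * b);
      fun a b c d e => 0])) => //.
- by_mx5.
- by_mx3.
- by_forms.
Qed.

Lemma edge_A2_211_A3_011 : twisted_ndeg false A2_211 false A3_011.
Proof.
apply: (pdeg_edge (na := 0) (nb := 0) (nc := 0) (a := 6) (b := 8) (c := 8)
  (P := [:: [:: 1; 0; 'X^2; 0; 0];
      [:: 'X^2; 0; 0; 1; 0];
      [:: 0; 0; 0; - 'X^2; 0];
      [:: 0; 'X; 0; 0; 'X];
      [:: 0; 'X^3; 0; 0; 0]])
  (P' := [:: [:: 0; 'X^4; 'X^2; 0; 0];
      [:: 0; 0; 0; 0; 'X^3];
      [:: 'X^4; - 'X^2; - 1; 0; 0];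
      [:: 0; 0; - 'X^4; 0; 0];
      [:: 0; 0; 0; 'X^5; - 'X^3]])
  (Q := [:: [:: 'X^4; 'X^6; 0];
      [:: - 'X^4; 0; 0];
      [:: - 1; - 'X^2; 'X^4]])
  (Q' := [:: [:: 0; - 'X^4; 0];
      [:: 'X^2; 'X^2; 0];
      [:: 1; 0; 'X^4]])
  (r := [:: fun a b c d e => 'X * (e * e);
      fun a b c d e => 'X * (b * b) + 2 * 'X * (d * e) + 'X^3 * (e * e);
      fun a b c d e => 0])) => //.
- by_mx5.
- by_mx3.
- by_forms.
Qed.

Lemma edge_A2_301_A3_201 : twisted_ndeg false A2_301 false A3_201.
Proof.
apply: (pdeg_edge (na := 0) (nb := 0) (nc := 0) (a := 6) (b := 8) (c := 8)
  (P := [:: [:: 1; 0; 0; 'X^2; 0];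
      [:: 'X^2; 0; 0; 0; - 1];
      [:: 0; 0; 0; 0; 'X^2];
      [:: 0; 'X^2; 0; 0; 0];
      [:: 0; 0; 'X^2; 0; 0]])
  (P' := [:: [:: 0; 'X^4; 'X^2; 0; 0];
      [:: 0; 0; 0; 'X^4; 0];
      [:: 0; 0; 0; 0; 'X^4];
      [:: 'X^4; - 'X^2; - 1; 0; 0];
      [:: 0; 0; 'X^4; 0; 0]])
  (Q := [:: [:: 'X^4; 'X^6; 0];
      [:: 'X^4; 0; 0];
      [:: - 1; - 'X^2; 'X^4]])
  (Q' := [:: [:: 0; 'X^4; 0];
      [:: 'X^2; - 'X^2; 0];
      [:: 1; 0; 'X^4]])
  (r := [:: fun a b c d e => 0;
      fun a b c d e => 'X * (b * b) + 'X * (d * d) + 'X * (e * e);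
      fun a b c d e => 0])) => //.
- by_mx5.
- by_mx3.
- by_forms.
Qed.

Lemma edge_A2_121_A3_201 : twisted_ndeg false A2_121 false A3_201.
Proof.
apply: (pdeg_edge (na := 0) (nb := 0) (nc := 0) (a := 6) (b := 8) (c := 8)
  (P := [:: [:: 1; 'X^2; 0; 0; 0];
      [:: 'X^2; 0; - 1; 0; 0];
      [:: 0; 0; 'X^2; 0; 0];
      [:: 0; 0; 0; 'X^2; 0];
      [:: 0; 0; 0; 0; 'X^2]])
  (P' := [:: [:: 0; 'X^4; 'X^2; 0; 0];
      [:: 'X^4; - 'X^2; - 1; 0; 0];
      [:: 0; 0; 'X^4; 0; 0];
      [:: 0; 0; 0; 'X^4; 0];
      [:: 0; 0; 0; 0; 'X^4]])
  (Q := [:: [:: 'X^4; 'X^6; 0];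
      [:: 'X^4; 0; 0];
      [:: - 1; - 'X^2; 'X^4]])
  (Q' := [:: [:: 0; 'X^4; 0];
      [:: 'X^2; - 'X^2; 0];
      [:: 1; 0; 'X^4]])
  (r := [:: fun a b c d e => 0;
      fun a b c d e => 'X * (b * b);
      fun a b c d e => 0])) => //.
- by_mx5.
- by_mx3.
- by_forms.
Qed.

(** The missing product arises from a collision, [(a + X^2 e)^2 - a^2]. *)
Lemma edge_A2_121_C5_1 : twisted_ndeg false A2_121 false C5_1.
Proof.
apply: (pdeg_edge (na := 0) (nb := 0) (nc := 0) (a := 2) (b := 2) (c := 2)
  (P := [:: [:: 1; 0; 0; 0; 1];
      [:: 0; 'X; 0; 0; 0];
      [:: 0; 0; 0; 'X; 0];
      [:: 0; 0; 'X; 0; 0];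
      [:: 0; 0; 0; 0; 'X^2]])
  (P' := [:: [:: 'X^2; 0; 0; 0; - 1];
      [:: 0; 'X; 0; 0; 0];
      [:: 0; 0; 0; 'X; 0];
      [:: 0; 0; 'X; 0; 0];
      [:: 0; 0; 0; 0; 1]])
  (Q := [:: [:: - 1; 'X^2; 0];
      [:: 1; 0; 0];
      [:: 0; 0; 1]])
  (Q' := [:: [:: 0; 'X^2; 0];
      [:: 1; 1; 0];
      [:: 0; 0; 'X^2]])
  (r := [:: fun a b c d e => 'X * (e * e);
      fun a b c d e => 0;
      fun a b c d e => 0])) => //.
- by_mx5.
- by_mx3.
- by_forms.
Qed.

Lemma edge_A3_011_A3_201 : twisted_ndeg false A3_011 true A3_201.
Proof.
apply: (pdeg_edge (na := 3) (nb := 0) (nc := 3) (a := 2) (b := 0) (c := 2)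
  (P := [:: [:: 2 * 'X; 0; 0; 0; 0];
      [:: 0; 2 * 'X; 0; 0; 0];
      [:: 0; 0; 2 * 'X; 0; 0];
      [:: 0; 0; 0; 2 * 'X^2; 1];
      [:: 0; 0; 0; 2 * 'X^2; - 1]])
  (P' := [:: [:: 2 * 'X; 0; 0; 0; 0];
      [:: 0; 2 * 'X; 0; 0; 0];
      [:: 0; 0; 2 * 'X; 0; 0];
      [:: 0; 0; 0; 1; 1];
      [:: 0; 0; 0; 2 * 'X^2; - 2 * 'X^2]])
  (Q := [:: [:: 1; 0; 0];
      [:: 0; 1; 0];
      [:: 0; 0; 1]])
  (Q' := [:: [:: 1; 0; 0];
      [:: 0; 1; 0];
      [:: 0; 0; 1]])
  (r := [:: fun a b c d e => 0;
      fun a b c d e => 4 * 'X * (d * d) + 8 * 'X * (d * e) + 4 * 'X * (e * e);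
      fun a b c d e => 0])) => //.
- by_mx5.
- by_mx3.
- by_forms.
Qed.

(** A mere rescaling of the permuted variables: the weights make [d^2] dominate [2 a b] in the
    second source form. *)
Lemma edge_A3_011_C5_1 : twisted_ndeg false A3_011 false C5_1.
Proof.
apply: (pdeg_edge (na := 0) (nb := 0) (nc := 0) (a := 2) (b := 2) (c := 2)
  (P := [:: [:: 'X; 0; 0; 0; 0];
      [:: 0; 0; 0; 1; 0];
      [:: 0; 'X; 0; 0; 0];
      [:: 0; 0; 0; 0; 'X^2];
      [:: 0; 0; 'X; 0; 0]])
  (P' := [:: [:: 'X; 0; 0; 0; 0];
      [:: 0; 0; 'X; 0; 0];
      [:: 0; 0; 0; 0; 'X];
      [:: 0; 'X^2; 0; 0; 0];
      [:: 0; 0; 0; 1; 0]])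
  (Q := [:: [:: 1; 0; 0];
      [:: 0; 0; 'X^2];
      [:: 0; 1; 0]])
  (Q' := [:: [:: 'X^2; 0; 0];
      [:: 0; 0; 'X^2];
      [:: 0; 1; 0]])
  (r := [:: fun a b c d e => 0;
      fun a b c d e => 0;
      fun a b c d e => 2 * 'X * (a * c)])) => //.
- by_mx5.
- by_mx3.
- by_forms.
Qed.

(** The square of [w4 = 2 X a + 2 X^2 c] cancels the terms in [a^2] and [a c] of [2 w0 w1], and
    leaves [c^2]. *)
Lemma edge_B2_112_C5_2 : twisted_ndeg false B2_112 false C5_2.
Proof.
apply: (pdeg_edge (na := 3) (nb := 0) (nc := 3) (a := 4) (b := 2) (c := 4)
  (P := [:: [:: 2 * 'X^2; - 1; 0; 0; 2 * 'X];
      [:: 0; 0; 2 * 'X^2; 0; 0];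
      [:: 0; - 2 * 'X; 0; 0; 2 * 'X^2];
      [:: 0; 0; 0; 2 * 'X^2; 0];
      [:: 0; 2 * 'X^2; 0; 0; 0]])
  (P' := [:: [:: 2 * 'X^2; 0; - 2 * 'X; 0; - 1];
      [:: 0; 0; 0; 0; 2 * 'X^2];
      [:: 0; 2 * 'X^2; 0; 0; 0];
      [:: 0; 0; 0; 2 * 'X^2; 0];
      [:: 0; 0; 2 * 'X^2; 0; 2 * 'X]])
  (Q := [:: [:: 1; 0; - 'X^2];
      [:: 1; 0; 0];
      [:: 0; 1; 0]])
  (Q' := [:: [:: 0; 'X^2; 0];
      [:: 0; 0; 'X^2];
      [:: - 1; 1; 0]])
  (r := [:: fun a b c d e => 0;
      fun a b c d e => 0;
      fun a b c d e => 8 * (a * c) + (- 8 * 'X) * (a * e)])) => //.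
- by_mx5.
- by_mx3.
- by_forms.
Qed.

(** In the split form, [w3^2 - w4^2] is the product of [8 X^2 b] with [-2 b - 4 X c + 4 X^2 d]; the
    square of [w1] removes its first two terms and leaves [c^2]. *)
Lemma edge_A3_201_C5_2 : twisted_ndeg true A3_201 false C5_2.
Proof.
apply: (pdeg_edge (na := 15) (nb := 0) (nc := 15) (a := 4) (b := 1) (c := 4)
  (P := [:: [:: 4 * 'X^2; 0; 0; 0; 0];
      [:: 0; 4 * 'X; 0; - 1 + 4 * 'X^2; - 1 - 4 * 'X^2];
      [:: 0; 4 * 'X^2; 0; - 2 * 'X; - 2 * 'X];
      [:: 0; 0; 0; 2 * 'X^2; 2 * 'X^2];
      [:: 0; 0; 4 * 'X^2; 0; 0]])
  (P' := [:: [:: 4 * 'X^2; 0; 0; 0; 0];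
      [:: 0; 0; 4 * 'X^2; 4 * 'X; 0];
      [:: 0; 0; 0; 0; 4 * 'X^2];
      [:: 0; 2 * 'X^2; - 2 * 'X; - 1 + 4 * 'X^2; 0];
      [:: 0; - 2 * 'X^2; 2 * 'X; 1 + 4 * 'X^2; 0]])
  (Q := [:: [:: 1; 0; 0];
      [:: 0; 'X; 0];
      [:: 0; 0; 1]])
  (Q' := [:: [:: 'X; 0; 0];
      [:: 0; 1; 0];
      [:: 0; 0; 'X]])
  (r := [:: fun a b c d e => 0;
      fun a b c d e => 32 * (a * c);
      fun a b c d e => 0])) => //.
- by_mx5.
- by_mx3.
- by_forms.
Qed.

(** The squares [a^2] and [b^2] collide into [a b]; the change of [d] and [e] keeps the first form
    intact. *)
Lemma edge_C5_1_C5_2 : twisted_ndeg false C5_1 false C5_2.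
Proof.
apply: (pdeg_edge (na := 0) (nb := 0) (nc := 0) (a := 2) (b := 1) (c := 3)
  (P := [:: [:: 'X; 'X; 0; 0; 0];
      [:: 0; 'X^2; 0; 0; 0];
      [:: 0; 0; 'X; 0; 0];
      [:: 0; 0; 0; 1; - 1];
      [:: 0; 0; 0; 0; 'X]])
  (P' := [:: [:: 'X; - 1; 0; 0; 0];
      [:: 0; 1; 0; 0; 0];
      [:: 0; 0; 'X; 0; 0];
      [:: 0; 0; 0; 'X^2; 'X];
      [:: 0; 0; 0; 0; 'X]])
  (Q := [:: [:: 'X; 0; 0];
      [:: 0; - 1; 'X];
      [:: 0; 1; 0]])
  (Q' := [:: [:: 1; 0; 0];
      [:: 0; 0; 'X];
      [:: 0; 1; 1]])
  (r := [:: fun a b c d e => 0;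
      fun a b c d e => b * b;
      fun a b c d e => 0])) => //.
- by_mx5.
- by_mx3.
- by_forms.
Qed.

End Edges.

(** * Congruence is an equivalence relation *)

Section Congruence.
Variables (K : fieldType) (n : nat).
Implicit Types (g X : 'M[K]_n) (L : {vspace 'M[K]_n}).

Lemma congrK g X : g \in unitmx -> invmx g *m (g *m X *m g^T) *m (invmx g)^T = X.
Proof.
by move=> ug; rewrite !mulmxA mulVmx // mul1mx -mulmxA -trmx_mul mulVmx // trmx1 mulmx1.
Qed.

Lemma congrM (h g X : 'M[K]_n) : h *m g *m X *m (h *m g)^T = h *m (g *m X *m g^T) *m h^T.
Proof. by rewrite trmx_mul !mulmxA. Qed.

Lemma congruent_sym L L' : congruent L L' -> congruent L' L.
Proof.
case=> g ug ->; exists (invmx g); first by rewrite unitmx_inv.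
apply/vspaceP => X; apply/idP/idP => [LX|].
  apply/mem_congr_act; exists (g *m X *m g^T); last by rewrite congrK.
  by apply/mem_congr_act; exists X.
by case/mem_congr_act => _ /mem_congr_act[Z LZ ->] ->; rewrite congrK.
Qed.

Lemma congruent_trans L L' L'' : congruent L L' -> congruent L' L'' -> congruent L L''.
Proof.
case=> g ug -> [h uh ->]; exists (h *m g); first by rewrite unitmx_mul uh.
apply/vspaceP => X; apply/idP/idP.
  case/mem_congr_act => _ /mem_congr_act[Z LZ ->] ->.
  by apply/mem_congr_act; exists Z; rewrite ?congrM.
case/mem_congr_act => Z LZ ->; apply/mem_congr_act; exists (g *m Z *m g^T).
  by apply/mem_congr_act; exists Z.
exact: congrM.
Qed.

Lemma dim_congr_act g L : g \in unitmx -> \dim (congr_act g L) = \dim L.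
Proof.
move=> ug; apply: limg_dim_eq; apply/eqP; rewrite -subv0; apply/subvP => X.
rewrite memv_cap memv_ker lfunE /= => /andP[_ /eqP gX].
by rewrite -(congrK X ug) gX mulmx0 mul0mx mem0v.
Qed.
End Congruence.

(** * Degenerations along paths, over an algebraically closed field *)

Section Paths.
Variable K : numClosedFieldType.

(** The diagonal matrix [g] with last entry ['i] is a symmetric square root of [last_sign] and
    commutes with the twistable nets, whose last coordinate splits off. Hence the twist is a
    congruence by [g]. *)
Lemma ndeg_twist s k : s ==> twistable k ->
  pdeg (tnth (net_tuple K k)) (fun i => twist K s *m tnth (net_tuple K k) i) /\
  pdeg (fun i => twist K s *m tnth (net_tuple K k) i) (tnth (net_tuple K k)).
Proof.
case: s => [/= kE | _]; last first.
  have -> : (fun i => 1%:M *m tnth (net_tuple K k) i) = tnth (net_tuple K k).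
    by apply/funext => i; rewrite mul1mx.
  suff H : pdeg (tnth (net_tuple K k)) (tnth (net_tuple K k)) by [].
  have := pdeg_congr (tnth (net_tuple K k)) (unitmx1 K 5).
  by under [X in pdeg _ X]funext => i do rewrite mul1mx trmx1 mulmx1.
pose g : 'M[K]_5 := lmx 5 5 [:: [:: 1; 0; 0; 0; 0]; [:: 0; 1; 0; 0; 0];
  [:: 0; 0; 1; 0; 0]; [:: 0; 0; 0; 1; 0]; [:: 0; 0; 0; 0; 'i]].
have ii : 'i * 'i = -1 :> K by rewrite -expr2 sqrCi.
have gg : g *m g = last_sign K.
  apply/matrixP => i j; rewrite !mxE !sum_ord5 !mxE; move: i j.
  by apply: all_ord5; apply: all_ord5; rewrite /= ?ii; ring.
have ug : g \in unitmx.
  have : g *m g *m last_sign K = 1%:M.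
    rewrite gg; by_mx5.
  by rewrite -mulmxA => /mulmx1_unit[].
have gM i : g *m tnth (net_tuple K k) i *m g^T = last_sign K *m tnth (net_tuple K k) i.
  have gT : g^T = g.
    by apply/matrixP => a b; rewrite !mxE; move: a b; apply: all_ord5; apply: all_ord5.
  rewrite -gg gT -!mulmxA; congr (g *m _).
  apply/matrixP => a b; rewrite !mxE !sum_ord5 !mxE !(tnth_nth 0).
  case: k kE => // _; move: i; apply: all_ord3; rewrite /= !mxE;
  by move: a b; apply: all_ord5; apply: all_ord5; rewrite /=; ring.
have gF : (fun i => last_sign K *m tnth (net_tuple K k) i) =
    (fun i => g *m tnth (net_tuple K k) i *m g^T) by apply/funext => i; rewrite gM.
split; rewrite /= gF; first exact: pdeg_congr.
have uig : invmx g \in unitmx by rewrite unitmx_inv.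
have := pdeg_congr (fun i => g *m tnth (net_tuple K k) i *m g^T) uig.
under [X in pdeg _ X]funext => i.
  rewrite -!mulmxA -trmx_mul mulVmx // trmx1 mulmx1 mulKmx //.
over.
by [].
Qed.

Lemma ndeg_untwist s k s' l : s ==> twistable k -> s' ==> twistable l ->
  twisted_ndeg K s k s' l -> ndeg K k l.
Proof.
move=> /ndeg_twist[ks _] /ndeg_twist[_ sl] kl.
exact: pdeg_trans (pdeg_trans ks kl) sl.
Qed.

Lemma ndeg_edge k l : net_edge k l -> ndeg K k l.
Proof.
case: k; case: l => // _.
- exact: ndeg_untwist (edge_A1_201_A2_121 K).
- exact: ndeg_untwist (edge_A1_201_A2_301 K).
- exact: ndeg_untwist (edge_A1_011_A2_102 K).
- exact: ndeg_untwist (edge_A1_011_A2_211 K).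
- exact: ndeg_untwist (edge_A2_121_A3_201 K).
- exact: ndeg_untwist (edge_A2_121_C5_1 K).
- exact: ndeg_untwist (edge_A2_102_A2_121 K).
- exact: ndeg_untwist (edge_A2_102_A3_011 K).
- exact: ndeg_untwist (edge_A2_211_A3_011 K).
- exact: ndeg_untwist (edge_A2_301_A3_201 K).
- exact: ndeg_untwist (edge_A3_201_C5_2 K).
- exact: ndeg_untwist (edge_A3_011_A3_201 K).
- exact: ndeg_untwist (edge_A3_011_C5_1 K).
- exact: ndeg_untwist (edge_B2_112_C5_2 K).
- exact: ndeg_untwist (edge_C5_1_C5_2 K).
Qed.

Lemma ndeg_refl k : ndeg K k k.
Proof.
by have [kk kk'] := @ndeg_twist false k isT; apply: pdeg_trans kk kk'.
Qed.

Lemma path_ndeg k l : net_path k l -> ndeg K k l.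
Proof.
case=> p; elim: p k => [|m p IHp] k /= => [_ <-|/andP[/ndeg_edge km mp] lp].
  exact: ndeg_refl.
exact: pdeg_trans km (IHp m mp lp).
Qed.

Lemma degenerates_net k l : degenerates (net K k) (net K l) <-> net_path k l.
Proof.
by rewrite degeneratesE; split; [apply: ndeg_path | apply: path_ndeg].
Qed.

Lemma congruent_ndeg k l : congruent (net K k) (net K l) -> ndeg K k l.
Proof.
case=> g ug lE; apply: pdeg_trans (pdeg_congr (tnth (net_tuple K k)) ug) _.
pose T := [tuple g *m tnth (net_tuple K k) i *m g^T | i < 3].
have bT : basis_of (net K l) T.
  rewrite basisEdim size_tuple (size_basis (net_basis K l)) leqnn andbT.
  apply/subvP => X; rewrite lE => /mem_congr_act[Y kY ->].
  rewrite (coord_basis (net_basis K k) kY) mulmx_sumr mulmx_suml.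
  apply: memv_suml => i _; rewrite -scalemxAr -scalemxAl memvZ // memv_span //.
  by apply/tnthP; exists i; rewrite tnth_mktuple (tnth_nth 0).
have [D [D' [DD DE _]]] := coord_change (net_basis K l) bT.
have TE : tnth T = (fun j => g *m tnth (net_tuple K k) j *m g^T).
  by apply/funext => j; rewrite tnth_mktuple.
rewrite -TE; apply: pdeg_basis DD (mulmx1 1%:M) DE _ (ndeg_refl l) => j.
rewrite (bigD1 j) //= big1 ?addr0 => [|i /negPf ij]; rewrite mxE ?eqxx ?scale1r //.
by rewrite ij scale0r.
Qed.

Lemma congruent_net_inj k l : congruent (net K k) (net K l) -> k = l.
Proof.
move=> kl; have lk := congruent_sym kl.
by apply: net_path_antisym; apply: ndeg_path; apply: congruent_ndeg.
Qed.
End Paths.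

(** * Normal forms *)

Section Frames.
Variable K : numClosedFieldType.

(** By polarization a nonzero symmetric matrix has a nonzero value, which a square root normalises
    to 1. *)
Lemma sym_unit_vector n (S : 'M[K]_n) : S^T = S -> S != 0 ->
  exists v : 'rV_n, v *m S *m v^T = 1%:M.
Proof.
move=> symS S0; have [v vSv] : exists v : 'rV_n, (v *m S *m v^T) 0 0 != 0.
  apply: contrapT => H; case/negP: S0; apply/eqP; rewrite -(gramK symS).
  have q0 (v : 'rV_n) : (v *m S *m v^T) 0 0 = 0.
    by apply/eqP/negPn/negP => vSv; apply: H; exists v.
  by apply/matrixP => i j; rewrite [LHS]mxE !q0 !subr0 mulr0 mxE.
pose a := sqrtC ((v *m S *m v^T) 0 0); have a0 : a != 0 by rewrite sqrtC_eq0.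
exists (a^-1 *: v); rewrite linearZ /= -!scalemxAl -!scalemxAr scalerA.
rewrite [X in _ *: X]mx11_scalar scale_scalar_mx -invfM -expr2 sqrtCK.
by rewrite mulVf.
Qed.

Lemma free_basis r n (W : 'M[K]_n) : \rank W = r ->
  exists B : 'M_(r, n), row_free B /\ (B :=: W)%MS.
Proof.
by move=> <-; exists (row_base W); split; [apply: row_base_free | apply: eq_row_base].
Qed.

(** [C] is a basis of the orthogonal of the rows of [B], the kernel of [S B^T]; it is transversal to
    [B] because the restriction of [S] to [B] is nondegenerate. *)
Lemma complement k m (S : 'M[K]_(k + m)) (B : 'M_(k, k + m)) :
  S \in unitmx -> B *m S *m B^T \in unitmx ->
  exists C : 'M_(m, k + m), C *m S *m B^T = 0 /\ col_mx B C \in unitmx.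
Proof.
move=> uS uB; have freeB : row_free B.
  rewrite -row_leq_rank -{1}(mxrank_unit uB).
  exact: leq_trans (mxrankM_maxl _ _) (mxrankM_maxl _ _).
have rK : \rank (kermx (S *m B^T)) = m.
  rewrite mxrank_ker -mxrank_tr trmx_mul trmxK mxrankMfree.
    by rewrite (eqP freeB) addKn.
  by rewrite row_free_unit unitmx_tr.
have [C [freeC CK]] := free_basis rK; exists C.
have CSB : C *m S *m B^T = 0.
  by rewrite -mulmxA; apply/sub_kermxP; rewrite CK.
split=> //; rewrite -row_free_unit; apply: inj_row_free => v.
rewrite -[v]hsubmxK mul_row_col => vBC.
have v0 : lsubmx v = 0.
  have : (lsubmx v *m B + rsubmx v *m C) *m S *m B^T = 0 by rewrite vBC !mul0mx.
  rewrite !mulmxDl -!mulmxA [C *m (_ *m _)]mulmxA CSB mulmx0 addr0 [B *m _]mulmxA.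
  by move=> /(congr1 (mulmx^~ (invmx (B *m S *m B^T)))); rewrite mulmxK // mul0mx.
have : rsubmx v *m C = 0 *m C by rewrite mul0mx -vBC v0 mul0mx add0r.
by move=> /(row_free_inj freeC) ->; rewrite v0 row_mx0.
Qed.

Lemma congr_col k m n (B : 'M[K]_(k, n)) (C : 'M_(m, n)) (X : 'M_n) :
  col_mx B C *m X *m (col_mx B C)^T =
  block_mx (B *m X *m B^T) (B *m X *m C^T) (C *m X *m B^T) (C *m X *m C^T).
Proof. by rewrite mul_col_mx tr_col_mx mul_col_row. Qed.

Lemma orthonormalize n (S : 'M[K]_n) : S^T = S -> S \in unitmx ->
  exists2 g, g \in unitmx & g *m S *m g^T = 1%:M.
Proof.
elim: n S => [|n IHn] S symS uS; first by exists 1%:M; rewrite ?unitmx1 // !flatmx0.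
have S0 : S != 0.
  by apply: contraTneq uS => ->; rewrite unitmxE det0 unitr0.
have [v vSv] := sym_unit_vector symS S0.
have [|C [CSv uC]] := @complement 1 n S v uS; first by rewrite vSv unitmx1.
have vSC : v *m S *m C^T = 0.
  by apply: trmx_inj; rewrite !trmx_mul trmxK symS mulmxA CSv trmx0.
have uSC : C *m S *m C^T \in unitmx.
  have : col_mx v C *m S *m (col_mx v C)^T \in unitmx.
    by rewrite !unitmx_mul uC uS unitmx_tr uC.
  rewrite congr_col vSv vSC CSv !unitmxE.
  by rewrite (@det_ublock _ 1 n) det1 mul1r.
have symC : (C *m S *m C^T)^T = C *m S *m C^T.
  by rewrite !trmx_mul trmxK symS mulmxA.
have [h uh hSh] := IHn _ symC uSC.
exists (col_mx v (h *m C)).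
  have -> : col_mx v (h *m C) = block_mx 1%:M 0 0 h *m col_mx v C.
    by rewrite mul_block_col mul1mx !mul0mx addr0 add0r.
  by rewrite unitmx_mul uC andbT unitmxE (@det_ublock _ 1 n) det1 mul1r -unitmxE.
rewrite (@congr_col 1 n) vSv trmx_mul !mulmxA vSC mul0mx.
have -> : h *m C *m S *m v^T = 0 by rewrite -!mulmxA [C *m _]mulmxA CSv mulmx0.
have -> : h *m C *m S *m C^T *m h^T = 1%:M by rewrite -hSh !mulmxA.
by rewrite [RHS](@scalar_mx_block _ 1 n).
Qed.

Lemma ortho_complement k m (B : 'M[K]_(k, k + m)) : B *m B^T \in unitmx ->
  exists C : 'M_(m, k + m), [/\ C *m C^T = 1%:M, C *m B^T = 0, B *m C^T = 0
    & col_mx B C \in unitmx].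
Proof.
move=> uB; have [|C [CB uC]] := @complement k m 1%:M B (unitmx1 _ _).
  by rewrite mulmx1.
rewrite mulmx1 in CB.
have BC : B *m C^T = 0 by apply: trmx_inj; rewrite trmx_mul trmxK CB trmx0.
have uCC : C *m C^T \in unitmx.
  have : col_mx B C *m (col_mx B C)^T \in unitmx by rewrite unitmx_mul unitmx_tr uC.
  rewrite -{1}[col_mx B C]mulmx1 congr_col !mulmx1 CB BC !unitmxE det_ublock.
  by rewrite unitrM => /andP[].
have [|h uh hCh] := orthonormalize _ uCC; first by rewrite trmx_mul trmxK.
exists (h *m C); split.
- by rewrite trmx_mul mulmxA -[h *m C *m _]mulmxA.
- by rewrite -mulmxA CB mulmx0.
- by rewrite trmx_mul mulmxA BC mul0mx.
have -> : col_mx B (h *m C) = block_mx 1%:M 0 0 h *m col_mx B C.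
  by rewrite mul_block_col mul1mx !mul0mx addr0 add0r.
by rewrite unitmx_mul uC andbT unitmxE det_ublock det1 mul1r -unitmxE.
Qed.

(* [C C^T = 1] makes [v |-> v C] an isometric embedding; it intertwines [X]
   with its compression [C X C^T] as soon as the row space of [B] is [X]-stable. *)
Lemma compress k m (B : 'M[K]_(k, k + m)) (C : 'M_(m, k + m)) (X : 'M_(k + m)) A :
  C *m C^T = 1%:M -> C *m B^T = 0 -> col_mx B C \in unitmx ->
  X^T = X -> B *m X = A *m B ->
  C *m X *m B^T = 0 /\ C *m X = C *m X *m C^T *m C.
Proof.
move=> CC CB uC symX BX.
have CXB : C *m X *m B^T = 0.
  apply: trmx_inj; rewrite !trmx_mul trmxK symX mulmxA BX trmx0 -mulmxA.
  by rewrite -[B *m C^T]trmxK trmx_mul trmxK CB trmx0 mulmx0.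
split=> //; have ug : (col_mx B C)^T \in unitmx by rewrite unitmx_tr.
apply: (can_inj (mulmxK ug)); rewrite tr_col_mx !mul_mx_row CXB.
by rewrite -!mulmxA CC mulmx1 !mulmxA -[C *m X *m C^T *m _ *m _]mulmxA CB mulmx0.
Qed.

(** The tool by which all normal forms split: once the rows of [B] are stable under [X], so is their
    orthogonal, and compression to it is multiplicative, so that equations such as [N *m N = 0] are
    inherited. *)
Lemma frame k m (B : 'M[K]_(k, k + m)) : B *m B^T \in unitmx ->
  exists C : 'M_(m, k + m), let g := col_mx B C in
  [/\ C *m C^T = 1%:M /\ C *m B^T = 0, g \in unitmx,
      g *m g^T = block_mx (B *m B^T) 0 0 1%:M
    & forall X A, X^T = X -> B *m X = A *m B ->
      g *m X *m g^T = block_mx (B *m X *m B^T) 0 0 (C *m X *m C^T) /\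
      forall Y, C *m X *m C^T *m (C *m Y *m C^T) = C *m (X *m Y) *m C^T].
Proof.
move=> uB; have [C [CC CB BC uC]] := ortho_complement uB; exists C; split=> //.
  by rewrite tr_col_mx mul_col_row CB BC CC.
move=> X A symX BX; have [CXB CX] := compress CC CB uC symX BX; split=> [|Y].
  have BXC : B *m X *m C^T = 0 by rewrite BX -mulmxA BC mulmx0.
  by rewrite congr_col CXB BXC.
by rewrite !mulmxA -CX.
Qed.

Definition rows k n (vs : seq 'rV[K]_n) : 'M_(k, n) := \matrix_(i < k) vs`_i.

Lemma rows_mul k n p (vs : seq 'rV[K]_n) (X : 'M_(n, p)) :
  rows k vs *m X = rows k [seq v *m X | v <- vs].
Proof.
apply/row_matrixP => i; rewrite row_mul !rowK.
have [lt_i | ge_i] := ltnP i (size vs); first by rewrite (nth_map 0).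
by rewrite !nth_default ?mul0mx // size_map.
Qed.

Lemma rows_gram k n (vs ws : seq 'rV[K]_n) (i j : 'I_k) :
  (rows k vs *m (rows k ws)^T) i j = (vs`_i *m (ws`_j)^T) 0 0.
Proof. by rewrite !mxE; apply: eq_bigr => l _; rewrite !mxE. Qed.

Lemma mul_rows k n (A : 'M[K]_k) (vs : seq 'rV[K]_n) :
  A *m rows k vs = \matrix_(i < k) \sum_j A i j *: vs`_j.
Proof.
apply/row_matrixP => i; rewrite row_mul mulmx_sum_row rowK.
by apply: eq_bigr => j _; rewrite rowK mxE.
Qed.
End Frames.

Definition dsum (R : nmodType) k m (s t : seq (seq R)) : seq (seq R) :=
  mkseq (fun i => mkseq (fun j =>
    if (i < k)%N then (if (j < k)%N then (nth [::] s i)`_j else 0)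
    else (if (j < k)%N then 0 else (nth [::] t (i - k))`_(j - k)))
    (k + m)) (k + m).

Lemma block_lmx (R : nmodType) k m (s t : seq (seq R)) :
  block_mx (lmx k k s) 0 0 (lmx m m t) = lmx (k + m) (k + m) (dsum k m s t).
Proof.
apply/matrixP => i j; rewrite !mxE !nth_mkseq //.
case: splitP => i' ei; rewrite mxE; case: splitP => j' ej; rewrite !mxE //.
  by rewrite ei ej.
by rewrite ei ej !addKn.
Qed.

(** * Splitting off one block of a nilpotent symmetric matrix *)

Section Nilpotent.
Variable K : numClosedFieldType.

Lemma tr11 (M : 'M[K]_1) : M^T = M.
Proof. by apply/matrixP => i j; rewrite mxE !ord1. Qed.

Lemma nil_square_step m (N : 'M[K]_(2 + m)) : N^T = N -> N *m N = 0 -> N != 0 ->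
  exists (g : 'M_(2 + m)) (N' : 'M_m),
  [/\ g \in unitmx, g *m g^T = block_mx (lmx 2 2 [:: [:: 0; 1]; [:: 1; 0]]) 0 0 1%:M,
      g *m N *m g^T = block_mx (lmx 2 2 [:: [:: 1; 0]; [:: 0; 0]]) 0 0 N',
      N'^T = N' & N' *m N' = 0].
Proof.
move=> symN NN N0; have [v0 v0N] := sym_unit_vector symN N0.
(* The vector [u] is isotropic as [N^2 = 0], and the correction by [a / 2] makes [v] isotropic. So
   [v] and [u] span a hyperbolic plane that is stable under [N]. *)
pose a := (v0 *m v0^T) 0 0; pose u := v0 *m N; pose v := v0 - (a / 2) *: u.
have uN : u *m N = 0 by rewrite /u -mulmxA NN mulmx0.
have uu : u *m u^T = 0 by rewrite /u trmx_mul symN mulmxA -/u uN mul0mx.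
have vN : v *m N = u by rewrite mulmxBl -scalemxAl uN scaler0 subr0.
have v0u : v0 *m u^T = 1%:M by rewrite -[LHS]tr11 trmx_mul trmxK.
have uv : u *m v^T = 1%:M.
  by rewrite /v linearB linearZ /= mulmxBr -scalemxAr uu scaler0 subr0.
have vu : v *m u^T = 1%:M by rewrite -[LHS]tr11 trmx_mul trmxK.
have vv : v *m v^T = 0.
  rewrite {1}/v mulmxBl -scalemxAl uv /v linearB linearZ /= mulmxBr -scalemxAr v0u.
  rewrite [v0 *m v0^T]mx11_scalar -/a -addrA -opprD -scalerDl -splitr.
  by rewrite scalemx1 subrr.
pose B := rows 2 [:: v; u].
have BB : B *m B^T = lmx 2 2 [:: [:: 0; 1]; [:: 1; 0]].
  apply/matrixP => i j; rewrite rows_gram [RHS]mxE.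
  by case: i => [[|[|//]] ?]; case: j => [[|[|//]] ?]; rewrite /=
    ?vv ?uv ?vu ?uu mxE.
have uB : B *m B^T \in unitmx.
  have : (lmx 2 2 [:: [:: 0; 1]; [:: 1; 0]] : 'M[K]_2) *m
         lmx 2 2 [:: [:: 0; 1]; [:: 1; 0]] = 1%:M.
    apply/matrixP => i j; rewrite !mxE !big_ord_recl big_ord0 !mxE.
    by case: i => [[|[|//]] ?]; case: j => [[|[|//]] ?]; rewrite /=; ring.
  by rewrite BB => /mulmx1_unit[].
have BN : B *m N = lmx 2 2 [:: [:: 0; 1]; [:: 0; 0]] *m B.
  rewrite rows_mul mul_rows /= vN uN; apply/row_matrixP => i; rewrite !rowK.
  rewrite !big_ord_recl big_ord0 !mxE.
  by case: i => [[|[|//]] ?]; rewrite /= ?scale0r ?scale1r ?addr0 ?add0r.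
have [C [[CC CB] uC gg gX]] := frame uB; have [gN CNC] := gX _ _ symN BN.
exists (col_mx B C), (C *m N *m C^T); split=> //.
- by rewrite gg BB.
- rewrite gN; congr block_mx; rewrite rows_mul /= vN uN.
  apply/matrixP => i j; rewrite rows_gram [RHS]mxE.
  by case: i => [[|[|//]] ?]; case: j => [[|[|//]] ?]; rewrite /=
    ?uv ?uu ?mul0mx mxE.
- by rewrite !trmx_mul trmxK symN mulmxA.
- by rewrite CNC NN mulmx0 mul0mx.
Qed.

Lemma nil_cube_step m (N : 'M[K]_(3 + m)) :
    N^T = N -> N *m N *m N = 0 -> N *m N != 0 ->
  exists (g : 'M_(3 + m)) (N' : 'M_m),
  [/\ g \in unitmx,
      g *m g^T = block_mx (lmx 3 3 [:: [:: 0; 0; 1]; [:: 0; 1; 0]; [:: 1; 0; 0]]) 0 0 1%:M,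
      g *m N *m g^T = block_mx (lmx 3 3 [:: [:: 0; 1; 0]; [:: 1; 0; 0]; [:: 0; 0; 0]]) 0 0 N',
      g *m (N *m N) *m g^T =
        block_mx (lmx 3 3 [:: [:: 1; 0; 0]; [:: 0; 0; 0]; [:: 0; 0; 0]]) 0 0 (N' *m N')
    & N'^T = N' /\ N' *m N' *m N' = 0].
Proof.
move=> symN N3 N20; have symN2 : (N *m N)^T = N *m N by rewrite trmx_mul symN.
have [v0 v0N] := sym_unit_vector symN2 N20.
pose a := (v0 *m v0^T) 0 0; pose b := (v0 *m N *m v0^T) 0 0.
(* These solve [v u^T = b + 2 x = 0] and [v v^T = a + 2 x b + x^2 + 2 y = 0]. *)
pose x := - (b / 2); pose y := - ((a + x ^+ 2 + 2 * x * b) / 2).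
pose u0 := v0 *m N; pose w := v0 *m N *m N.
pose v := v0 + x *: u0 + y *: w; pose u := u0 + x *: w.
have wN : w *m N = 0 by rewrite /w -!mulmxA [N *m (N *m N)]mulmxA N3 mulmx0.
have uN : u *m N = w by rewrite mulmxDl -scalemxAl wN scaler0 addr0.
have vN : v *m N = u by rewrite !mulmxDl -!scalemxAl wN scaler0 addr0.
have D0 (p q : 'rV[K]_(3 + m)) : (p *m N) *m q^T = p *m (q *m N)^T.
  by rewrite trmx_mul symN mulmxA.
have ww : w *m w^T = 0 by rewrite {1}/w D0 wN trmx0 mulmx0.
have uw0 : u0 *m w^T = 0 by rewrite /u0 D0 wN trmx0 mulmx0.
have vw0 : v0 *m w^T = 1%:M by rewrite /w -D0 -D0 -v0N !mulmxA.
have uu0 : u0 *m u0^T = 1%:M by rewrite {2}/u0 -D0 -v0N !mulmxA.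
have vu0 : v0 *m u0^T = b%:M by rewrite /u0 -D0 [LHS]mx11_scalar.
have vv0 : v0 *m v0^T = a%:M by rewrite [LHS]mx11_scalar.
have S (p q : 'rV[K]_(3 + m)) : p *m q^T = q *m p^T by rewrite -[LHS]tr11 trmx_mul trmxK.
have uT : u^T = u0^T + x *: w^T by rewrite linearD linearZ.
have vT : v^T = v0^T + x *: u0^T + y *: w^T by rewrite !linearD !linearZ.
have uw : u *m w^T = 0 by rewrite mulmxDl -scalemxAl uw0 ww scaler0 addr0.
have vw : v *m w^T = 1%:M.
  by rewrite !mulmxDl -!scalemxAl uw0 ww vw0 !scaler0 !addr0.
have uu : u *m u^T = 1%:M.
  rewrite uT mulmxDr -scalemxAr uw scaler0 addr0.
  by rewrite mulmxDl -scalemxAl [w *m _]S uw0 scaler0 addr0.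
have vu : v *m u^T = 0.
  rewrite uT mulmxDr -scalemxAr vw.
  rewrite !mulmxDl -!scalemxAl [w *m _]S uw0 uu0 vu0 scaler0 addr0 !scalemx1.
  by rewrite -!raddfD /= /x -addrA -opprD -splitr subrr raddf0.
have vv : v *m v^T = 0.
  rewrite vT !mulmxDr -!scalemxAr vw.
  have -> : v *m v0^T = (a + x * b + y)%:M.
    rewrite S vT !mulmxDr -!scalemxAr vv0 vu0 vw0.
    by rewrite !scale_scalar_mx -!raddfD /= mulr1.
  have -> : v *m u0^T = (b + x)%:M.
    by rewrite !mulmxDl -!scalemxAl [w *m _]S uw0 uu0 vu0 scaler0 addr0 scalemx1 -raddfD.
  rewrite !scale_scalar_mx -!raddfD /= -[0](raddf0 (@scalar_mx K 1)); congr (_%:M).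
  have h : 2 != 0 :> K by rewrite pnatr_eq0.
  by rewrite /y; field.
pose B := rows 3 [:: v; u; w].
have BB : B *m B^T = lmx 3 3 [:: [:: 0; 0; 1]; [:: 0; 1; 0]; [:: 1; 0; 0]].
  apply/matrixP => i j; rewrite rows_gram [RHS]mxE; move: i j.
  by apply: all_ord3; apply: all_ord3;
    rewrite /= ?vv ?vu ?[u *m v^T]S ?[w *m _]S ?uu ?uw ?vw ?vu ?ww mxE.
have uB : B *m B^T \in unitmx.
  have : (lmx 3 3 [:: [:: 0; 0; 1]; [:: 0; 1; 0]; [:: 1; 0; 0]] : 'M[K]_3) *m
         lmx 3 3 [:: [:: 0; 0; 1]; [:: 0; 1; 0]; [:: 1; 0; 0]] = 1%:M.
    apply/matrixP => i j; rewrite !mxE sum_ord3 !mxE; move: i j.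
    by apply: all_ord3; apply: all_ord3; rewrite /=; ring.
  by rewrite BB => /mulmx1_unit[].
have BN : B *m N = lmx 3 3 [:: [:: 0; 1; 0]; [:: 0; 0; 1]; [::]] *m B.
  rewrite rows_mul mul_rows /= vN uN wN; apply/row_matrixP => i; rewrite !rowK.
  rewrite sum_ord3 !mxE; move: i.
  by apply: all_ord3; rewrite /= ?scale0r ?scale1r ?addr0 ?add0r.
have [C [[CC CB] uC gg gX]] := frame uB; have [gN CNC] := gX _ _ symN BN.
have BN2 : B *m (N *m N) = lmx 3 3 [:: [:: 0; 1; 0]; [:: 0; 0; 1]; [::]] *m
    lmx 3 3 [:: [:: 0; 1; 0]; [:: 0; 0; 1]; [::]] *m B.
  by rewrite mulmxA BN -mulmxA BN mulmxA.
have [gN2 _] := gX _ _ symN2 BN2.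
exists (col_mx B C), (C *m N *m C^T); split=> //.
- by rewrite gg BB.
- rewrite gN; congr block_mx; rewrite rows_mul /= vN uN wN.
  apply/matrixP => i j; rewrite rows_gram [RHS]mxE; move: i j.
  by apply: all_ord3; apply: all_ord3;
    rewrite /= ?mul0mx ?[u *m v^T]S ?[w *m _]S ?uu ?uw ?vw ?vu ?ww mxE.
- rewrite gN2 CNC; congr block_mx; rewrite rows_mul /= !mulmxA vN uN wN mul0mx.
  apply/matrixP => i j; rewrite rows_gram [RHS]mxE; move: i j.
  by apply: all_ord3; apply: all_ord3;
    rewrite /= ?mul0mx ?[w *m _]S ?uw ?vw ?ww mxE.
split; first by rewrite !trmx_mul trmxK symN mulmxA.
by rewrite -mulmxA !CNC [N *m (N *m N)]mulmxA N3 mulmx0 mul0mx.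
Qed.
End Nilpotent.

Section NormalForms.
Variable K : numClosedFieldType.

Definition id_rows n : seq (seq K) := mkseq (fun i => mkseq (fun j => (i == j)%:R) n) n.

Lemma lmx1 n : 1%:M = lmx n n (id_rows n).
Proof. by apply/matrixP => i j; rewrite !mxE !nth_mkseq. Qed.

Lemma lmx0 m n : 0 = lmx m n [::] :> 'M[K]_(m, n).
Proof. by apply/matrixP => i j; rewrite !mxE !nth_nil. Qed.

(** The image of a symmetric idempotent is nondegenerate and orthogonal to its kernel, on which
    every symmetric [X] with [E X = 0] lives. *)
Lemma idem_split k m (E : 'M[K]_(k + m)) : E^T = E -> E *m E = E -> \rank E = k ->
  exists (g : 'M_(k + m)) (C : 'M_(m, k + m)),
  [/\ g \in unitmx, C *m C^T = 1%:M, g *m g^T = 1%:M,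
      g *m E *m g^T = block_mx (lmx k k (id_rows k)) 0 0 (lmx m m [::])
    & forall X, X^T = X -> E *m X = 0 ->
      g *m X *m g^T = block_mx (lmx k k [::]) 0 0 (C *m X *m C^T) /\
      forall Y, C *m X *m C^T *m (C *m Y *m C^T) = C *m (X *m Y) *m C^T].
Proof.
move=> symE EE rE; have [B0 [freeB0 B0E]] := free_basis rE.
have [D DE] : exists D, E = D *m B0 by apply/submxP; rewrite B0E.
have [D' D'E] : exists D', B0 = D' *m E by apply/submxP; rewrite B0E.
have BE : B0 *m E = B0 by rewrite D'E -mulmxA EE.
have uB0 : B0 *m B0^T \in unitmx.
  rewrite -row_free_unit; apply: inj_row_free => x xBB.
  have : x *m B0 = 0 *m B0.
    have ET : E = B0^T *m D^T by rewrite -{1}symE DE trmx_mul.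
    by rewrite mul0mx -BE ET !mulmxA -[x *m B0 *m _]mulmxA xBB mul0mx.
  exact: row_free_inj.
have [|h uh hB] := orthonormalize _ uB0; first by rewrite trmx_mul trmxK.
pose B := h *m B0.
have BB : B *m B^T = 1%:M by rewrite trmx_mul mulmxA -[h *m B0 *m _]mulmxA.
have BE1 : B *m E = 1%:M *m B by rewrite mul1mx -mulmxA BE.
have [|C [[CC CB] ug gg gX]] := @frame K k m B; first by rewrite BB unitmx1.
exists (col_mx B C), C; split=> //.
- by rewrite gg BB -scalar_mx_block.
- have [-> _] := gX _ _ symE BE1.
  rewrite BE1 mul1mx BB -lmx1 -lmx0; congr block_mx.
  have CB0 : C *m B0^T = 0.
    apply: (can_inj (mulmxK (_ : h^T \in unitmx))); first by rewrite unitmx_tr.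
    by rewrite mul0mx -mulmxA -trmx_mul.
  by rewrite -symE DE trmx_mul [C *m _]mulmxA CB0 !mul0mx.
move=> X symX EX; have BX : B *m X = 0 *m B.
  by rewrite -[B]mul1mx -BE1 -mulmxA EX mulmx0 mul0mx.
have [-> CX] := gX _ _ symX BX; split=> //.
by rewrite BX !mul0mx -lmx0.
Qed.

Lemma block_congr k m (g X : 'M[K]_(k + m)) (h : 'M_m) A D :
  g *m X *m g^T = block_mx A 0 0 D ->
  (block_mx 1%:M 0 0 h *m g) *m X *m (block_mx 1%:M 0 0 h *m g)^T
  = block_mx A 0 0 (h *m D *m h^T).
Proof.
move=> gX; rewrite trmx_mul tr_block_mx trmx1 !trmx0.
rewrite !mulmxA -[block_mx _ _ _ _ *m g *m X]mulmxA -[_ *m (g *m X) *m g^T]mulmxA gX.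
by rewrite !mulmx_block !(mulmx0, mul0mx, mulmx1, mul1mx, addr0, add0r).
Qed.

Lemma block_unit k m (g : 'M[K]_(k + m)) (h : 'M_m) : g \in unitmx -> h \in unitmx ->
  block_mx 1%:M 0 0 h *m g \in unitmx.
Proof.
move=> ug uh; rewrite unitmx_mul ug andbT unitmxE det_ublock det1 mul1r.
by rewrite -unitmxE.
Qed.

Definition fits l (s : seq 'M[K]_5) :=
  exists2 g : 'M[K]_5, g \in unitmx & forall X, X \in s ->
  exists x, g *m X *m g^T = gen3 l x.

(** Mapping a spanning family into the net gives an inclusion, and the dimensions agree. *)
Lemma fits_congruent l (s : seq 'M[K]_5) L :
  \dim L = 3%N -> (L <= <<s>>)%VS -> fits l s -> congruent (net K l) L.
Proof.
move=> dimL Ls [g ug gs]; apply: congruent_sym; exists g => //; apply/esym/eqP.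
rewrite eqEdim (size_basis (net_basis K l)) dim_congr_act // dimL leqnn andbT.
apply/subvP => _ /mem_congr_act[X /(subvP Ls) sX ->].
rewrite -[s]in_tupleE in sX; rewrite (coord_span sX) mulmx_sumr mulmx_suml.
apply: memv_suml => i _; rewrite -scalemxAr -scalemxAl memvZ //.
by have [x ->] := gs _ (mem_nth 0 (ltn_ord i)); apply: mem_gen3.
Qed.
End NormalForms.

Ltac by_entries := apply/matrixP; let i := fresh in let j := fresh in
  intros i j; rewrite [LHS]mxE [RHS]mxE; revert i j; apply: all_ord5; apply: all_ord5;
  rewrite //=.

(** * Normal forms from idempotents and nilpotents *)

Section AssociativeForms.
Variable K : numClosedFieldType.

Lemma rank_block0 k m (D : 'M[K]_m) :
  \rank (block_mx (lmx k k [::]) 0 0 D) = \rank D.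
Proof. by rewrite rank_diag_block_mx -lmx0 mxrank0. Qed.

Lemma rank_congr n (g X : 'M[K]_n) : g \in unitmx -> \rank (g *m X *m g^T) = \rank X.
Proof.
move=> ug; rewrite mxrankMfree ?row_free_unit ?unitmx_tr //.
by rewrite (eqmxMfull _ _) // row_full_unit.
Qed.

Lemma compress_sym k m (C : 'M[K]_(m, k)) (X : 'M_k) : X^T = X ->
  (C *m X *m C^T)^T = C *m X *m C^T.
Proof. by move=> symX; rewrite !trmx_mul trmxK symX mulmxA. Qed.

Lemma block_step k m (g X : 'M[K]_(k + m)) (h D : 'M_m) s t :
  g *m X *m g^T = block_mx (lmx k k s) 0 0 D -> h *m D *m h^T = lmx m m t ->
  (block_mx 1%:M 0 0 h *m g) *m X *m (block_mx 1%:M 0 0 h *m g)^T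
  = lmx (k + m) (k + m) (dsum k m s t).
Proof. by move=> gX hD; rewrite (block_congr _ gX) hD block_lmx. Qed.

Lemma congr_lmx0 m (h : 'M[K]_m) : h *m lmx m m [::] *m h^T = lmx m m [::].
Proof. by rewrite -lmx0 mulmx0 mul0mx. Qed.

Lemma fits_A1 (E F : 'M[K]_5) p q l :
    E^T = E -> F^T = F -> E *m E = E -> F *m F = F -> E *m F = 0 ->
    \rank E = p -> \rank F = q ->
    (p, q, l) = (3, 1, A1_201)%N \/ (p, q, l) = (2, 2, A1_011)%N ->
  fits l [:: 1%:M; E; F].
Proof.
move=> symE symF EE FF EF rE rF; case=> -[pE qE ->];
  rewrite {}pE in rE; rewrite {}qE in rF.
  have [g1 [C [ug1 CC gg1 gE1 gX]]] := @idem_split K 3 2 E symE EE rE.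
  have [gF CF] := gX F symF EF; pose F' := C *m F *m C^T.
  have rF' : \rank F' = 1%N by rewrite -[RHS]rF -(rank_congr F ug1) gF (@rank_block0 3 2).
  have [|h [D [uh _ hh hF _]]] := @idem_split K 1 1 F' (compress_sym _ symF) _ rF'.
    by rewrite CF FF.
  rewrite (@block_lmx _ 1 1) in hF; rewrite lmx1 in hh; rewrite -{1}[h]mulmx1 in hh.
  rewrite scalar_mx_block lmx1 -{1}[g1]mulmx1 in gg1.
  exists (block_mx 1%:M 0 0 h *m g1); first exact: (@block_unit K 3 2).
  move=> X; rewrite !inE => /or3P[] /eqP ->.
  - by exists (1, 1, 1); rewrite (@block_step 3 2 _ _ _ _ _ _ gg1 hh); by_entries.
  - by exists (1, 0, 0); rewrite (@block_step 3 2 _ _ _ _ _ _ gE1 (congr_lmx0 h)); by_entries.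
  - by exists (0, 1, 0); rewrite (@block_step 3 2 _ _ _ _ _ _ gF hF); by_entries.
have [g1 [C [ug1 CC gg1 gE1 gX]]] := @idem_split K 2 3 E symE EE rE.
have [gF CF] := gX F symF EF; pose F' := C *m F *m C^T.
have rF' : \rank F' = 2%N by rewrite -[RHS]rF -(rank_congr F ug1) gF (@rank_block0 2 3).
have [|h [D [uh _ hh hF _]]] := @idem_split K 2 1 F' (compress_sym _ symF) _ rF'.
  by rewrite CF FF.
rewrite (@block_lmx _ 2 1) in hF; rewrite lmx1 in hh; rewrite -{1}[h]mulmx1 in hh.
rewrite scalar_mx_block lmx1 -{1}[g1]mulmx1 in gg1.
exists (block_mx 1%:M 0 0 h *m g1); first exact: (@block_unit K 2 3).
move=> X; rewrite !inE => /or3P[] /eqP ->.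
- by exists (1, 1, 1); rewrite (@block_step 2 3 _ _ _ _ _ _ gg1 hh); by_entries.
- by exists (1, 0, 0); rewrite (@block_step 2 3 _ _ _ _ _ _ gE1 (congr_lmx0 h)); by_entries.
- by exists (0, 1, 0); rewrite (@block_step 2 3 _ _ _ _ _ _ gF hF); by_entries.
Qed.

Lemma square0_M1 (N : 'M[K]_1) : N *m N = 0 -> N = 0.
Proof.
rewrite [N]mx11_scalar mul_scalar_mx scale_scalar_mx => /matrixP/(_ 0 0)/eqP.
by rewrite !mxE eqxx mulf_eq0 orbb => /eqP ->; rewrite raddf0.
Qed.

(** Cayley-Hamilton, [N^2 = t N - d], multiplied by [N^2] gives [d N^2 = 0]; if [d = 0], then
    [N^3 = t^2 N]. *)
Lemma cube0_M2 (N : 'M[K]_2) : N *m N *m N = 0 -> N *m N = 0.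
Proof.
move=> N3; pose t := N 0 0 + N 1 1; pose d := N 0 0 * N 1 1 - N 0 1 * N 1 0.
have NN : N *m N = t *: N - d%:M.
  have -> : N = \matrix_(i, j) nth 0 (nth [::] [:: [:: N 0 0; N 0 1]; [:: N 1 0; N 1 1]] i) j.
    apply/matrixP => i j; rewrite mxE.
    by case: i => [[|[|//]] ?]; case: j => [[|[|//]] ?] /=; congr (N _ _); apply: val_inj.
  apply/matrixP => i j; rewrite !mxE !big_ord_recl big_ord0 !mxE /t /d.
  by case: i => [[|[|//]] ?]; case: j => [[|[|//]] ?]; rewrite /= ?mulr1n ?mulr0n; ring.
have : N *m N *m (N *m N) = t *: (N *m N *m N) - d *: (N *m N).
  by rewrite [X in _ *m X]NN mulmxBr -scalemxAr mul_mx_scalar.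
rewrite mulmxA N3 mul0mx scaler0 sub0r => /esym/eqP.
rewrite oppr_eq0 scaler_eq0 => /orP[] /eqP // d0.
move: N3; rewrite NN d0 raddf0 subr0 -scalemxAl NN d0 raddf0 subr0 scalerA => /eqP.
rewrite scaler_eq0 mulf_eq0 orbb.
by case/orP => /eqP ->; rewrite ?scale0r ?scaler0.
Qed.
End AssociativeForms.

Section NilpotentForms.
Variable K : numClosedFieldType.

Lemma idem_square k m (E N : 'M[K]_(k + m)) :
    E^T = E -> E *m E = E -> \rank E = k -> N^T = N -> E *m N = 0 ->
    N *m N = 0 -> N != 0 ->
  exists (g : 'M_(k + m)) (N' : 'M_m),
  [/\ g \in unitmx, g *m 1%:M *m g^T = block_mx (lmx k k (id_rows K k)) 0 0 1%:M,
      g *m E *m g^T = block_mx (lmx k k (id_rows K k)) 0 0 (lmx m m [::]),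
      g *m N *m g^T = block_mx (lmx k k [::]) 0 0 N'
    & [/\ N'^T = N', N' *m N' = 0 & N' != 0]].
Proof.
move=> symE EE rE symN EN NN N0.
have [g [C [ug CC gg gE gX]]] := idem_split symE EE rE.
have [gN CN] := gX N symN EN; exists g, (C *m N *m C^T); split=> //.
  by rewrite mulmx1 gg scalar_mx_block (lmx1 K k).
split; [exact: (compress_sym C symN)|by rewrite CN NN mulmx0 mul0mx|].
apply: contraNneq N0 => CNC0; rewrite CNC0 -lmx0 block_mx0 in gN.
by rewrite -mxrank_eq0 -(rank_congr N ug) gN mxrank0.
Qed.

(** Two successive splittings produce hyperbolic planes on neighbouring coordinates, whereas
    [A2_102] pairs [b] with [e] and [c] with [d]. *)
Definition perm5 : 'M[K]_5 :=
  lmx 5 5 [:: [:: 1]; [:: 0; 1]; [:: 0; 0; 0; 1]; [:: 0; 0; 0; 0; 1]; [:: 0; 0; 1]].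

Lemma perm5_unit : perm5 \in unitmx.
Proof.
have : perm5 *m perm5^T = 1%:M.
  by_mx5.
by case/mulmx1_unit.
Qed.

(** [N] lives on the complement of the image of [E]. Its square being 0, that complement has
    dimension at least 2, and [N] has rank 1 there, or possibly 2 in dimension 4. This yields the
    four nets [A2]. *)
Lemma fits_A2 (E N : 'M[K]_5) :
    E^T = E -> E *m E = E -> E != 0 -> N^T = N -> E *m N = 0 -> N *m N = 0 -> N != 0 ->
  exists l, fits l [:: 1%:M; E; N].
Proof.
move=> symE EE E0 symN EN NN N0.
have := rank_leq_row E; move rE: (\rank E) => k.
case: k rE => [/eqP|[|[|[|[|[|//]]]]]] rE _; first by rewrite mxrank_eq0 (negPf E0) in rE.
- have [g1 [N1 [ug1 gg1 gE1 gN1 [symN1 NN1 N10]]]] := @idem_square 1 4 E N symE EE rE symN EN NN N0.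
  have [h [N2 [uh hh hN symN2 NN2]]] := @nil_square_step K 2 N1 symN1 NN1 N10.
  have [N20|N20] := eqVneq N2 0.
    rewrite lmx1 (@block_lmx _ 2 2) -{1}[h]mulmx1 in hh.
    rewrite N20 [X in block_mx _ _ _ X]lmx0 (@block_lmx _ 2 2) in hN.
    exists A2_121, (block_mx 1%:M 0 0 h *m g1); first exact: (@block_unit K 1 4).
    move=> X; rewrite !inE => /or3P[] /eqP ->.
    - by exists (1, 1, 0); rewrite (@block_step K 1 4 _ _ _ _ _ _ gg1 hh); by_entries.
    - by exists (1, 0, 0); rewrite (@block_step K 1 4 _ _ _ _ _ _ gE1 (congr_lmx0 h)); by_entries.
    - by exists (0, 0, 1); rewrite (@block_step K 1 4 _ _ _ _ _ _ gN1 hN); by_entries.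
  have [f [N3 [uf ff fN _ _]]] := @nil_square_step K 0 N2 symN2 NN2 N20.
  rewrite lmx1 (@block_lmx _ 2 0) -{1}[f]mulmx1 in ff.
  rewrite [N3]flatmx0 -[X in block_mx _ _ _ X](flatmx0 (lmx 0 0 [::])) (@block_lmx _ 2 0) in fN.
  rewrite -{1}[h]mulmx1 in hh.
  pose g2 : 'M_(2 + 2) := block_mx 1%:M 0 0 f *m h.
  have uh2 : g2 \in unitmx by apply: (@block_unit K 2 2).
  have gg2 := @block_step K 2 2 _ _ _ _ _ _ hh ff.
  have gN2 := @block_step K 2 2 _ _ _ _ _ _ hN fN.
  exists A2_102, (perm5 *m (block_mx 1%:M 0 0 g2 *m g1)).
    by rewrite unitmx_mul perm5_unit; apply: (@block_unit K 1 4).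
  move=> X; rewrite !inE congrM => /or3P[] /eqP ->.
  - exists (1, 1, 0); rewrite (@block_step K 1 4 _ _ _ _ _ _ gg1 gg2).
    by_mx5.
  - exists (1, 0, 0); rewrite (@block_step K 1 4 _ _ _ _ _ _ gE1 (congr_lmx0 g2)).
    by_mx5.
  - exists (0, 0, 1); rewrite (@block_step K 1 4 _ _ _ _ _ _ gN1 gN2).
    by_mx5.
- have [g1 [N1 [ug1 gg1 gE1 gN1 [symN1 NN1 N10]]]] := @idem_square 2 3 E N symE EE rE symN EN NN N0.
  have [h [N2 [uh hh hN symN2 NN2]]] := @nil_square_step K 1 N1 symN1 NN1 N10.
  rewrite lmx1 (@block_lmx _ 2 1) -{1}[h]mulmx1 in hh.
  rewrite (square0_M1 NN2) [X in block_mx _ _ _ X]lmx0 (@block_lmx _ 2 1) in hN.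
  exists A2_211, (block_mx 1%:M 0 0 h *m g1); first exact: (@block_unit K 2 3).
  move=> X; rewrite !inE => /or3P[] /eqP ->.
  - by exists (1, 1, 0); rewrite (@block_step K 2 3 _ _ _ _ _ _ gg1 hh); by_entries.
  - by exists (1, 0, 0); rewrite (@block_step K 2 3 _ _ _ _ _ _ gE1 (congr_lmx0 h)); by_entries.
  - by exists (0, 0, 1); rewrite (@block_step K 2 3 _ _ _ _ _ _ gN1 hN); by_entries.
- have [g1 [N1 [ug1 gg1 gE1 gN1 [symN1 NN1 N10]]]] := @idem_square 3 2 E N symE EE rE symN EN NN N0.
  have [h [N2 [uh hh hN symN2 NN2]]] := @nil_square_step K 0 N1 symN1 NN1 N10.
  rewrite lmx1 (@block_lmx _ 2 0) -{1}[h]mulmx1 in hh.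
  rewrite [N2]flatmx0 -[X in block_mx _ _ _ X](flatmx0 (lmx 0 0 [::])) (@block_lmx _ 2 0) in hN.
  exists A2_301, (block_mx 1%:M 0 0 h *m g1); first exact: (@block_unit K 3 2).
  move=> X; rewrite !inE => /or3P[] /eqP ->.
  - by exists (1, 1, 0); rewrite (@block_step K 3 2 _ _ _ _ _ _ gg1 hh); by_entries.
  - by exists (1, 0, 0); rewrite (@block_step K 3 2 _ _ _ _ _ _ gE1 (congr_lmx0 h)); by_entries.
  - by exists (0, 0, 1); rewrite (@block_step K 3 2 _ _ _ _ _ _ gN1 hN); by_entries.
- have [g1 [N1 [_ _ _ _ [_ NN1]]]] := @idem_square 4 1 E N symE EE rE symN EN NN N0.
  by rewrite (square0_M1 NN1) eqxx.
- have [g1 [N1 [_ _ _ _ [_ _]]]] := @idem_square 5 0 E N symE EE rE symN EN NN N0.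
  by rewrite [N1]flatmx0 eqxx.
Qed.

(** The rest of [N] on the two-dimensional complement has square 0. It is zero for [A3_201] and of
    rank 1 for [A3_011]. *)
Lemma fits_A3 (N : 'M[K]_5) : N^T = N -> N *m N *m N = 0 -> N *m N != 0 ->
  exists l, fits l [:: 1%:M; N; N *m N].
Proof.
move=> symN N3 NN0.
have [g1 [N1 [ug1 gg1 gN1 gNN1 [symN1 N13]]]] := @nil_cube_step K 2 N symN N3 NN0.
have NN1 := cube0_M2 N13; rewrite NN1 in gNN1; rewrite -{1}[g1]mulmx1 in gg1.
have [N10|N10] := eqVneq N1 0.
  rewrite N10 [X in block_mx _ _ _ X]lmx0 (@block_lmx _ 3 2) in gN1.
  rewrite [X in block_mx _ _ _ X]lmx0 (@block_lmx _ 3 2) in gNN1.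
  rewrite (lmx1 K 2) (@block_lmx _ 3 2) in gg1.
  exists A3_201, g1 => // X; rewrite !inE => /or3P[] /eqP ->.
  - by exists (1, 0, 0); rewrite gg1; by_entries.
  - by exists (0, 1, 0); rewrite gN1; by_entries.
  - by exists (0, 0, 1); rewrite gNN1; by_entries.
have [h [N2 [uh hh hN symN2 NN2]]] := @nil_square_step K 0 N1 symN1 NN1 N10.
rewrite lmx1 (@block_lmx _ 2 0) -{1}[h]mulmx1 in hh; rewrite [X in block_mx _ _ _ X]lmx0 in gNN1.
rewrite [N2]flatmx0 -[X in block_mx _ _ _ X](flatmx0 (lmx 0 0 [::])) (@block_lmx _ 2 0) in hN.
exists A3_011, (block_mx 1%:M 0 0 h *m g1); first exact: (@block_unit K 3 2).
move=> X; rewrite !inE => /or3P[] /eqP ->.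
- by exists (1, 0, 0); rewrite (@block_step K 3 2 _ _ _ _ _ _ gg1 hh); by_entries.
- by exists (0, 1, 0); rewrite (@block_step K 3 2 _ _ _ _ _ _ gN1 hN); by_entries.
- by exists (0, 0, 1); rewrite (@block_step K 3 2 _ _ _ _ _ _ gNN1 (congr_lmx0 h)); by_entries.
Qed.
End NilpotentForms.

(** * An involution anticommuting with an element of square zero *)

Section SkewForm.
Variable K : numClosedFieldType.

(* [a] and [c] are eigenvectors of [S] for the eigenvalues 1 and -1, and so are
   [c N] and [a N]. *)
Lemma skew_pair n (S N : 'M[K]_n) :
    S^T = S -> S *m S = 1%:M -> N^T = N -> N *m S = - (S *m N) -> N *m N = 0 -> N != 0 ->
  exists a c : 'rV_n, [/\ a *m S = a, c *m S = - c, a *m a^T = 0, c *m c^T = 0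
    & a *m N *m c^T = 1%:M].
Proof.
move=> symS SS symN NS NN N0; have [x xNx] := sym_unit_vector symN N0.
have [v [w [vS wS xE]]] : exists v w : 'rV_n,
    [/\ v *m S = v, w *m S = - w & x = v + 2^-1 *: w].
  (* Only one eigencomponent is halved: since [v N v^T] and [w N w^T] vanish, [x = v + w / 2] gives
     [v N w^T = x N x^T = 1]. *)
  exists (2^-1 *: (x + x *m S)), (x - x *m S); split.
  - by rewrite -scalemxAl mulmxDl -mulmxA SS mulmx1 addrC.
  - by rewrite mulmxBl -mulmxA SS mulmx1 opprB.
  - rewrite -scalerDr addrACA subrr addr0 -mulr2n -scaler_nat scalerA.
    by rewrite mulVf ?scale1r // pnatr_eq0.
have ND (p q : 'rV[K]_n) : (p *m N) *m q^T = p *m (q *m N)^T.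
  by rewrite trmx_mul symN mulmxA.
have SD (p q : 'rV[K]_n) : (p *m S) *m q^T = p *m (q *m S)^T.
  by rewrite trmx_mul symS mulmxA.
have self_opp (y : 'M[K]_1) : y = - y -> y = 0.
  move=> /eqP; rewrite -addr_eq0 -mulr2n -scaler_nat scaler_eq0 pnatr_eq0 /=.
  by move=> /eqP.
have vN : v *m N *m S = - (v *m N) by rewrite -mulmxA NS mulmxN mulmxA vS.
have wN : w *m N *m S = w *m N by rewrite -mulmxA NS mulmxN mulmxA wS mulNmx opprK.
have vw : v *m N *m w^T = 1%:M.
  have vNv : v *m N *m v^T = 0.
    by apply: self_opp; rewrite -{2}vS trmx_mul symS mulmxA vN mulNmx.
  have wNw : w *m N *m w^T = 0.
    by apply: self_opp; rewrite -{2}[w]opprK -wS linearN /= mulmxN -SD wN.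
  have wNv : w *m N *m v^T = v *m N *m w^T.
    by rewrite -[LHS]tr11 !trmx_mul trmxK symN mulmxA.
  rewrite -xNx xE [(v + _)^T]linearD /= [(_ *: _)^T]linearZ /=.
  rewrite !mulmxDl !mulmxDr -!scalemxAr -!scalemxAl.
  rewrite vNv wNw wNv !scaler0 addr0 add0r -scalerDl.
  by rewrite -[2^-1]mul1r -splitr scale1r.
pose p := (v *m v^T) 0 0; pose q := (w *m w^T) 0 0.
exists (v - (p / 2) *: (w *m N)), (w - (q / 2) *: (v *m N)).
have NNv (y z : 'rV[K]_n) : y *m N *m (z *m N)^T = 0.
  by rewrite -ND -[y *m N *m N]mulmxA NN mulmx0 mul0mx.
have wNv : w *m N *m v^T = 1%:M by rewrite -[LHS]tr11 !trmx_mul trmxK symN mulmxA.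
split.
- by rewrite mulmxBl -scalemxAl wN vS.
- by rewrite mulmxBl -scalemxAl vN wS opprB scalerN opprK addrC.
- rewrite [(_ - _)^T]linearB /= [(_ *: _)^T]linearZ /= mulmxBl !mulmxBr.
  rewrite -!scalemxAl -!scalemxAr -ND vw wNv NNv.
  rewrite [v *m v^T]mx11_scalar -/p !scaler0 subr0 -addrA -opprD -scalerDl -splitr.
  by rewrite scalemx1 subrr.
- rewrite [(_ - _)^T]linearB /= [(_ *: _)^T]linearZ /= mulmxBl !mulmxBr.
  rewrite -!scalemxAl -!scalemxAr -ND vw wNv NNv.
  rewrite [w *m w^T]mx11_scalar -/q !scaler0 subr0 -addrA -opprD -scalerDl -splitr.
  by rewrite scalemx1 subrr.
rewrite [(_ - _)^T]linearB /= [(_ *: _)^T]linearZ /= mulmxBl mulmxBr !mulmxBl.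
rewrite -!scalemxAr -!scalemxAl NNv vw.
by rewrite -[w *m N *m N]mulmxA NN mulmx0 !mul0mx !scaler0 subr0 subr0 subr0.
Qed.

Let swap5 : 'M[K]_5 :=
  lmx 5 5 [:: [:: 0; 0; 1]; [:: 0; 0; 0; 1]; [:: 1]; [:: 0; 1]; [:: 0; 0; 0; 0; 1]].

Lemma fits_B2 (S N : 'M[K]_5) :
    S^T = S -> S *m S = 1%:M -> N^T = N -> N *m S = - (S *m N) -> N *m N = 0 -> N != 0 ->
  fits B2_112 [:: 1%:M; S; N].
Proof.
move=> symS SS symN NS NN N0.
have [a [c [aS cS aa cc aNc]]] := skew_pair symS SS symN NS NN N0.
pose b := c *m N; pose d := a *m N.
have bS : b *m S = b by rewrite /b -mulmxA NS mulmxN mulmxA cS mulNmx opprK.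
have dS : d *m S = - d by rewrite /d -mulmxA NS mulmxN mulmxA aS.
have bN : b *m N = 0 by rewrite /b -mulmxA NN mulmx0.
have dN : d *m N = 0 by rewrite /d -mulmxA NN mulmx0.
have C (p q : 'rV[K]_5) : p *m q^T = q *m p^T by rewrite -[LHS]tr11 trmx_mul trmxK.
have ort p q : p *m S = p -> q *m S = - q -> p *m q^T = 0.
  move=> pS qS; have : p *m q^T = - (p *m q^T).
    by rewrite -{1}pS -mulmxA -[S *m _]trmxK trmx_mul trmxK symS qS linearN mulmxN.
  move=> /eqP; rewrite -addr_eq0 -mulr2n -scaler_nat scaler_eq0 pnatr_eq0 /=.
  by move=> /eqP.
have D0 (p q : 'rV[K]_5) : p *m (q *m N)^T = p *m N *m q^T.
  by rewrite trmx_mul symN mulmxA.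
have ab : a *m b^T = 1%:M by rewrite D0.
have cd : c *m d^T = 1%:M by rewrite D0 C D0.
have bb : b *m b^T = 0 by rewrite {2}/b D0 bN mul0mx.
have dd : d *m d^T = 0 by rewrite {2}/d D0 dN mul0mx.
have [ac ad bc bd] : [/\ a *m c^T = 0, a *m d^T = 0, b *m c^T = 0 & b *m d^T = 0].
  by split; apply: ort.
pose B := rows 4 [:: a; b; c; d].
pose H : seq (seq K) := [:: [:: 0; 1]; [:: 1]; [:: 0; 0; 0; 1]; [:: 0; 0; 1]].
have BB : B *m B^T = lmx 4 4 H.
  apply/matrixP => i j; rewrite rows_gram [RHS]mxE.
  by case: i => [[|[|[|[|//]]]] ?]; case: j => [[|[|[|[|//]]]] ?]; rewrite /=
    ?aa ?ab ?ac ?ad ?[b *m a^T]C ?ab ?bb ?bc ?bd ?[c *m a^T]C ?[c *m b^T]C ?ac ?bc ?cc ?cd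
    ?[d *m a^T]C ?[d *m b^T]C ?[d *m c^T]C ?ad ?bd ?cd ?dd mxE.
have uB : B *m B^T \in unitmx.
  have : lmx 4 4 H *m lmx 4 4 H = 1%:M.
    apply/matrixP => i j; rewrite !mxE !big_ord_recl big_ord0 !mxE.
    by case: i => [[|[|[|[|//]]]] ?]; case: j => [[|[|[|[|//]]]] ?]; rewrite /=; ring.
  by rewrite BB => /mulmx1_unit[].
have BS : B *m S = lmx 4 4 [:: [:: 1]; [:: 0; 1]; [:: 0; 0; -1]; [:: 0; 0; 0; -1]] *m B.
  rewrite rows_mul mul_rows /= aS bS cS dS; apply/row_matrixP => i; rewrite !rowK.
  rewrite !big_ord_recl big_ord0 !mxE.
  by case: i => [[|[|[|[|//]]]] ?]; rewrite /= ?(scale0r, scale1r, scaleN1r, addr0, add0r).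
have BN : B *m N = lmx 4 4 [:: [:: 0; 0; 0; 1]; [::]; [:: 0; 1]; [::]] *m B.
  rewrite rows_mul mul_rows /= bN dN; apply/row_matrixP => i; rewrite !rowK.
  rewrite !big_ord_recl big_ord0 !mxE.
  by case: i => [[|[|[|[|//]]]] ?]; rewrite /= ?(scale0r, scale1r, scaleN1r, addr0, add0r).
have [D [[DD DB] uD gg gX]] := @frame K 4 1 B uB.
have [gS DSD] := gX _ _ symS BS; have [gN DND] := gX _ _ symN BN.
pose g := col_mx B D; pose s := (D *m S *m D^T) 0 0.
have DN0 : D *m N *m D^T = 0 by apply: square0_M1; rewrite DND NN mulmx0 mul0mx.
have s1 : s = 1 \/ s = -1.
  have : s ^+ 2 = 1.
    have : D *m S *m D^T *m (D *m S *m D^T) = 1%:M by rewrite DSD SS mulmx1.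
    rewrite [D *m S *m D^T]mx11_scalar -/s -scalar_mxM => /matrixP/(_ 0 0).
    by rewrite !mxE.
  by move/eqP; rewrite sqrf_eq1 => /orP[] /eqP; [left|right].
have g1 : g *m 1%:M *m g^T = gen3 B2_112 (1, 1, 0).
  rewrite mulmx1 gg BB (lmx1 K 1) (@block_lmx _ 4 1); by_entries.
have gNE : g *m N *m g^T = gen3 B2_112 (0, 0, 1).
  rewrite gN DN0 [X in block_mx _ _ _ X]lmx0.
  have -> : B *m N *m B^T = lmx 4 4 [:: [:: 0; 0; 1]; [::]; [:: 1]; [::]].
    rewrite rows_mul; apply/matrixP => i j; rewrite rows_gram [RHS]mxE /= bN dN -/b -/d.
    by case: i => [[|[|[|[|//]]]] ?]; case: j => [[|[|[|[|//]]]] ?]; rewrite /=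
    ?mul0mx ?ab ?bb ?bc ?bd ?[d *m a^T]C ?[d *m b^T]C ?[d *m c^T]C
    ?[b *m a^T]C ?ab ?ad ?bd ?cd ?dd mxE.
  rewrite (@block_lmx _ 4 1); by_entries.
have gSE : g *m S *m g^T =
   lmx 5 5 [:: [:: 0; 1]; [:: 1]; [:: 0; 0; 0; -1]; [:: 0; 0; -1]; [:: 0; 0; 0; 0; s]].
  rewrite gS.
  have -> : B *m S *m B^T = lmx 4 4 [:: [:: 0; 1]; [:: 1]; [:: 0; 0; 0; -1]; [:: 0; 0; -1]].
    rewrite rows_mul; apply/matrixP => i j; rewrite rows_gram [RHS]mxE /= aS bS cS dS.
    by case: i => [[|[|[|[|//]]]] ?]; case: j => [[|[|[|[|//]]]] ?]; rewrite /=
    ?mulNmx ?aa ?ab ?ac ?ad ?[b *m a^T]C ?ab ?bb ?bc ?bd ?[c *m a^T]C ?[c *m b^T]C ?ac ?bc ?cc ?cd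
    ?[d *m a^T]C ?[d *m b^T]C ?[d *m c^T]C ?ad ?bd ?cd ?dd ?oppr0 !mxE.
  have -> : D *m S *m D^T = lmx 1 1 [:: [:: s]].
    by apply/matrixP => i j; rewrite !ord1 [RHS]mxE.
  rewrite (@block_lmx _ 4 1); by_entries.
(* In [B2_112] the variable [e] goes with [c] and [d], on which [S] is [-1]. If the fifth vector has
   eigenvalue 1, the two hyperbolic planes are exchanged. *)
case: s1 => s1; last first.
  exists g => // X; rewrite !inE => /or3P[] /eqP ->.
  - by exists (1, 1, 0).
  - by exists (1, -1, 0); rewrite gSE s1; by_entries.
  - by exists (0, 0, 1).
exists (swap5 *m g).
  rewrite unitmx_mul uD andbT; have : swap5 *m swap5^T = 1%:M.
    by_mx5.
  by case/mulmx1_unit.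
move=> X; rewrite !inE congrM => /or3P[] /eqP ->.
- exists (1, 1, 0); rewrite g1.
  by_mx5.
- exists (-1, 1, 0); rewrite gSE s1.
  by_mx5.
- exists (0, 0, 1); rewrite gNE.
  by_mx5.
Qed.
End SkewForm.

(** * Pencils of square zero *)

Section NullForms.
Variable K : numClosedFieldType.

Lemma skew_rank n (M : 'M[K]_n) : M^T = - M -> M != 0 -> (1 < \rank M)%N.
Proof.
move=> skM M0; have skE i j : M j i = - M i j.
  by have /matrixP/(_ i j) := skM; rewrite !mxE.
have dM i : M i i = 0.
  have /eqP := skE i i; rewrite -addr_eq0 -mulr2n -mulr_natr mulf_eq0 pnatr_eq0 orbF.
  by move/eqP.
rewrite ltnNge; apply: contraNN M0 => rM; apply/eqP/matrixP => i j; rewrite [RHS]mxE.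
pose f (k : 'I_2) := if k == 0 then i else j; pose g (k : 'I_2) := if k == 0 then j else i.
have fg0 (k l : 'I_2) : (k < l)%N -> M (f k) (g l) = 0.
  by case: k => [[|[|//]] ?]; case: l => [[|[|//]] ?] //= _; rewrite /f /g /= dM.
have := rank_trig rM fg0; rewrite !big_ord_recl big_ord0 mulr1 /f /g /= [M j i]skE.
by move=> /eqP; rewrite mulrN oppr_eq0 mulf_eq0 orbb => /eqP.
Qed.

Lemma rank_square0 m (N : 'M[K]_(m.*2.+1)) : N *m N = 0 -> (\rank N <= m)%N.
Proof.
move=> NN; have /mxrankS : (N <= kermx N)%MS by apply/sub_kermxP.
rewrite mxrank_ker leq_subRL ?rank_leq_row // addnn => /half_leq.
by rewrite doubleK -[X in (_ <= X)%N -> _]/(uphalf _) uphalf_double.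
Qed.

(** [N S] is skew, so of rank at least 2 unless it is zero, while [N] has rank at most 2 in size 5.
    As [N S = - S N], the row spaces of [N S] and [N] then agree, so the rows of [N] lie in that of
    [S], and [S^2 = 0] gives [N S = 0]. *)
Lemma null_pencil (S N : 'M[K]_5) :
    S^T = S -> N^T = N -> S *m S = 0 -> N *m N = 0 -> N *m S = - (S *m N) ->
  N *m S = 0.
Proof.
move=> symS symN SS NN NS; apply/eqP; apply: contraTT isT => M0.
have skM : (N *m S)^T = - (N *m S) by rewrite trmx_mul symN symS NS opprK.
have rM := skew_rank skM M0.
have MN : (N *m S <= N)%MS by rewrite NS -mulNmx submxMl.
have NM : (N <= N *m S)%MS.
  rewrite -(geq_leqif (mxrank_leqif_sup MN)).
  exact: leq_trans (@rank_square0 2 N NN) rM.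
have /submxP[D DE] : (N <= S)%MS by apply: submx_trans NM (submxMl _ _).
by case/negP: M0; rewrite {1}DE -mulmxA SS mulmx0.
Qed.

Definition diag_form (X : 'M[K]_2) := exists y z, X = lmx 2 2 [:: [:: y; 0]; [:: 0; z]].
Definition corner_form (X : 'M[K]_2) := exists y z, X = lmx 2 2 [:: [:: z; y]; [:: y; 0]].

Lemma all_ord2 (P : 'I_2 -> Prop) : P 0 -> P 1 -> forall i, P i.
Proof.
move=> P0 P1 [[|[|m]] lt_m] //.
- by rewrite (_ : Ordinal _ = 0) //; apply: val_inj.
- by rewrite (_ : Ordinal _ = 1) //; apply: val_inj.
Qed.

Lemma sym2 (X : 'M[K]_2) : X^T = X ->
  X = lmx 2 2 [:: [:: X 0 0; X 0 1]; [:: X 0 1; X 1 1]].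
Proof.
move=> symX; apply/matrixP => i j; rewrite [RHS]mxE; move: i j.
by apply: all_ord2; apply: all_ord2; rewrite //= -{1}symX mxE.
Qed.

Lemma square_form (f : 'M[K]_2) : f^T = f -> f != 0 -> \det f = 0 ->
  exists2 g, g \in unitmx & g *m f *m g^T = lmx 2 2 [:: [:: 1; 0]; [:: 0; 0]].
Proof.
move=> symf f0 detf; have [v vfv] := sym_unit_vector symf f0.
have /det0P[w w0 wf] : \det f == 0 by rewrite detf.
have fw : f *m w^T = 0 by rewrite -symf -trmx_mul wf trmx0.
exists (rows 2 [:: v; w]).
  rewrite -row_free_unit; apply: inj_row_free => x.
  rewrite mulmx_sum_row !big_ord_recl big_ord0 !rowK /= addr0 => xvw.
  have x0 : x 0 0 = 0.
    have : (x 0 0 *: v + x 0 (lift ord0 ord0) *: w) *m (f *m v^T) = 0 by rewrite xvw mul0mx.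
    rewrite mulmxDl -!scalemxAl !mulmxA vfv wf mul0mx scaler0 addr0 => /matrixP/(_ 0 0).
    by rewrite !mxE mulr1.
  move: xvw; rewrite x0 scale0r add0r => /eqP; rewrite scaler_eq0 (negPf w0) orbF => /eqP x1.
  apply/matrixP => i j; rewrite ord1 [RHS]mxE.
  by case: j => [[|[|//]] ?]; [rewrite -[RHS]x0|rewrite -[RHS]x1]; congr (x _ _); apply: val_inj.
rewrite rows_mul; apply/matrixP => i j; rewrite rows_gram [RHS]mxE /= wf.
by case: i => [[|[|//]] ?]; case: j => [[|[|//]] ?];
  rewrite /= ?mul0mx -?mulmxA ?fw ?mulmx0 ?mulmxA ?vfv mxE.
Qed.

(** Take [f] to be the square [a^2]. If [m] has a term in [b^2], completing the square diagonalises
    the pencil; otherwise all members are divisible by [a]. *)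
Lemma singular_form (f m : 'M[K]_2) : f^T = f -> m^T = m -> f != 0 -> \det f = 0 ->
  exists2 g, g \in unitmx &
    (forall a b, diag_form (g *m (a *: f + b *: m) *m g^T)) \/
    (forall a b, corner_form (g *m (a *: f + b *: m) *m g^T)).
Proof.
move=> symf symm f0 detf; have [g ug gf] := square_form symf f0 detf.
have gm : g *m m *m g^T = _ := sym2 (compress_sym g symm).
move: {gm}(_ 0 0) (_ 0 1) (_ 1 1) gm => al be ga gm.
have gD (h : 'M_2) a b : h *m g *m (a *: f + b *: m) *m (h *m g)^T
    = a *: (h *m (g *m f *m g^T) *m h^T) + b *: (h *m (g *m m *m g^T) *m h^T).
  by rewrite trmx_mul !mulmxDr !mulmxDl -!scalemxAr -!scalemxAl !mulmxA.
have [ga0|ga0] := eqVneq ga 0.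
  exists g => //; right => a b; exists (b * be), (a + b * al).
  move: (gD 1%:M a b); rewrite !mul1mx trmx1 !mulmx1 => ->; rewrite gf gm ga0.
  apply/matrixP => i j; rewrite !mxE.
  by case: i => [[|[|//]] ?]; case: j => [[|[|//]] ?] /=; ring.
pose h : 'M[K]_2 := lmx 2 2 [:: [:: 1; - (be / ga)]; [:: 0; 1]].
exists (h *m g).
  rewrite unitmx_mul ug andbT.
  have : h *m lmx 2 2 [:: [:: 1; be / ga]; [:: 0; 1]] = 1%:M.
    apply/matrixP => i j; rewrite !mxE !big_ord_recl big_ord0 !mxE.
    by case: i => [[|[|//]] ?]; case: j => [[|[|//]] ?] /=; ring.
  by case/mulmx1_unit.
left=> a b; exists (a + b * (al - be ^+ 2 / ga)), (b * ga); rewrite gD gf gm.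
apply/matrixP => i j; do !rewrite !mxE !big_ord_recl !big_ord0; rewrite !mxE.
by case: i => [[|[|//]] ?]; case: j => [[|[|//]] ?] /=; field.
Qed.

(** The singular member is [n], or else [s - t n] for an eigenvalue [t] of [s n^-1]. *)
Lemma singular_member (n s : 'M[K]_2) : n != 0 -> (forall t, s != t *: n) ->
  n^T = n -> s^T = s ->
  exists f m, [/\ f^T = f, m^T = m, f != 0, \det f = 0
    & forall a b, exists c d, a *: n + b *: s = c *: f + d *: m].
Proof.
move=> n0 ns symn syms; have [detn|detn] := eqVneq (\det n) 0.
  by exists n, s; split=> // a b; exists a, b.
have /closed_rootP[t] : size (char_poly (s *m invmx n)) != 1%N.
  by rewrite size_char_poly.
rewrite -eigenvalue_root_char => /eigenvalueP[v vsn v0].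
exists (s - t *: n), n; split=> //.
- by rewrite linearB linearZ /= symn syms.
- by rewrite subr_eq0.
- apply/eqP/det0P; exists v => //.
  rewrite mulmxBr -scalemxAr scalemxAl -vsn mulmxA mulmxKV ?subrr //.
  by rewrite unitmxE unitfE.
move=> a b; exists b, (a + b * t); rewrite scalerBr scalerA scalerDl.
by rewrite [X in _ = _ + X]addrC addrA subrK addrC.
Qed.

Lemma binary_pencil (n s : 'M[K]_2) : n != 0 -> (forall t, s != t *: n) ->
  n^T = n -> s^T = s ->
  exists2 g, g \in unitmx &
    (forall a b, diag_form (g *m (a *: n + b *: s) *m g^T)) \/
    (forall a b, corner_form (g *m (a *: n + b *: s) *m g^T)).
Proof.
move=> n0 ns symn syms; have [f [m [symf symm f0 detf fm]]] := singular_member n0 ns symn syms.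
have [g ug gfm] := singular_form symf symm f0 detf; exists g => //.
by case: gfm => H; [left|right] => a b; have [c [d ->]] := fm a b.
Qed.

Lemma null_rank2 (S N : 'M[K]_5) : S^T = S -> N^T = N -> S *m S = 0 -> N *m N = 0 ->
  N *m S = 0 -> N != 0 -> (forall t, S != t *: N) ->
  exists (B : 'M_(2, 5)) n s, [/\ row_free B, B *m B^T = 0, N = B^T *m n *m B,
    S = B^T *m s *m B & n^T = n /\ s^T = s].
Proof.
move=> symS symN SS NN NS N0 SN; pose W := col_mx N S.
have WW : W *m W^T = 0.
  have SN0 : S *m N = 0 by rewrite -symS -symN -trmx_mul NS trmx0.
  by rewrite tr_col_mx mul_col_row symN symS NN SS NS SN0 block_mx0.
have freeB := row_base_free W; have B0W := eq_row_base W.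
move: (\rank W) (row_base W) freeB B0W => r B freeB BW.
have BB : B *m B^T = 0.
  have /submxP[D DE] : (B <= W)%MS by rewrite BW.
  by rewrite DE trmx_mul mulmxA -[D *m W *m _]mulmxA WW mulmx0 mul0mx.
have [R BR] : exists R, B *m R = 1%:M by apply/row_freeP.
have factor X : X^T = X -> (X <= W)%MS -> X = B^T *m (R^T *m X *m R) *m B.
  move=> symX; rewrite -BW => /submxP[D DE].
  have XR : X = X *m R *m B by rewrite {2}DE -[D *m B *m R]mulmxA BR mulmx1.
  have XT : X = B^T *m R^T *m X by rewrite -{1}symX {1}XR !trmx_mul symX !mulmxA.
  by rewrite {1}XT {1}XR !mulmxA.
have symF X : X^T = X -> (R^T *m X *m R)^T = R^T *m X *m R.
  by move=> symX; rewrite !trmx_mul trmxK symX mulmxA.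
have [NE SE] : N = B^T *m (R^T *m N *m R) *m B /\ S = B^T *m (R^T *m S *m R) *m B.
  split; apply: factor => //; apply/submxP.
    by exists (row_mx 1%:M 0); rewrite mul_row_col mul1mx mul0mx addr0.
  by exists (row_mx 0 1%:M); rewrite mul_row_col mul1mx mul0mx add0r.
(* The rows of [B] span a totally isotropic space, so [r <= 5 - r]. The values 0 and 1 contradict
   [N != 0] and the independence of [S] from [N]. *)
have /mxrankS : (B <= kermx B^T)%MS by apply/sub_kermxP.
rewrite mxrank_ker mxrank_tr (eqP freeB) leq_subRL; last by rewrite -(eqP freeB) rank_leq_col.
case: r B freeB R {BW} BB BR {factor} symF NE SE => [|[|[|r]]] B freeB R BB BR symF NE SE;
  last by rewrite !addnS.
- by move=> _; case/negP: N0; rewrite NE [B^T]thinmx0 !mul0mx.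
- move=> _; move: NE SE; rewrite [R^T *m N *m R]mx11_scalar [R^T *m S *m R]mx11_scalar.
  move: (_ 0 0) (_ 0 0) => a b; rewrite !mul_mx_scalar -!scalemxAl => NE SE.
  have a0 : b != 0 by apply: contraNneq N0 => b0; rewrite NE b0 scale0r.
  by case/negP: (SN (a / b)); rewrite {1}SE NE scalerA divfK.
- by move=> _; exists B, (R^T *m N *m R), (R^T *m S *m R); do !split=> //; apply: symF.
Qed.

(** Any dual family [V] is made isotropic by subtracting half of its Gram matrix times [B]; this
    keeps it dual, as [B] is isotropic. *)
Lemma dual_frame k n (B : 'M[K]_(k, n)) : row_free B -> B *m B^T = 0 ->
  exists V : 'M_(k, n), V *m B^T = 1%:M /\ V *m V^T = 0.
Proof.
move=> /row_freeP[R BR] BB.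
have [V [VB BV]] : exists V : 'M_(k, n), V *m B^T = 1%:M /\ B *m V^T = 1%:M.
  by exists R^T; rewrite trmxK -trmx_mul BR trmx1.
pose A := V *m V^T; have symA : A^T = A by rewrite trmx_mul trmxK.
exists (V - 2^-1 *: (A *m B)); split.
  by rewrite mulmxBl -scalemxAl -mulmxA BB mulmx0 scaler0 subr0.
have -> : (V - 2^-1 *: (A *m B))^T = V^T - 2^-1 *: (B^T *m A).
  by rewrite linearB linearZ /= trmx_mul symA.
rewrite mulmxBl !mulmxBr -!scalemxAl -!scalemxAr -[A *m B *m V^T]mulmxA BV mulmx1.
rewrite [V *m (B^T *m A)]mulmxA VB mul1mx mulmxA -[A *m B *m B^T]mulmxA BB mulmx0 mul0mx.
rewrite !scaler0 subr0 -addrA -opprD -scalerDl -[2^-1]mul1r -splitr.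
by rewrite scale1r subrr.
Qed.

(** Puts the frame [V], [B], [D] into the antidiagonal order of the nets [C5], with the anisotropic
    vector in the middle. *)
Let perm_c : 'M[K]_5 :=
  lmx 5 5 [:: [:: 1]; [:: 0; 1]; [:: 0; 0; 0; 0; 1]; [:: 0; 0; 0; 1]; [:: 0; 0; 1]].

(* [S] and [N] are forms on a totally isotropic plane, spanned by the rows of [B];
   the rows of [V] are dual to it, and one more vector completes the frame. *)
Lemma fits_C (S N : 'M[K]_5) :
    S^T = S -> N^T = N -> S *m S = 0 -> N *m N = 0 -> N *m S = - (S *m N) ->
    N != 0 -> (forall t, S != t *: N) ->
  exists l, fits l [:: 1%:M; S; N].
Proof.
move=> symS symN SS NN NS N0 SN; have NS0 := null_pencil symS symN SS NN NS.
have [B0 [n0 [s0 [freeB0 BB0 NE0 SE0 [symn0 syms0]]]]] := null_rank2 symS symN SS NN NS0 N0 SN.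
have [] := @binary_pencil n0 s0 _ _ symn0 syms0.
- by apply: contraNneq N0 => n00; rewrite NE0 n00 mulmx0 mul0mx.
- by move=> t; apply: contra (SN t) => /eqP st; rewrite SE0 NE0 st -scalemxAr -scalemxAl.
move=> h uh hP; pose B := (invmx h)^T *m B0.
pose form X := h *m X *m h^T.
have formE (x : 'M_2) : B^T *m form x *m B = B0^T *m x *m B0.
  rewrite /B trmx_mul trmxK /form !mulmxA mulmxKV // -[_ *m h^T *m _]mulmxA.
  by rewrite -trmx_mul mulVmx // trmx1 mulmx1.
have freeB : row_free B by rewrite /row_free mxrankMfree // mxrank_tr mxrank_unit ?unitmx_inv.
have BB : B *m B^T = 0 by rewrite trmx_mul mulmxA -[_ *m B0 *m _]mulmxA BB0 mulmx0 mul0mx.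
have [V [VB VV]] := dual_frame freeB BB.
have BV : B *m V^T = 1%:M by rewrite -[B]trmxK -trmx_mul VB trmx1.
pose W : 'M_(2 + 2, 5) := col_mx V B.
have WW : W *m W^T = block_mx 0 1%:M 1%:M 0.
  by rewrite tr_col_mx mul_col_row VV VB BV BB.
have uW : W *m W^T \in unitmx.
  have : W *m W^T *m (W *m W^T) = 1%:M.
    by rewrite WW mulmx_block !mul0mx !mulmx0 !mulmx1 !addr0 add0r -scalar_mx_block.
  by case/mulmx1_unit.
have [D [[DD DW] uD gg gX]] := @frame K 4 1 W uW.
have gE X x : X^T = X -> X = B0^T *m x *m B0 ->
    col_mx W D *m X *m (col_mx W D)^T
    = block_mx (block_mx (form x) 0 0 0) 0 0 (lmx 1 1 [::] : 'M_1).
  move=> symX; rewrite -formE => XE.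
  have WX : W *m X = block_mx 0 (form x) 0 0 *m W.
    rewrite mul_col_mx mul_block_col !mul0mx !add0r XE !mulmxA VB BB mul1mx.
    by rewrite !mul0mx.
  have WXW : W *m X *m W^T = block_mx (form x) 0 0 0.
    by rewrite WX -mulmxA WW mulmx_block !mul0mx !mulmx0 mulmx1 !addr0 add0r.
  have [-> _] := gX _ _ symX WX; rewrite WXW; congr block_mx.
  have DB : D *m B^T = 0.
    have : row_mx (D *m V^T) (D *m B^T) = row_mx 0 0.
      by rewrite -mul_mx_row -tr_col_mx row_mx0.
    by case/eq_row_mx.
  by rewrite XE !mulmxA DB !mul0mx -lmx0.
have WWE : W *m W^T = lmx 4 4 [:: [:: 0; 0; 1]; [:: 0; 0; 0; 1]; [:: 1]; [:: 0; 1]].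
  rewrite WW; apply/matrixP => i j; rewrite !mxE.
  by case: splitP => i' ->; rewrite mxE; case: splitP => j' ->; rewrite !mxE;
    move: i' j'; apply: all_ord2; apply: all_ord2.
have uP : perm_c *m col_mx W D \in unitmx.
  rewrite unitmx_mul uD andbT; have : perm_c *m perm_c^T = 1%:M.
    by_mx5.
  by case/mulmx1_unit.
have one l : gen3 l (1, 0, 0) = gen3 C5_1 (1, 0, 0) :> 'M[K]_5 ->
    exists x, perm_c *m col_mx W D *m 1%:M *m (perm_c *m col_mx W D)^T = gen3 l x.
  move=> l1; exists (1, 0, 0).
  rewrite congrM mulmx1 gg WWE (lmx1 K 1) (@block_lmx _ 4 1) l1.
  by_mx5.
have [nP sP] : n0 = 1 *: n0 + 0 *: s0 /\ s0 = 0 *: n0 + 1 *: s0.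
  by rewrite !scale0r !scale1r addr0 add0r.
have gN X x t : X^T = X -> X = B0^T *m x *m B0 -> form x = lmx 2 2 t ->
  perm_c *m col_mx W D *m X *m (perm_c *m col_mx W D)^T =
    perm_c *m lmx 5 5 (dsum 4 1 (dsum 2 2 t [::]) [::]) *m perm_c^T.
  move=> symX XE xE; rewrite congrM (gE _ _ symX XE) xE.
  by rewrite [X in block_mx (block_mx _ _ _ X)](lmx0 K) (@block_lmx _ 2 2) (@block_lmx _ 4 1).
case: hP => hP.
  have gC X x : X^T = X -> X = B0^T *m x *m B0 -> diag_form (form x) ->
      exists y, perm_c *m col_mx W D *m X *m (perm_c *m col_mx W D)^T = gen3 C5_1 y.
    move=> symX XE [y [z xE]]; exists (0, y, z); rewrite (gN _ _ _ symX XE xE).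
    by_mx5.
  exists C5_1, (perm_c *m col_mx W D) => // X; rewrite !inE => /or3P[] /eqP ->.
  - exact: one.
  - by apply: gC symS SE0 _; rewrite sP; apply: hP.
  - by apply: gC symN NE0 _; rewrite nP; apply: hP.
have gC X x : X^T = X -> X = B0^T *m x *m B0 -> corner_form (form x) ->
    exists y, perm_c *m col_mx W D *m X *m (perm_c *m col_mx W D)^T = gen3 C5_2 y.
  move=> symX XE [y [z xE]]; exists (0, y, z); rewrite (gN _ _ _ symX XE xE).
  by_mx5.
exists C5_2, (perm_c *m col_mx W D) => // X; rewrite !inE => /or3P[] /eqP ->.
- apply: one; by_entries.
- by apply: gC symS SE0 _; rewrite sP; apply: hP.
- by apply: gC symN NE0 _; rewrite nP; apply: hP.
Qed.
End NullForms.

(** * Classification *)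

Section Spans.
Variables (K : fieldType) (V : vectType K).

Lemma mem_span2 (x y v : V) :
  v \in <<[:: x; y]>>%VS -> exists a b, v = a *: x + b *: y.
Proof.
rewrite span_cons span_seq1 => /memv_addP[_ /vlineP[a ->] [_ /vlineP[b ->] ->]].
by exists a, b.
Qed.

Lemma mem_span3 (x y z v : V) :
  v \in <<[:: x; y; z]>>%VS -> exists a b c, v = a *: x + b *: y + c *: z.
Proof.
rewrite span_cons => /memv_addP[_ /vlineP[a ->] [_ /mem_span2[b [c ->]] ->]].
by exists a, b, c; rewrite addrA.
Qed.

Lemma span3_sub (x y z : V) (W : {vspace V}) : x \in W -> y \in W -> z \in W ->
  (<<[:: x; y; z]>> <= W)%VS.
Proof.
by move=> Wx Wy Wz; apply/span_subvP => v; rewrite !inE => /or3P[] /eqP ->.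
Qed.

Lemma dim3_span (x y z : V) (W : {vspace V}) : \dim W = 3%N ->
  x \in W -> y \in W -> z \in W -> free [:: x; y; z] -> W = <<[:: x; y; z]>>%VS.
Proof.
move=> dimW Wx Wy Wz free_xyz; apply/eqP; rewrite eq_sym eqEdim span3_sub //=.
by rewrite dimW (eqnP free_xyz).
Qed.
End Spans.

Section Classification.
Variable K : numClosedFieldType.

Lemma cubic_roots (a b c : K) : exists r s t,
  [/\ a = r + s + t, b = - (r * s + r * t + s * t) & c = r * s * t].
Proof.
have [r rE] := @solve_monicpoly K 3 (fun i => [:: c; b; a]`_i) isT.
(* The coefficients are those of the quotient of the cubic by [X - r]. *)
have [s sE] := @solve_monicpoly K 2 (fun i => [:: b + a * r - r ^+ 2; a - r]`_i) isT.
exists r, s, (a - r - s); move: rE sE; rewrite !big_ord_recl !big_ord0 /= => rE sE.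
split; first by ring.
  have -> : b = s ^+ 2 - (a - r) * s - a * r + r ^+ 2 by rewrite sE; ring.
  by ring.
have -> : c = r ^+ 3 - a * r ^+ 2 - b * r by rewrite rE; ring.
have -> : b = s ^+ 2 - (a - r) * s - a * r + r ^+ 2 by rewrite sE; ring.
by ring.
Qed.

Lemma rank_add_idem n (E F : 'M[K]_n) : E *m E = E -> F *m F = F ->
  E *m F = 0 -> F *m E = 0 -> \rank (E + F)%R = (\rank E + \rank F)%N.
Proof.
move=> EE FF EF FE; rewrite -mxrank_disjoint_sum; last first.
  apply/eqP; rewrite -submx0; apply/rV_subP => v; rewrite sub_capmx.
  case/andP => /submxP[x xE] /submxP[y yF]; rewrite submx0.
  by rewrite yF -FF mulmxA -yF xE -mulmxA EF mulmx0.
apply/eqmx_rank/andP; split; first exact: addmx_sub_adds.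
rewrite addsmx_sub; apply/andP; split; apply/submxP.
  by exists E; rewrite mulmxDr EE EF addr0.
by exists F; rewrite mulmxDr FF FE add0r.
Qed.

(** The ranks are positive with sum 5, hence 3, 1, 1 or 2, 2, 1 in some order; each case puts the
    two idempotents of prescribed ranks first. *)
Lemma fits_ortho3 (E F G : 'M[K]_5) : E^T = E -> F^T = F -> G^T = G ->
    E *m E = E -> F *m F = F -> G *m G = G ->
    E *m F = 0 -> E *m G = 0 -> F *m G = 0 -> E != 0 -> F != 0 -> G != 0 ->
    E + F + G = 1%:M ->
  exists l s, fits l s /\ (<<[:: E; F; G]>> <= <<s>>)%VS.
Proof.
move=> symE symF symG EE FF GG EF EG FG E0 F0 G0 sum1.
have FE : F *m E = 0 by rewrite -symE -symF -trmx_mul EF trmx0.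
have GE : G *m E = 0 by rewrite -symE -symG -trmx_mul EG trmx0.
have GF : G *m F = 0 by rewrite -symF -symG -trmx_mul FG trmx0.
have : \rank (E + F + G)%R = 5%N by rewrite sum1 mxrank1.
rewrite !rank_add_idem ?mulmxDl ?mulmxDr ?EE ?EF ?FF ?FE ?EG ?FG ?GE ?GF ?addr0 ?add0r //.
rewrite -!mxrank_eq0 in E0 F0 G0; move: E0 F0 G0.
move rE: (\rank E) => p; move rF: (\rank F) => q; move rG: (\rank G) => u.
have sp (X Y Z : 'M[K]_5) : X + Y + Z = 1%:M -> forall W, W \in [:: X; Y; Z] ->
    W \in <<[:: 1%:M; X; Y]>>%VS.
  move=> XYZ W; have [m1 mX mY] : [/\ 1%:M \in <<[:: 1%:M; X; Y]>>%VS,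
      X \in <<[:: 1%:M; X; Y]>>%VS & Y \in <<[:: 1%:M; X; Y]>>%VS].
    by split; apply: memv_span; rewrite !inE eqxx ?orbT.
  rewrite !inE => /or3P[] /eqP -> //.
  by have -> : Z = 1%:M - X - Y; [rewrite -XYZ -addrA -opprD addrC addKr|rewrite !rpredB].
have sub3 (X Y Z : 'M[K]_5) : X + Y + Z = 1%:M ->
    (<<[:: X; Y; Z]>> <= <<[:: 1%:M; X; Y]>>)%VS.
  by move=> XYZ; apply: span3_sub; apply: (sp X Y Z XYZ); rewrite !inE eqxx ?orbT.
have per (X Y Z X' Y' Z' : 'M[K]_5) : perm_eq [:: X; Y; Z] [:: X'; Y'; Z'] ->
    <<[:: X; Y; Z]>>%VS = <<[:: X'; Y'; Z']>>%VS.
  by move=> /perm_mem XX'; apply: eq_span.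
have fin X Y Z p' q' l : perm_eq [:: E; F; G] [:: X; Y; Z] ->
    X^T = X -> Y^T = Y -> X *m X = X -> Y *m Y = Y -> X *m Y = 0 ->
    X + Y + Z = 1%:M -> \rank X = p' -> \rank Y = q' ->
    (p', q', l) = (3, 1, A1_201)%N \/ (p', q', l) = (2, 2, A1_011)%N ->
  exists l s, fits l s /\ (<<[:: E; F; G]>> <= <<s>>)%VS.
  move=> /per -> symX symY XX YY XY XYZ rX rY pq.
  by exists l, [:: 1%:M; X; Y]; split; [apply: fits_A1 pq|apply: sub3].
have cases : (0 < p -> 0 < q -> 0 < u -> p + q + u = 5 ->
    [\/ (p, q) = (3, 1), (p, q) = (2, 2) | (q, u) = (2, 2)] \/
    [\/ (q, p) = (3, 1), (u, p) = (3, 1) | (p, u) = (2, 2)])%N.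
  case: p q u {rE rF rG} => [|[|[|[|p]]]] [|[|[|[|q]]]] [|[|[|[|u]]]] // _ _ _;
    rewrite ?addnS ?addSn ?addn0 // => _;
    by [left; constructor 1|left; constructor 2|left; constructor 3
       |right; constructor 1|right; constructor 2|right; constructor 3].
rewrite -!lt0n => p0 q0 u0 pqu.
case: (cases p0 q0 u0 pqu) => [] [] [e1 e2].
- by apply: (fin E F G _ _ A1_201) rE rF _ => //; left; rewrite e1 e2.
- by apply: (fin E F G _ _ A1_011) rE rF _ => //; right; rewrite e1 e2.
- apply: (fin F G E _ _ A1_011) rF rG _ => //; last by right; rewrite e1 e2.
  + by apply/permP => x /=; ring.
  + by rewrite -sum1 -[in RHS]addrA addrC.
- apply: (fin F E G _ _ A1_201) rF rE _ => //; last by left; rewrite e1 e2.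
  + by apply/permP => x /=; ring.
  + by rewrite -sum1 [F + E]addrC.
- apply: (fin G E F _ _ A1_201) rG rE _ => //; last by left; rewrite e1 e2.
  + by apply/permP => x /=; ring.
  + by rewrite -sum1 -addrA addrC.
- apply: (fin E G F _ _ A1_011) rE rG _ => //; last by right; rewrite e1 e2.
  + by apply/permP => x /=; ring.
  + by rewrite -sum1 addrAC.
Qed.
End Classification.

(** * A symmetric matrix with independent powers 1, T, T^2 *)

Section CubicCase.
Variables (K : numClosedFieldType) (T : 'M[K]_5).
Hypothesis symT : T^T = T.
Hypothesis notquad : forall x y, T *m T != x *: T + y%:M.

Let D x := T - x%:M.
Let cubic r s t := D r *m D s *m D t = 0.
Let goal := exists l s, fits l s /\ (<<[:: 1%:M; T; T *m T]>> <= <<s>>)%VS.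

Ltac entries :=
  let i := fresh "i" in let j := fresh "j" in apply/matrixP => i j;
  rewrite /D !mxE; case: (i == j); rewrite ?mulr1n ?mulr0n.

Lemma quad_expand x y : D x *m D y = T *m T - (x + y) *: T + (x * y)%:M.
Proof.
rewrite /D mulmxBl !mulmxBr mul_scalar_mx mul_mx_scalar -scalar_mxM.
move: (T *m T) => T2.
by entries; ring.
Qed.

Lemma factor_comm x y : D x *m D y = D y *m D x.
Proof. by rewrite !quad_expand [x + y]addrC [x * y]mulrC. Qed.

Lemma factor_sym x : (D x)^T = D x.
Proof. by rewrite linearB /= symT tr_scalar_mx. Qed.

Lemma quad_sym x y : (D x *m D y)^T = D x *m D y.
Proof. by rewrite trmx_mul !factor_sym factor_comm. Qed.

Lemma quad_neq0 x y : D x *m D y != 0.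
Proof.
apply: contra (notquad (x + y) (- (x * y))); rewrite quad_expand => /eqP TT0.
apply/eqP; rewrite -[LHS]subr0 -TT0; move: (T *m T) => T2.
by entries; ring.
Qed.

Lemma factor_eigen (X : 'M[K]_5) r s : X *m D r = 0 -> X *m D s = (r - s) *: X.
Proof.
move=> XD; have -> : D s = D r + (r - s)%:M by entries; ring.
by rewrite mulmxDr XD add0r mul_mx_scalar.
Qed.

Lemma cubic_rot r s t : cubic r s t -> cubic s t r.
Proof.
by rewrite /cubic -[D s *m D t *m _]mulmxA [D t *m _]factor_comm mulmxA [D s *m _]factor_comm.
Qed.

Lemma cubic_swap r s t : cubic r s t -> cubic r t s.
Proof. by rewrite /cubic -!mulmxA [D t *m _]factor_comm. Qed.

(** [E] is the Lagrange interpolation polynomial of the root [r], evaluated at [T]. On it [T] acts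
    as [r]. *)
Lemma lagrange_idem r s t : r != s -> r != t -> cubic s t r ->
  let E := ((r - s) * (r - t))^-1 *: (D s *m D t) in E *m E = E.
Proof.
move=> rs rt str E; have ED x : E *m D x = (r - x) *: E.
  by apply: factor_eigen; rewrite -scalemxAl str scaler0.
rewrite {2}/E -scalemxAr mulmxA ED -scalemxAl ED 2!scalerA -mulrA mulVf ?scale1r //.
by rewrite mulf_neq0 // subr_eq0.
Qed.

Lemma cubic_distinct r s t : r != s -> r != t -> s != t -> cubic r s t -> goal.
Proof.
move=> rs rt st rst; have str := cubic_rot rst; have trs := cubic_rot str.
have rts := cubic_swap rst; have d0 x y : x != y -> x - y != 0 by rewrite subr_eq0.
have dsr : s != r by rewrite eq_sym. have dtr : t != r by rewrite eq_sym.
have dts : t != s by rewrite eq_sym.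
pose E := ((r - s) * (r - t))^-1 *: (D s *m D t).
pose F := ((s - t) * (s - r))^-1 *: (D t *m D r).
pose G := ((t - r) * (t - s))^-1 *: (D r *m D s).
have EE : E *m E = E by apply: lagrange_idem.
have FF : F *m F = F by apply: lagrange_idem => //; apply: cubic_rot.
have GG : G *m G = G by apply: lagrange_idem.
have [] := @fits_ortho3 K E F G _ _ _ EE FF GG.
- by rewrite linearZ /= quad_sym.
- by rewrite linearZ /= quad_sym.
- by rewrite linearZ /= quad_sym.
- by rewrite -scalemxAl -scalemxAr [D t *m _]factor_comm mulmxA str mul0mx !scaler0.
- by rewrite -scalemxAl -scalemxAr mulmxA str mul0mx !scaler0.
- by rewrite -scalemxAl -scalemxAr [D r *m D s]factor_comm mulmxA trs mul0mx !scaler0.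
- by rewrite scaler_eq0 negb_or quad_neq0 invr_eq0 mulf_neq0 // d0.
- by rewrite scaler_eq0 negb_or quad_neq0 invr_eq0 mulf_neq0 // d0.
- by rewrite scaler_eq0 negb_or quad_neq0 invr_eq0 mulf_neq0 // d0.
- rewrite /E /F /G !quad_expand; move: (T *m T) => T2; entries; field;
    by rewrite !d0.
move=> l [u [fu EFGu]]; exists l, u; split=> //; apply: subv_trans EFGu.
have [mE mF mG] : let W := <<[:: E; F; G]>>%VS in [/\ E \in W, F \in W & G \in W].
  by split; apply: memv_span; rewrite !inE eqxx ?orbT.
apply: span3_sub.
- have -> : 1%:M = E + F + G.
    rewrite /E /F /G !quad_expand; move: (T *m T) => T2; entries; field;
    by rewrite !d0.
  by rewrite !memvD.
- have -> : T = r *: E + s *: F + t *: G.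
    rewrite /E /F /G !quad_expand; move: (T *m T) => T2; entries; field;
    by rewrite !d0.
  by rewrite !memvD // memvZ.
have -> : T *m T = r ^+ 2 *: E + s ^+ 2 *: F + t ^+ 2 *: G.
  rewrite /E /F /G !quad_expand; move: (T *m T) => T2; entries; field;
  by rewrite !d0.
by rewrite !memvD // memvZ.
Qed.

Lemma cubic_triple r : cubic r r r -> goal.
Proof.
move=> rrr; have [l fl] := fits_A3 (factor_sym r) rrr (quad_neq0 r r).
exists l, [:: 1%:M; D r; D r *m D r]; split=> //.
have [m1 mN mNN] : let W := <<[:: 1%:M; D r; D r *m D r]>>%VS in
    [/\ 1%:M \in W, D r \in W & D r *m D r \in W].
  by split; apply: memv_span; rewrite !inE eqxx ?orbT.
apply: span3_sub => //.
  have -> : T = D r + r *: 1%:M by entries; ring.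
  by rewrite memvD // memvZ.
have -> : T *m T = D r *m D r + (2 * r) *: D r + r ^+ 2 *: 1%:M.
  by rewrite quad_expand; move: (T *m T) => T2; entries; ring.
by rewrite !memvD // memvZ.
Qed.

Lemma cubic_double r t : r != t -> cubic r r t -> goal.
Proof.
move=> rt rrt; pose d := t - r; have d0 : d != 0 by rewrite subr_eq0 eq_sym.
(* [G] is the projection onto the eigenspace of the simple root [t]; [N] is the nilpotent part at
   [r], up to a factor, and [T] is recovered as [r + d G - N / d]. *)
pose G := d ^- 2 *: (D r *m D r); pose N := D r *m D t.
have Gt : G *m D t = 0 by rewrite -scalemxAl rrt scaler0.
have Gr : G *m D r = d *: G by apply: factor_eigen.
have [|||||||l fl] := @fits_A2 K G N.
- by rewrite linearZ /= quad_sym.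
- by rewrite {2}/G -scalemxAr mulmxA Gr -scalemxAl Gr
    2!scalerA -mulrA -expr2 mulVf ?scale1r // expf_neq0.
- by rewrite scaler_eq0 negb_or quad_neq0 invr_eq0 expf_neq0.
- exact: quad_sym.
- by rewrite /N factor_comm mulmxA Gt mul0mx.
- by rewrite /N mulmxA -[D r *m D t *m D r]mulmxA [D t *m _]factor_comm mulmxA rrt mul0mx.
- exact: quad_neq0.
exists l, [:: 1%:M; G; N]; split=> //.
have [m1 mG mN] : let W := <<[:: 1%:M; G; N]>>%VS in [/\ 1%:M \in W, G \in W & N \in W].
  by split; apply: memv_span; rewrite !inE eqxx ?orbT.
have TE : T = r *: 1%:M + d *: G - d^-1 *: N.
  by rewrite /G /N !quad_expand /d; move: (T *m T) => T2; entries; field.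
have mT : T \in <<[:: 1%:M; G; N]>>%VS by rewrite TE memvB ?memvD // memvZ.
apply: span3_sub => //.
have -> : T *m T = d ^+ 2 *: G + (2 * r) *: T - r ^+ 2 *: 1%:M.
  by rewrite /G !quad_expand /d; move: (T *m T) => T2; entries; field.
by rewrite memvB ?memvD // memvZ.
Qed.

Lemma cubic_case a b c : T *m T *m T = a *: (T *m T) + b *: T + c%:M -> goal.
Proof.
have [r [s [t [-> -> ->]]]] := cubic_roots a b c => T3.
have rst : cubic r s t.
  rewrite /cubic quad_expand /D mulmxBr !mulmxDl mulNmx T3 mul_scalar_mx.
  rewrite -scalemxAl !mul_mx_scalar; move: (T *m T) => T2; entries; ring.
have [rs|rs] := eqVneq r s.
  have [rt|rt] := eqVneq r t; first by move: rst; rewrite -rs -rt; apply: cubic_triple.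
  by move: rst; rewrite -rs; apply: cubic_double.
have [rt|rt] := eqVneq r t.
  by apply: (cubic_double rs); apply: cubic_swap; rewrite {2}rt.
have [st|st] := eqVneq s t; last exact: cubic_distinct rs rt st rst.
by apply: (@cubic_double s r); [rewrite eq_sym|apply: cubic_rot; rewrite {2}st].
Qed.
End CubicCase.

(** * Nets in which each member satisfies a quadratic equation *)

Section QuadraticCase.
Variable K : numClosedFieldType.

Lemma quad_pair_forms (S N : 'M[K]_5) sg rho : S^T = S -> N^T = N ->
    S *m S = sg%:M -> N *m N = 0 -> N *m S + S *m N = rho%:M ->
    N != 0 -> (forall t, S != t *: N) ->
  exists l s, fits l s /\ (<<[:: 1%:M; S; N]>> <= <<s>>)%VS.
Proof.
move=> symS symN SS NN NS N0 SN; have [rho0|rho0] := eqVneq rho 0; last first.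
  (* [E] and [E^T] are complementary idempotents: the rank of [E] would be 5/2. *)
  pose E := rho^-1 *: (N *m S); have ET : E^T = rho^-1 *: (S *m N).
    by rewrite linearZ /= trmx_mul symS symN.
  have EE : E *m E = E.
    have NSN : N *m S *m N = rho *: N.
      have SNE : S *m N = rho%:M - N *m S by rewrite -NS addrC addKr.
      by rewrite -mulmxA SNE mulmxBr mulmxA NN mul0mx subr0 mul_mx_scalar.
    rewrite /E -scalemxAl -scalemxAr mulmxA NSN -scalemxAl [_ *: (rho *: _)]scalerA.
    by rewrite mulVf // scale1r.
  have EEt : E *m E^T = 0.
    rewrite ET -scalemxAl -scalemxAr mulmxA -[N *m S *m S]mulmxA SS mul_mx_scalar.
    by rewrite -scalemxAl NN !scaler0.
  have EtE : E^T *m E = 0.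
    by rewrite ET -scalemxAl -scalemxAr mulmxA -[S *m N *m N]mulmxA NN mulmx0 mul0mx !scaler0.
  have EtEt : E^T *m E^T = E^T by rewrite -trmx_mul EE.
  have := rank_add_idem EE EtEt EEt EtE.
  rewrite ET -scalerDr NS scale_scalar_mx mulVf // -ET mxrank1 mxrank_tr addnn.
  by move/(congr1 odd); rewrite odd_double.
have {}NS : N *m S = - (S *m N).
  by apply/eqP; rewrite -addr_eq0 NS rho0 raddf0.
have [sg0|sg0] := eqVneq sg 0.
  rewrite sg0 raddf0 in SS; have [l fl] := fits_C symS symN SS NN NS N0 SN.
  by exists l, [:: 1%:M; S; N].
pose c := sqrtC sg; have c0 : c != 0 by rewrite sqrtC_eq0.
pose S' := c^-1 *: S; have SE : S = c *: S' by rewrite scalerA mulfV // scale1r.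
exists B2_112, [:: 1%:M; S'; N]; split.
  apply: fits_B2 => //.
  - by rewrite linearZ /= symS.
  - rewrite -scalemxAl -scalemxAr SS scalerA scale_scalar_mx -invfM -expr2 sqrtCK.
    by rewrite mulVf.
  - by rewrite -scalemxAl -scalemxAr NS scalerN.
have [m1 mS mN] : let W := <<[:: 1%:M; S'; N]>>%VS in [/\ 1%:M \in W, S' \in W & N \in W].
  by split; apply: memv_span; rewrite !inE eqxx ?orbT.
by apply: span3_sub => //; rewrite SE memvZ.
Qed.

Lemma free3_eq0 (V : vectType K) (x y z : V) : free [:: x; y; z] ->
  forall a b c, a *: x + b *: y + c *: z = 0 -> [/\ a = 0, b = 0 & c = 0].
Proof.
rewrite !free_cons span_cons span_seq1 => /and4P[Hx Hy Hz _] a b c abc.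
have a0 : a = 0.
  apply/eqP; apply: contraNT Hx => a0.
  have -> : x = a^-1 *: - (b *: y + c *: z).
    move: abc; rewrite -addrA => /eqP; rewrite addr_eq0 => /eqP <-.
    by rewrite scalerA mulVf // scale1r.
  by rewrite memvZ // memvN memv_add // memvZ // memv_line.
move: abc; rewrite a0 scale0r add0r => abc.
have b0 : b = 0.
  apply/eqP; apply: contraNT Hy => b0.
  have -> : y = b^-1 *: - (c *: z).
    move: abc => /eqP; rewrite addr_eq0 => /eqP <-.
    by rewrite scalerA mulVf // scale1r.
  by rewrite memvZ // memvN memvZ // memv_line.
move: abc; rewrite b0 scale0r add0r => /eqP; rewrite scaler_eq0 => /orP[/eqP //|/eqP z0].
by move: Hz; rewrite z0 mem0v.
Qed.

Variable L : {vspace 'M[K]_5}.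
Hypotheses (dimL : \dim L = 3%N) (L1 : 1%:M \in L).
Hypothesis symL : forall X, X \in L -> X^T = X.

Lemma quad_case :
    (forall T, T \in L -> exists x y, T *m T = x *: T + y%:M) ->
  exists l s, fits l s /\ (L <= <<s>>)%VS.
Proof.
move=> quadL; have h2 : 2 != 0 :> K by rewrite pnatr_eq0.
have L1' a : a%:M \in L by rewrite -scalemx1 memvZ.
have shift T : T \in L -> exists c y, (T - c%:M) *m (T - c%:M) = y%:M.
  move=> LT; have [x [y TT]] := quadL T LT; exists (x / 2), (y + (x / 2) ^+ 2).
  rewrite mulmxBl !mulmxBr TT mul_scalar_mx mul_mx_scalar -scalar_mxM.
  apply/matrixP => i j; rewrite !mxE; case: (i == j); rewrite ?mulr1n ?mulr0n; by field.
(* Completing the square makes the square of a member scalar, and the scalar shift stays outside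
   [W]. *)
have pick W : (\dim W < 3)%N -> 1%:M \in W ->
    exists X y, [/\ X \in L, X \notin W & X *m X = y%:M].
  move=> dimW W1; have /subvPn[T LT WT] : ~~ (L <= W)%VS.
    by apply: contraL dimW => /dimvS; rewrite dimL -leqNgt.
  have [c [y Tc]] := shift T LT; exists (T - c%:M), y; split=> //; first by rewrite memvB.
  by apply: contra WT => Wc; rewrite -[T](subrK c%:M) memvD // -scalemx1 memvZ.
have [|X [al [LX X1 XX]]] := @pick <[1%:M]>%VS _ (memv_line _).
  by rewrite dim_vline; case: (_ != 0).
have [||Y [be [LY XY YY]]] := @pick <<[:: X; 1%:M]>>%VS.
- exact: leq_ltn_trans (dim_span _) _.
- by rewrite memv_span // !inE eqxx orbT.
have freeYX : free [:: Y; X; 1%:M].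
  rewrite !free_cons XY span_seq1 X1 span_nil memv0 nil_free andbT /=.
  by apply/negP => /eqP/matrixP/(_ 0 0)/eqP; rewrite !mxE oner_eq0.
have indep := free3_eq0 freeYX.
have LE : L = <<[:: Y; X; 1%:M]>>%VS by apply: dim3_span.
(* The equations of [X + Y] and of [X - Y] give two expressions for the anticommutator; comparing
   coefficients of the independent [X] and [Y] kills the linear part. *)
have [p PE] : exists p, X *m Y + Y *m X = p%:M.
  have [m [k mk]] := quadL _ (memvD LX LY); have [m' [k' mk']] := quadL _ (memvB LX LY).
  have P1 : X *m Y + Y *m X = m *: X + m *: Y + (k - al - be)%:M.
    move: mk; rewrite mulmxDl !mulmxDr XX YY; move: (X *m Y) (Y *m X) => A B mk.
    have -> : A + B = al%:M + A + (B + be%:M) - al%:M - be%:M.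
      by apply/matrixP => i j; rewrite !mxE; ring.
    by rewrite mk scalerDr; apply/matrixP => i j; rewrite !mxE; case: (i == j); ring.
  have P2 : X *m Y + Y *m X = - (m' *: X) + m' *: Y + (al + be - k')%:M.
    move: mk'; rewrite mulmxBl !mulmxBr XX YY; move: (X *m Y) (Y *m X) => A B mk'.
    have -> : A + B = al%:M + be%:M - (al%:M - A - (B - be%:M)).
      by apply/matrixP => i j; rewrite !mxE; ring.
    by rewrite mk' scalerBr; apply/matrixP => i j; rewrite !mxE; case: (i == j); ring.
  have [] := @indep (m - m') (m + m') (k - al - be - (al + be - k')).
    rewrite -[RHS](subrr (X *m Y + Y *m X)) {1}P1 P2.
    by apply/matrixP => i j; rewrite !mxE; case: (i == j); ring.
  move=> /eqP; rewrite subr_eq0 => /eqP -> /eqP; rewrite -mulr2n -mulr_natr mulf_eq0.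
  rewrite pnatr_eq0 orbF => /eqP m0 _; exists (al + be - k').
  by rewrite P2 m0 !scale0r oppr0 !add0r.
have [symX symY] : X^T = X /\ Y^T = Y by split; apply: symL.
have [be0|be0] := eqVneq be 0.
  rewrite be0 raddf0 in YY.
  have [] := @quad_pair_forms X Y al p symX symY XX YY _ _ _.
  - by rewrite addrC.
  - by apply: contraNneq XY => ->; rewrite mem0v.
  - move=> t; apply/negP => /eqP XtY; have [|t0 /eqP] := indep t (-1) 0.
      by rewrite scaleN1r scale0r addr0 XtY subrr.
    by rewrite oppr_eq0 oner_eq0.
  move=> l [s [fs sub]]; exists l, s; split=> //; apply: subv_trans sub.
  by rewrite LE; apply: span3_sub; apply: memv_span; rewrite !inE eqxx ?orbT.
(* A root of [be u^2 + p u + al], the scalar to which [X + u Y] squares. *)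
have [u uE] := @solve_monicpoly K 2 (fun i => [:: - (al / be); - (p / be)]`_i) isT.
rewrite !big_ord_recl big_ord0 /= in uE.
have [] := @quad_pair_forms Y (X + u *: Y) be (p + 2 * (u * be)) symY _ YY _ _ _ _.
- by rewrite linearD linearZ /= symX symY.
- rewrite mulmxDl !mulmxDr -!scalemxAl -!scalemxAr XX YY.
  have -> : al%:M + u *: (X *m Y) + (u *: (Y *m X) + u *: (u *: be%:M)) =
      al%:M + u *: (X *m Y + Y *m X) + u ^+ 2 *: be%:M.
    by rewrite scalerDr scalerA !addrA.
  rewrite PE uE; apply/matrixP => i j; rewrite !mxE.
  case: (i == j); rewrite ?mulr1n ?mulr0n; field => //.
- rewrite mulmxDl mulmxDr -scalemxAl -scalemxAr YY addrACA PE.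
  by apply/matrixP => i j; rewrite !mxE; case: (i == j); ring.
- apply/negP => /eqP XuY; have [|_ /eqP] := indep u 1 0.
    by rewrite scale1r scale0r addr0 addrC.
  by rewrite oner_eq0.
- move=> t; apply/negP => /eqP YtN; have [|tu t0 _] := indep (t * u - 1) t 0.
    have -> : (t * u - 1) *: Y + t *: X + 0 *: 1%:M = t *: (X + u *: Y) - Y.
      by apply/matrixP => i j; rewrite !mxE; ring.
    by rewrite -YtN subrr.
  by move: tu => /eqP; rewrite t0 mul0r sub0r oppr_eq0 oner_eq0.
move=> l [s [fs sub]]; exists l, s; split=> //; apply: subv_trans sub.
have [m1 mY mN] : let W := <<[:: 1%:M; Y; (X + u *: Y)%R]>>%VS in
    [/\ 1%:M \in W, Y \in W & X + u *: Y \in W].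
  by split; apply: memv_span; rewrite !inE eqxx ?orbT.
rewrite LE; apply: span3_sub => //.
by have := memvB mN (memvZ u mY); rewrite addrK.
Qed.

Hypothesis sqrL : forall X, X \in L -> X *m X \in L.

Lemma classification_unit1 : exists l, congruent (net K l) L.
Proof.
suff [l [s [fs Ls]]] : exists l s, fits l s /\ (L <= <<s>>)%VS.
  by exists l; apply: fits_congruent dimL Ls fs.
have [[T [LT notquad]]|quadL] := pselect (exists T, T \in L /\
    forall x y, T *m T != x *: T + y%:M); last first.
  apply: quad_case => T LT; apply: contrapT => H; apply: quadL; exists T; split=> // x y.
  by apply/negP => /eqP TT; apply: H; exists x, y.
have free1 : free [:: T *m T; T; 1%:M].
  rewrite !free_cons span_seq1 span_nil memv0 nil_free andbT.
  apply/and3P; split.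
  - apply/negP => /mem_span2[x [y TT]]; case/negP: (notquad x y).
    by rewrite TT scalemx1.
  - apply/negP => /vlineP[c TE]; case/negP: (notquad 0 (c * c)).
    by rewrite scale0r add0r TE scalemx1 -scalar_mxM.
  - by apply/negP => /eqP/matrixP/(_ 0 0)/eqP; rewrite !mxE oner_eq0.
have LE : L = <<[:: T *m T; T; 1%:M]>>%VS by apply: dim3_span => //; apply: sqrL.
have : T *m T *m T \in L.
  (* Only closure under squares is assumed; the cube is obtained by polarizing the square at [T^2]
     and [T]. *)
  have -> : T *m T *m T = 2^-1 *: ((T *m T + T) *m (T *m T + T)
      - T *m T *m (T *m T) - T *m T).
    rewrite mulmxDl !mulmxDr !mulmxA; move: (T *m T *m T *m T) (T *m T *m T) (T *m T) => A B C.
    have h2 : 2 != 0 :> K by rewrite pnatr_eq0.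
    by apply/matrixP => i j; rewrite !mxE; field.
  have LTT := sqrL LT.
  by rewrite memvZ // !memvB //; apply: sqrL => //; apply: memvD.
rewrite {1}LE => /mem_span3[a [b [c TTT]]]; rewrite scalemx1 in TTT.
have [l [s [fs sub]]] := cubic_case (symL LT) notquad TTT.
exists l, s; split=> //; apply: subv_trans sub; rewrite LE.
by apply: span3_sub; apply: memv_span; rewrite !inE eqxx ?orbT.
Qed.
End QuadraticCase.

Section Classification.
Variable K : numClosedFieldType.

Lemma classification (L : {vspace 'M[K]_5}) :
  jordan_net L -> exists k, congruent (net K k) L.
Proof.
case=> /jordan_spaceP[symL [U [LU uU LM]]] dimL.
have [h uh hUh] := orthonormalize (symL U LU) uU.
(* Hence [h] carries [X U^-1 X] to the ordinary square of [h X h^T]. *)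
have VE : invmx U = h^T *m h.
  have hhU : h^T *m h *m U = 1%:M.
    have uhT : h^T \in unitmx by rewrite unitmx_tr.
    apply: (can_inj (mulmxK uhT)).
    by rewrite -!mulmxA [h *m (U *m _)]mulmxA hUh mulmx1 mul1mx.
  by rewrite -[RHS]mulmx1 -(mulmxV uU) mulmxA hhU mul1mx.
have LL' : congruent L (congr_act h L) by exists h.
have [||X|X|k kL'] := @classification_unit1 K (congr_act h L).
- by rewrite dim_congr_act.
- by apply/mem_congr_act; exists U.
- by case/mem_congr_act => Y /symL symY ->; rewrite compress_sym.
- case/mem_congr_act => Y LY ->; apply/mem_congr_act; exists (jprod U Y Y); first exact: LM.
  by rewrite jprodxx VE !mulmxA.
by exists k; apply: congruent_trans kL' (congruent_sym LL').
Qed.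
End Classification.

Theorem theorem4p3 (R : realType) :
  [/\ forall k : net5, jordan_net (net R[i] k),
      forall L : {vspace 'M[R[i]]_5}, jordan_net L ->
        exists k : net5, congruent (net R[i] k) L,
      forall k l : net5, congruent (net R[i] k) (net R[i] l) -> k = l
    & forall k l : net5, degenerates (net R[i] k) (net R[i] l) <->
        exists2 p : seq net5, path net_edge k p & last k p = l].
Proof.
split.
- by move=> k; apply: jordan_net_net.
- by move=> L; apply: classification.
- by move=> k l; apply: congruent_net_inj.
- by move=> k l; apply: degenerates_net.
Qed.
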